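(* Let $\Omega\subset\mathbb R^n$ ($n\ge3$) be a smooth bounded open set. There exists $\rho>0$ such that the set $\{\theta\in\mathfrak B_\rho:\psi_{\Omega_\theta}\text{ is a Morse function}\}$ is a residual (hence dense) subset of $\mathfrak B_\rho$.
   Context: $\mathfrak C^2$ is the Banach space of $C^2$ maps $\theta:\mathbb R^n\to\mathbb R^n$ with $\|\theta\|_2=\max_{i}\max_{0\le|\ell|\le2}\sup_{x\in\mathbb R^n}|\partial^\ell\theta_i(x)|<\infty$; $\mathfrak B_\rho=\{\theta\in\mathfrak C^2:\|\theta\|_2\le\rho\}$. For $\theta\in\mathfrak C^2$, $\Omega_\theta=\{x+\theta(x):x\in\Omega\}$. For an open bounded set $D$, $\psi_D:D\to\mathbb R$, $\psi_D(x)=\int_{\mathbb R^n\setminus D}|x-y|^{-2n}dy$. A $C^2$ function is a Morse function if all its critical points are nondegenerate (nonsingular Hessian). A subset $A\subset B$ is residual if $B\setminus A$ is a countable union of closed subsets of $B$ with empty interior. *)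

(* Defs.v *)
From mathcomp Require Import all_boot all_order all_algebra.
From mathcomp Require Import all_classical all_reals all_analysis.
Set Implicit Arguments. Unset Strict Implicit. Unset Printing Implicit Defensive.
Import Order.TTheory GRing.Theory Num.Theory.
Import numFieldNormedType.Exports.
Local Open Scope classical_set_scope.
Local Open Scope ring_scope.

Section Defs.
Variables (R : realType) (n : nat).
Notation Rn := 'rV[R]_n.

Definition evec (j : 'I_n) : Rn := \row_(k < n) (if k == j then 1 else 0).
Definition partial (j : 'I_n) (f : Rn -> R) : Rn -> R := fun x => 'D_(evec j) f x.

Definition enorm (x : Rn) : R := Num.sqrt (\sum_(i < n) (x ord0 i) ^+ 2).

Fixpoint Ck (k : nat) (U : set Rn) (f : Rn -> R) : Prop :=
  match k with
  | 0 => forall x, U x -> {for x, continuous f}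
  | k'.+1 => (forall x, U x -> differentiable f x) /\
             (forall j, Ck k' U (partial j f))
  end.

Definition smooth_on (U : set Rn) (f : Rn -> R) := forall k, Ck k U f.

Definition smooth_bounded_open (Om : set Rn) : Prop :=
  [/\ open Om,
      (exists M : R, forall x, Om x -> enorm x <= M) &
      (forall p, closure Om p -> ~ Om p ->
         exists (r : R) (phi : Rn -> R),
           [/\ 0 < r, smooth_on setT phi, (exists j, partial j phi p != 0) &
               forall x, enorm (x - p) < r -> (Om x <-> phi x < 0)])].

Definition hessian (f : Rn -> R) (x : Rn) : 'M[R]_n :=
  \matrix_(i < n, j < n) partial i (partial j f) x.

Definition Morse_on (D : set Rn) (f : Rn -> R) : Prop :=
  Ck 2 D f /\
  forall x, D x -> (forall j, partial j f x = 0) -> hessian f x \in unitmx.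

Definition comp (i : 'I_n) (th : Rn -> Rn) : Rn -> R := fun x => th x ord0 i.

Definition deriv_le2 (f g : Rn -> R) : Prop :=
  g = f \/ (exists j, g = partial j f) \/
  (exists j k, g = partial j (partial k f)).

Definition C2map (th : Rn -> Rn) : Prop := forall i, Ck 2 setT (comp i th).

Definition C2norm (th : Rn -> Rn) : \bar R :=
  ereal_sup [set e | exists i g x, deriv_le2 (comp i th) g /\ e = (`|g x|)%:E].

Definition Bball (rho : R) : set (Rn -> Rn) :=
  [set th | C2map th /\ (C2norm th <= rho%:E)%E].

Definition C2dist (th ph : Rn -> Rn) : \bar R := C2norm (fun x => th x - ph x).

Definition rel_closed (B F : set (Rn -> Rn)) : Prop :=
  F `<=` B /\
  forall th, B th ->
    (forall eps : R, 0 < eps -> exists ph, F ph /\ (C2dist th ph < eps%:E)%E) ->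
    F th.

Definition rel_empty_interior (B F : set (Rn -> Rn)) : Prop :=
  ~ exists th (eps : R), [/\ F th, 0 < eps &
       forall ph, B ph -> (C2dist th ph < eps%:E)%E -> F ph].

Definition residual_in (B A : set (Rn -> Rn)) : Prop :=
  A `<=` B /\
  exists F : nat -> set (Rn -> Rn),
    (forall k, rel_closed B (F k) /\ rel_empty_interior B (F k)) /\
    B `\` A = \bigcup_k F k.

Definition deform (Om : set Rn) (th : Rn -> Rn) : set Rn :=
  [set x + th x | x in Om].

End Defs.

(* Lebesgue integral over R^n of a nonnegative function, as the iterated
   one-dimensional Lebesgue integral (Tonelli). *)
Fixpoint iint {R : realType} (n : nat) : ('rV[R]_n -> \bar R) -> \bar R :=
  match n with
  | 0 => fun f => f 0
  | n'.+1 => fun f =>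
      (\int[@lebesgue_measure R]_(t in setT)
         iint (fun y : 'rV[R]_n' => f (@row_mx R 1 1 n' (t%:M) y)))%E
  end.

Definition psi {R : realType} {n : nat} (D : set 'rV[R]_n) (x : 'rV[R]_n) : R :=
  fine (iint (fun y : 'rV[R]_n =>
     ((\1_(~` D) y : R) * (enorm (x - y)) ^- (2 * n))%:E)).

(* Main.v *)
(* For z in Om consider the maps theta for which x + theta x has a degenerate
   critical point of psi with x in a small compact cube K around z.  Countably
   many rational cubes cover Om, so it is enough that such a set of maps is
   closed and has empty interior.

   Closed: on the complement of the deformed domain, the derivatives of psi are
   integrals of derivatives of |x - y|^(-2n).  The deformed boundary is a null
   set, because locally it is a graph and so has infinitely many disjoint
   translates in a bounded region; by dominated convergence gradient and
   Hessian depend continuously on theta.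

   Empty interior: shrink theta by a factor 1 - eta, which makes room in the
   ball, and push the boundary of Om outwards by small bumps near the points
   where the n coordinate half-lines from z leave Om.  Use the volumes a_i
   gained at the bumps as parameters.  Moving bump i changes the gradient of
   psi near z by a vector nearly parallel to e_i, of size comparable to the
   gained volume, whence |grad(a, x) - grad(a', x)| >= c |a - a'|.  A Sard
   argument by counting then gives a parameter without degenerate zeros: cut
   the x-cube into O(Q^n) cells of size 1/Q.  The parameters with a degenerate zero in a given cell lie
   within O(1/Q) of each other, and within O(1/Q^2) in the direction orthogonal
   to the range of the Hessian; so each cell accounts for only O(Q^(n-1)) of the
   Q^(2n) parameters of a grid of mesh 1/Q^2. *)
Require Import Defs.
From HB Require Import structures.
From mathcomp Require Import all_boot all_order all_algebra.
From mathcomp Require Import all_classical all_reals all_analysis.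
From mathcomp Require Import ring lra measurable_realfun.
Set Implicit Arguments. Unset Strict Implicit. Unset Printing Implicit Defensive.
Import Order.TTheory GRing.Theory Num.Def Num.Theory.
Import numFieldNormedType.Exports.
Local Open Scope classical_set_scope.
Local Open Scope ring_scope.

(** * Rows with the supremum norm *)

(** Differentiating [psi] in the amplitudes of the bumps would lead to integrals over a moving
    boundary. With gained volumes as parameters, a difference of gradients or Hessians is an
    integral of a bounded kernel over the gained sets, so volume alone bounds it from above and, in
    the direction of the bump, from below. The price is that nothing is differentiable in the
    parameter, which rules out the usual transversality theorem and leads to the count. The count
    has one power of Q to spare: O(Q^n) cells times O(Q^(n-1)) parameters is O(Q^(2n-1)).

    The radius comes from directions. Maps in the ball of radius rho have Lipschitz constant n rho =
    1/(16 n) in the supremum norm. This is small enough for x + theta(x) to be a homeomorphism, to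
    keep the cones along which the domain lies below a graph, and to let bump i be seen from near z
    in direction e_i with lateral error 1/(4 n); the gradient increments then form a diagonally
    dominant matrix. *)

Lemma fin_pos_common {R : realType} (I : finType) (P : I -> R -> Prop) :
  (forall i, exists2 d, 0 < d & P i d) ->
  (forall i d d', 0 < d' -> d' <= d -> P i d -> P i d') ->
  exists2 d, 0 < d & forall i, P i d.
Proof.
move=> H mono.
have /choice[f Hf] : forall i, exists d, 0 < d /\ P i d.
  by move=> i; have [d d0 Pd] := H i; exists d.
have S0 : 0 < 1 + \sum_i (f i)^-1.
  rewrite ltr_wpDr //; apply: sumr_ge0 => i _; rewrite invr_ge0 ltW //; exact: (Hf i).1.
(* Below every [f i], and still positive when [I] is empty. *)
exists (1 + \sum_i (f i)^-1)^-1; first by rewrite invr_gt0.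
move=> i; apply: (mono i (f i)); [by rewrite invr_gt0| |exact: (Hf i).2].
have fi := (Hf i).1.
rewrite -[leRHS]invrK lef_pV2 ?posrE ?invr_gt0 // (bigD1 i) //=.
rewrite addrCA lerDl addr_ge0 //; apply: sumr_ge0 => k _.
by rewrite invr_ge0 ltW //; exact: (Hf k).1.
Qed.

Lemma fin_bound_common {R : realType} (I : finType) (P : I -> R -> Prop) :
  (forall i, exists2 C, 0 <= C & P i C) ->
  (forall i C C', C <= C' -> P i C -> P i C') ->
  exists2 C, 0 <= C & forall i, P i C.
Proof.
move=> H mono.
have /choice[f Hf] : forall i, exists C, 0 <= C /\ P i C.
  by move=> i; have [C C0 PC] := H i; exists C.
exists (\sum_i f i); first by apply: sumr_ge0 => i _; exact: (Hf i).1.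
move=> i; apply: mono (Hf i).2; rewrite (bigD1 i) //= lerDl.
by apply: sumr_ge0 => k _; exact: (Hf k).1.
Qed.

Lemma continuous_pos {R : realType} {n : nat} (f : 'rV[R]_n -> R) x (e : R) :
  {for x, continuous f} -> 0 < e ->
  exists2 d, 0 < d & forall y, `|y - x| < d -> `|f y - f x| < e.
Proof.
move=> cf e0; have := cf (ball (f x) e) (nbhsx_ballx _ _ e0).
move=> /nbhs_ballP[d /= d0 H]; exists d => // y yx.
have : ball x d y by rewrite -ball_normE /= distrC.
by move=> /H; rewrite -ball_normE /= distrC.
Qed.

Lemma open_ball_in {R : realType} {n : nat} (U : set 'rV[R]_n) x : open U -> U x ->
  exists2 e : R, 0 < e & forall u, `|x - u| < e -> U u.
Proof.
move=> oU Ux; have /nbhs_ballP[e /= e0 H] : nbhs x U by exact: open_nbhs_nbhs.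
by exists e => // u xu; apply: H; rewrite -ball_normE.
Qed.

Section SupNorm.
Context {R : realType} {n : nat}.
Implicit Types (x y : 'rV[R]_n) (e : R).

Lemma normr_row_le x e : 0 <= e -> (forall j, `|x ord0 j| <= e) -> `|x| <= e.
Proof.
move=> e0 H; rewrite [leLHS]/normr /= mx_normrE; apply/bigmax_leP; split=> //.
by move=> [i j] _ /=; rewrite (ord1 i).
Qed.

Lemma normr_row_lt x e : 0 < e -> (forall j, `|x ord0 j| < e) -> `|x| < e.
Proof.
move=> e0 H; rewrite [ltLHS]/normr /= mx_normrE; apply/bigmax_ltP; split=> //.
by move=> [i j] _ /=; rewrite (ord1 i).
Qed.

Lemma coord_le_norm x j : `|x ord0 j| <= `|x|.
Proof.
rewrite [leRHS]/normr /= mx_normrE.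
by apply: (@le_bigmax _ _ _ 0 (fun ij : 'I_1 * 'I_n => `|x ij.1 ij.2|) (ord0, j)).
Qed.

Lemma rowDE x y j : (x + y) ord0 j = x ord0 j + y ord0 j.
Proof. by rewrite mxE. Qed.

Lemma rowBE x y j : (x - y) ord0 j = x ord0 j - y ord0 j.
Proof. by rewrite mxE [(- y) _ _]mxE. Qed.

Lemma rowZE e x j : (e *: x) ord0 j = e * x ord0 j.
Proof. by rewrite mxE. Qed.

Lemma ball_rowE x e y : ball x e y = (`|x - y| < e) :> Prop.
Proof. by rewrite -ball_normE. Qed.

Lemma norm_evec (j : 'I_n) : `|evec R j| = 1.
Proof.
apply/eqP; rewrite eq_le; apply/andP; split.
  apply: normr_row_le => // k; rewrite mxE; case: ifP => _; rewrite ?normr1 ?normr0 //.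
by have := coord_le_norm (evec R j) j; rewrite mxE eqxx normr1.
Qed.

Lemma row_evecE x : x = \sum_j x ord0 j *: evec R j.
Proof.
apply/rowP => k; rewrite summxE (bigD1 k) //= big1 ?addr0.
  by rewrite !mxE eqxx mulr1.
by move=> j jk; rewrite !mxE eq_sym (negbTE jk) mulr0.
Qed.

End SupNorm.

(** * Borel sets of the space of rows *)

Notation BR R n := (g_sigma_algebraType (@open 'rV[R]_n)).

Section Borel.
Context {R : realType} {n : nat}.
Implicit Types (U : set 'rV[R]_n).

Lemma open_measurable_row U : open U -> measurable (U : set (BR R n)).
Proof. by move=> oU; apply: sub_sigma_algebra. Qed.

Lemma row_rat_approx (x : 'rV[R]_n) (e : R) : 0 < e ->
  exists c : 'rV[rat]_n, `|x - map_mx ratr c| < e.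
Proof.
move=> e0.
have H j : exists q : rat, `|x ord0 j - ratr q| < e.
  have : x ord0 j - e < x ord0 j + e by lra.
  move=> /rat_in_itvoo[q]; rewrite in_itv /= => /andP[q1 q2]; exists q.
  by rewrite ltr_norml; apply/andP; split; lra.
pose f j := proj1_sig (cid (H j)).
exists (\row_j f j); apply: normr_row_lt => // j.
by rewrite !mxE /f; case: (cid (H j)).
Qed.

(* The supremum norm makes rational balls products of intervals, so openness
   of a set decomposes coordinatewise. *)
Lemma measurable_fun_row d (T : measurableType d) (h : T -> 'rV[R]_n) :
  (forall j, measurable_fun setT (fun t => h t ord0 j)) ->
  measurable_fun setT (h : T -> BR R n).
Proof.
move=> mh; apply: (@measurability _ _ T (BR R n) setT h (@open 'rV[R]_n)) => //.
move=> _ [U oU <-]; rewrite setTI.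
pose P (p : 'rV[rat]_n * nat) : set T :=
  if `[< forall y : 'rV[R]_n, `|map_mx ratr p.1 - y| < p.2.+1%:R^-1 -> U y >]
  then \bigcap_(j : 'I_n) [set t | `|ratr (p.1 ord0 j) - h t ord0 j| < p.2.+1%:R^-1]
  else set0.
have -> : h @^-1` U = \bigcup_p P p.
  apply/seteqP; split => [t /= Ut|t [[c k] _]]; last first.
    rewrite /P /=; case: asboolP => // H Ht; apply: H.
    apply: normr_row_lt; first by rewrite invr_gt0.
    by move=> j; rewrite !mxE; exact: (Ht j).
  have /nbhs_ballP[e /= e0 he] : nbhs (h t) U by exact: open_nbhs_nbhs.
  have [k hk] : exists k : nat, k.+1%:R^-1 < e / 2.
    have [k] := ltr_add_invr (y := 0 : R) (x := e/2) ltac:(lra).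
    by rewrite add0r => hk; exists k.
  have [|c hc] := @row_rat_approx (h t) (k.+1%:R^-1); first by rewrite invr_gt0.
  exists (c, k) => //; rewrite /P /=; case: asboolP => [_ j _ /=|nH]; last first.
    exfalso; apply: nH => y hy; apply: he; rewrite ball_rowE.
    have -> : h t - y = (h t - map_mx ratr c) + (map_mx ratr c - y) by rewrite addrA subrK.
    apply: le_lt_trans (ler_normD _ _) _; rewrite (splitr e).
    by rewrite ltrD // (lt_trans _ hk).
  apply: le_lt_trans hc; rewrite distrC.
  by have := coord_le_norm (h t - map_mx ratr c) j; rewrite !mxE.
apply: countable_bigcupT_measurable; first exact: countableP.
move=> [c k]; rewrite /P /=; case: asboolP => // _.
apply: fin_bigcap_measurable => [|j _]; first exact: finite_finset.
have mf : measurable_fun setT (fun t => `|ratr (c ord0 j) - h t ord0 j|).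
  apply: measurableT_comp => //; apply: measurable_funB => //.
have := mf measurableT `]-oo, k.+1%:R^-1[%classic (measurable_itv _).
by rewrite setTI; congr measurable; apply/seteqP; split=> t /=; rewrite in_itv.
Qed.

Lemma continuous_measurable_row U (f : 'rV[R]_n -> R) : open U ->
  (forall x, U x -> {for x, continuous f}) ->
  measurable_fun (U : set (BR R n)) (f : BR R n -> R).
Proof.
move=> oU cf; apply: (measurability _ (RGenOpens.measurableE R)) => //.
move=> _ [_ [a [b ->]] <-]; apply: open_measurable_row.
rewrite openE => x [Ux fx]; apply: filterI; first exact: open_nbhs_nbhs.
by apply: (cf x Ux); apply: open_nbhs_nbhs; split => //; exact: interval_open.
Qed.

Lemma measurable_coord j : measurable_fun setT (fun x : BR R n => x ord0 j : R).
Proof.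
apply: continuous_measurable_row; first exact: openT.
by move=> x _; exact: coord_continuous.
Qed.

End Borel.

(** * Lebesgue measure on rows *)

Section ConsRow.
Context {R : realType} {n : nat}.
Implicit Types (t : R) (y : 'rV[R]_n).

(** The same splitting of a row as in [iint], so the product measure pushed forward along it
    computes the iterated integral. *)
Definition cons_row (p : R * 'rV[R]_n) : 'rV[R]_n.+1 :=
  @row_mx R 1 1 n (p.1%:M) p.2.

Lemma cons_row0 p : cons_row p ord0 ord0 = p.1.
Proof.
have <- : lshift n (ord0 : 'I_1) = (ord0 : 'I_n.+1) by exact: val_inj.
by rewrite (@row_mxEl R 1 1 n p.1%:M p.2 ord0 ord0) mxE eqxx mulr1n.
Qed.

Lemma cons_rowS p j : cons_row p ord0 (lift ord0 j) = p.2 ord0 j.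
Proof.
have <- : rshift 1 j = lift (ord0 : 'I_n.+1) j by exact: val_inj.
by rewrite (@row_mxEr R 1 1 n p.1%:M p.2 ord0 j).
Qed.

Lemma cons_row_surj (v : 'rV[R]_n.+1) : exists p, v = cons_row p.
Proof.
exists (v ord0 ord0, \row_j v ord0 (lift ord0 j)).
by apply/rowP => i; case: (unliftP ord0 i) => [j|] ->;
  rewrite ?cons_row0 ?cons_rowS ?mxE.
Qed.

Lemma cons_rowD p q : cons_row p + cons_row q = cons_row (p.1 + q.1, p.2 + q.2).
Proof.
by apply/rowP => i; case: (unliftP ord0 i) => [j|] ->;
  rewrite rowDE ?cons_row0 ?cons_rowS ?rowDE.
Qed.

(** Balls of the supremum norm are products, hence so are their volumes. *)
Lemma cons_row_dist p q e : 0 < e ->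
  `|cons_row p - cons_row q| < e <-> `|p.1 - q.1| < e /\ `|p.2 - q.2| < e.
Proof.
move=> e0; split => [H|[H1 H2]].
  split.
    apply: le_lt_trans H; have := coord_le_norm (cons_row p - cons_row q) ord0.
    by rewrite ?rowBE !cons_row0.
  apply: normr_row_lt => // j; apply: le_lt_trans H.
  have := coord_le_norm (cons_row p - cons_row q) (lift ord0 j).
  by rewrite ?rowBE !cons_rowS.
apply: normr_row_lt => // i; case: (unliftP ord0 i) => [j|] ->;
  rewrite ?rowBE ?cons_row0 ?cons_rowS //.
by apply: le_lt_trans H2; have := coord_le_norm (p.2 - q.2) j; rewrite ?rowBE.
Qed.

Lemma measurable_cons_row :
  measurable_fun setT (cons_row : measurableTypeR R * BR R n -> BR R n.+1).
Proof.
apply: measurable_fun_row => i; case: (unliftP ord0 i) => [j|] ->.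
  rewrite (_ : (fun _ => _) = (fun p : measurableTypeR R * BR R n => p.2 ord0 j)).
    exact: (measurableT_comp (measurable_coord j) measurable_snd).
  by apply/funext => p; rewrite cons_rowS.
rewrite (_ : (fun _ => _) = (fun p : measurableTypeR R * BR R n => p.1)).
  exact: measurable_fst.
by apply/funext => p; rewrite cons_row0.
Qed.

End ConsRow.

Section OneDim.
Context {R : realType}.
Local Notation leb := (@lebesgue_measure R).

(** The shifted measure gives half-open intervals their length, and Lebesgue measure is unique with
    this property. *)
Lemma lebesgue_translation (v : R) (A : set (measurableTypeR R)) : measurable A ->
  leb [set t | A (t + v)] = leb A.
Proof.
move=> mA.
have mf : measurable_fun setT
  ((fun t => t + v) : measurableTypeR R -> measurableTypeR R).
  exact: measurable_funD.
apply/esym.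
have := @lebesgue_measure_unique R (pushforward leb
  ((fun t => t + v) : measurableTypeR R -> measurableTypeR R)).
apply => // _ [[a b]] _ <-; rewrite /pushforward.
transitivity (leb `]a - v, b - v]%classic).
  rewrite !lebesgue_measure_itv /= !lte_fin ltrD2r; case: ifP => // _.
  by rewrite -!EFinB; congr EFin; lra.
congr (leb _); apply/seteqP; split => t /=; rewrite !in_itv /= => /andP[h1 h2];
  by apply/andP; split; lra.
Qed.

Lemma lebesgue_integral_translation (v : R) (f : measurableTypeR R -> \bar R) :
  measurable_fun setT f -> (forall t, 0 <= f t)%E ->
  (\int[leb]_t f (t + v)%R = \int[leb]_t f t)%E.
Proof.
move=> mf f0.
pose sh : measurableTypeR R -> measurableTypeR R := fun t => t + v.
have mv : measurable_fun setT sh.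
  exact: measurable_funD.
transitivity (\int[pushforward leb sh]_t f t)%E.
  by rewrite ge0_integral_pushforward.
apply: eq_measure_integral => A mA _.
exact: lebesgue_translation.
Qed.

Lemma integral_oneDsqr_lty :
  (\int[leb]_t (1 + t ^+ 2)^-1%:E < +oo)%E.
Proof.
rewrite (_ : (fun t : R => _) = EFin \o (fun t => (oneDsqr t)^-1)) //.
rewrite ge0_symfun_integralT.
- rewrite -set_itvcy; have := integral0y_oneDsqr R; rewrite /= => ->.
  by rewrite -EFinM ltry.
- by move=> x; rewrite invr_ge0 addr_ge0 ?sqr_ge0.
- exact: continuous_oneDsqrV.
- by move=> x /=; rewrite /oneDsqr sqrrN.
Qed.

End OneDim.

Section SigmaFinitePack.
Context {R : realType} d (T : measurableType d) (mu : {measure set T -> \bar R})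
  (sf : sigma_finite setT mu).

(** The pushforward built below comes with a proof of sigma-finiteness but not with the bundled
    structure that Fubini expects. This alias, indexed by the proof, carries the instance. *)
Let nu (_ : sigma_finite setT mu) : set T -> \bar R := mu.
Let nu0 : nu sf set0 = 0%E. Proof. exact: measure0. Qed.
Let nu_ge0 A : (0 <= nu sf A)%E. Proof. exact: measure_ge0. Qed.
Let nu_sigma_additive : semi_sigma_additive (nu sf).
Proof. exact: measure_semi_sigma_additive. Qed.
HB.instance Definition _ := isMeasure.Build _ _ _ (nu sf) nu0 nu_ge0 nu_sigma_additive.
HB.instance Definition _ := Measure_isSigmaFinite.Build _ _ _ (nu sf) sf.

Lemma sigma_finite_pack : exists m : {sigma_finite_measure set T -> \bar R},
  (m : set T -> \bar R) = mu.
Proof. by exists (nu sf). Qed.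

End SigmaFinitePack.

(* An integrable function that dominates |x|^(-2n) away from the origin up to a
   constant. *)
Definition weight {R : realType} {n : nat} (x : 'rV[R]_n) : R :=
  \prod_j (1 + x ord0 j ^+ 2)^-1.

(** An interface to Lebesgue measure in dimension n. [volume_iint] ties it to [psi]; translations
    and finite balls make boundaries null; positive balls make the gained volumes positive; [weight]
    supplies dominating functions. *)
Record is_volume {R : realType} {n : nat}
    (mu : {sigma_finite_measure set (BR R n) -> \bar R}) : Prop := IsVolume {
  volume_iint : forall f : BR R n -> \bar R, measurable_fun setT f ->
    (forall x, 0 <= f x)%E -> iint f = (\int[mu]_x f x)%E ;
  volume_translation : forall (v : 'rV[R]_n) (A : set (BR R n)), measurable A ->
    mu [set x : 'rV[R]_n | A (x + v)] = mu A ;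
  volume_ball_lty : forall (c : 'rV[R]_n) (e : R),
    (mu [set x : 'rV[R]_n | (`|c - x| < e)%R] < +oo)%E ;
  volume_ball_gt0 : forall (c : 'rV[R]_n) (e : R), 0 < e ->
    (0 < mu [set x : 'rV[R]_n | (`|c - x| < e)%R])%E ;
  volume_weight_lty :
    (\int[mu]_x (weight (x : 'rV[R]_n))%:E < +oo)%E
}.

Section VolumeExists.
Context {R : realType}.

Lemma weight_ge0 n (x : 'rV[R]_n) : 0 <= weight x.
Proof. by apply: prodr_ge0 => j _; rewrite invr_ge0 addr_ge0 ?sqr_ge0. Qed.

Lemma measurable_weight n : measurable_fun setT (weight : BR R n -> R).
Proof.
apply: measurable_prod => j _.
apply: (@measurableT_comp _ _ _ _ _ _ (fun t : R => (1 + t ^+ 2)^-1)); last first.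
  exact: measurable_coord.
exact: (continuous_measurable_fun (@continuous_oneDsqrV R)).
Qed.

Lemma volume0 : exists mu : {sigma_finite_measure set (BR R 0) -> \bar R}, is_volume mu.
Proof.
have mu0 : forall x : BR R 0, x = (0 : 'rV[R]_0) by move=> x; apply/rowP => -[].
have sf : sigma_finite setT (\d_(0 : BR R 0) : set (BR R 0) -> \bar R).
  apply: fin_num_fun_sigma_finite; first by rewrite measure0.
  by move=> A mA; rewrite diracE.
have [mu Emu] := sigma_finite_pack sf.
have EI (f : BR R 0 -> \bar R) : measurable_fun setT f ->
    (\int[mu]_x f x)%E = f (0 : 'rV[R]_0).
  move=> mf; rewrite (eq_measure_integral (\d_(0 : BR R 0))); last by move=> A _ _; rewrite -Emu.
  by rewrite integral_dirac // diracT mul1e.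
exists mu; split.
- by move=> f mf _; rewrite EI.
- move=> v A mA; congr (mu _); apply/seteqP; split => x /=; by rewrite (mu0 (x + v)) (mu0 x).
- by move=> c e; rewrite Emu /= diracE ltry.
- move=> c e e0; rewrite Emu /= diracE mem_set ?lte_fin //=.
  have -> : c - 0 = 0 :> 'rV[R]_0 by apply/rowP => -[].
  by rewrite normr0.
- rewrite EI ?ltry //; apply: measurableT_comp => //; exact: measurable_weight.
Qed.

Section Step.
Context {n : nat} (mu : {sigma_finite_measure set (BR R n) -> \bar R}).
Hypothesis Hmu : is_volume mu.
Local Notation leb := (@lebesgue_measure R).
Local Notation phi := (@cons_row R n : measurableTypeR R * BR R n -> BR R n.+1).
Local Notation prd := (leb \x mu)%E.

Let mphi : measurable_fun setT phi := measurable_cons_row.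

Let m : {measure set (BR R n.+1) -> \bar R} := measure_function_pushforward__canonical__measure_function_Measure prd mphi.

Lemma measurable_supball k (c : 'rV[R]_k) (e : R) :
  measurable ([set x : 'rV[R]_k | `|c - x| < e] : set (BR R k)).
Proof.
apply: open_measurable_row.
have -> : [set x : 'rV[R]_k | `|c - x| < e] = ball c e.
  by apply/seteqP; split => x; rewrite /= -ball_normE.
exact: ball_open.
Qed.

Let ball_split (c : 'rV[R]_n.+1) (e : R) : 0 < e ->
  exists (a : R) (b : 'rV[R]_n), m [set x : 'rV[R]_n.+1 | `|c - x| < e] =
   (leb [set t : R | (`|a - t| < e)%R] *
    mu [set y : 'rV[R]_n | (`|b - y| < e)%R])%E.
Proof.
move=> e0; have [p ->] := cons_row_surj c; exists p.1, p.2.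
rewrite -product_measure1E; last 2 first.
- have -> : [set t : R | `|p.1 - t| < e] = ball p.1 e.
    by apply/seteqP; split => x; rewrite /= -ball_normE.
  exact: measurable_ball.
- exact: measurable_supball.
by congr (prd _); apply/seteqP; split => q /=; apply cons_row_dist.
Qed.

Let ball_gt0 (c : 'rV[R]_n.+1) (e : R) : 0 < e ->
  (0 < m [set x : 'rV[R]_n.+1 | (`|c - x| < e)%R])%E.
Proof.
move=> e0; have [a [b ->]] := ball_split c e0; apply: mule_gt0.
  have -> : [set t : R | `|a - t| < e] = ball a e.
    by apply/seteqP; split => x; rewrite /= -ball_normE.
  by rewrite lebesgue_measure_ball ?ltW // lte_fin mulrn_wgt0.
exact: volume_ball_gt0.
Qed.

Let ball_lty (c : 'rV[R]_n.+1) (e : R) :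
  (m [set x : 'rV[R]_n.+1 | (`|c - x| < e)%R] < +oo)%E.
Proof.
have [e0|e0] := ltP 0 e; last first.
  rewrite (_ : [set x | _] = set0) ?measure0 //.
  by apply/seteqP; split => x //= /lt_le_trans/(_ e0); rewrite normr_lt0.
have [a [b ->]] := ball_split c e0; apply: lte_mul_pinfty => //.
- have -> : [set t : R | `|a - t| < e] = ball a e.
    by apply/seteqP; split => x; rewrite /= -ball_normE.
  by rewrite lebesgue_measure_ball ?ltW.
- exact: volume_ball_lty.
Qed.

Let sf : sigma_finite setT m.
Proof.
exists (fun k : nat => [set x : 'rV[R]_n.+1 | `|0 - x| < k%:R]).
  apply/seteqP; split => // x _; have := truncnS_gt `|x|; set k := (truncn _).+1 => hk.
  by exists k => //=; rewrite sub0r normrN.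
by move=> k; split; [exact: measurable_supball|exact: ball_lty].
Qed.

Let m_integral (f : BR R n.+1 -> \bar R) : measurable_fun setT f ->
    (forall x, 0 <= f x)%E ->
  (\int[m]_x f x = \int[leb]_t \int[mu]_y f (phi (t, y)))%E.
Proof.
move=> mf f0; rewrite /m /= (ge0_integral_pushforward mphi) //.
rewrite preimage_setT fubini_tonelli1 //.
  exact: measurableT_comp.
by move=> x; exact: f0.
Qed.

Let translation (v : 'rV[R]_n.+1) (A : set (BR R n.+1)) : measurable A ->
    m [set x : 'rV[R]_n.+1 | A (x + v)] = m A.
Proof.
move=> mA; have [[v0 v1] ->] := cons_row_surj v.
have mB : measurable (phi @^-1` A) by rewrite -[X in measurable X]setTI; exact: mphi.
pose F t := mu (xsection (phi @^-1` A) t).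
transitivity (\int[leb]_t F (t + v0)%R)%E; last first.
  rewrite lebesgue_integral_translation //.
  exact: measurable_fun_xsection.
apply: eq_integral => t _; rewrite /F /=.
rewrite -(volume_translation Hmu v1 (measurable_xsection _ mB)).
congr (mu _); apply/seteqP; split => y; rewrite /xsection /= !inE /= cons_rowD //.
Qed.

Let iint_eq (f : BR R n.+1 -> \bar R) : measurable_fun setT f ->
    (forall x, 0 <= f x)%E -> iint f = (\int[m]_x f x)%E.
Proof.
move=> mf f0; rewrite m_integral //=; apply: eq_integral => t _.
rewrite -(volume_iint Hmu) //.
apply: (measurableT_comp mf).
apply: (measurableT_comp mphi); exact: measurable_fun_pair.
Qed.

Let weight_lty : (\int[m]_x (weight (x : 'rV[R]_n.+1))%:E < +oo)%E.
Proof.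
rewrite m_integral; last 2 first.
- by apply: measurableT_comp => //; exact: measurable_weight.
- by move=> x; rewrite lee_fin weight_ge0.
have E t y : weight (phi (t, y)) = (1 + t ^+ 2)^-1 * weight (y : 'rV[R]_n).
  rewrite /weight big_ord_recl cons_row0; congr (_ * _).
  by apply: eq_bigr => j _; rewrite cons_rowS.
have w0 := volume_weight_lty Hmu.
set I := (\int[mu]_x _)%E in w0.
have mw : measurable_fun setT (fun y : BR R n => (weight (y : 'rV[R]_n))%:E).
  by apply: measurableT_comp => //; exact: measurable_weight.
pose F (t : measurableTypeR R) : R := (1 + t ^+ 2)^-1.
rewrite (eq_integral (fun t => I * (F t)%:E)%E); last first.
  move=> t _; under eq_integral do rewrite E EFinM.
  rewrite ge0_integralZl //; first by rewrite muleC.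
  - by move=> x _; rewrite lee_fin weight_ge0.
  - by rewrite lee_fin invr_ge0 addr_ge0 ?sqr_ge0.
have I0 : (0 <= I)%E by apply: integral_ge0 => x _; rewrite lee_fin weight_ge0.
rewrite ge0_integralZl //.
- apply: lte_mul_pinfty => //; first by rewrite ge0_fin_numE.
  exact: integral_oneDsqr_lty.
- apply: measurableT_comp => //.
  exact: (continuous_measurable_fun (@continuous_oneDsqrV R)).
- by move=> t _; rewrite lee_fin invr_ge0 addr_ge0 ?sqr_ge0.
Qed.

Lemma volumeS : exists nu : {sigma_finite_measure set (BR R n.+1) -> \bar R},
  is_volume nu.
Proof.
have [nu Enu] := sigma_finite_pack sf.
have EI (f : BR R n.+1 -> \bar R) : (\int[nu]_x f x = \int[m]_x f x)%E.
  by apply: eq_measure_integral => A _ _; rewrite -Enu.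
exists nu; split.
- by move=> f mf f0; rewrite EI iint_eq.
- by move=> v A mA; rewrite Enu translation.
- by move=> c e; rewrite Enu.
- by move=> c e e0; rewrite Enu; exact: ball_gt0.
- by rewrite EI.
Qed.

End Step.

Lemma volume_exists n :
  exists mu : {sigma_finite_measure set (BR R n) -> \bar R}, is_volume mu.
Proof.
by elim: n => [|n [mu]]; [exact: volume0|exact: volumeS].
Qed.

End VolumeExists.

(** * The kernel |x|^(-2n) and its derivatives *)

Section MultiMVT.
Context {R : realType} {n : nat}.
Implicit Types (f : 'rV[R]_n -> R) (u h : 'rV[R]_n).

Lemma derive_partial f u h : differentiable f u ->
  'D_h f u = \sum_j h ord0 j * partial j f u.
Proof.
move=> df; rewrite deriveE // {1}(row_evecE h) linear_sum; apply: eq_bigr => j _.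
by rewrite linearZ /= /partial deriveE.
Qed.

Lemma mvt_partial f u h :
  (forall t : R, 0 <= t <= 1 -> differentiable f (u + t *: h)) ->
  exists2 t, 0 <= t <= 1 &
    f (u + h) - f u = \sum_j h ord0 j * partial j f (u + t *: h).
Proof.
move=> df.
pose g (t : R) := f (u + t *: h).
have line_diff (t : R) : is_diff t (fun t : R => u + t *: h) (fun t => t *: h).
  by apply: is_diff_eq; apply/funext => s /=; rewrite add0r.
have dg (t : R) : 0 <= t <= 1 -> is_derive t 1 g ('D_h f (u + t *: h)).
  move=> t01; have := df t t01 => dft.
  have -> : g = f \o (fun t => u + t *: h) by [].
  have dl : differentiable (fun t : R => u + t *: h) t by exact: ex_diff.
  apply: DeriveDef; first by apply: diff_derivable; exact: differentiable_comp.
  rewrite deriveE; last exact: differentiable_comp.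
  rewrite diff_comp //= diff_val scale1r.
  by rewrite deriveE.
have [t||c] := @MVT_segment R g (fun t => 'D_h f (u + t *: h)) 0 1 ler01.
- by rewrite in_itv /= => /andP[t0 t1]; apply: dg; rewrite !ltW.
- apply: derivable_within_continuous => s; rewrite in_itv /= => s01.
  by have := dg s s01 => ?; exact: ex_derive.
rewrite in_itv /= => c01; rewrite /g scale1r scale0r addr0 subr0 mulr1 => E.
by exists c => //; rewrite E derive_partial //; exact: df.
Qed.

Lemma mvt_bound f u h (C : R) :
  (forall t : R, 0 <= t <= 1 -> differentiable f (u + t *: h)) ->
  (forall (t : R) j, 0 <= t <= 1 -> `|partial j f (u + t *: h)| <= C) ->
  `|f (u + h) - f u| <= n%:R * C * `|h|.
Proof.
move=> df bf; have [t t01 ->] := mvt_partial df.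
apply: le_trans (ler_norm_sum _ _ _) _.
have -> : n%:R * C * `|h| = \sum_(j < n) `|h| * C.
  by rewrite sumr_const card_ord -mulr_natl; lra.
apply: ler_sum => j _; rewrite normrM ler_pM ?bf //; exact: coord_le_norm.
Qed.

End MultiMVT.

Section Kernel.
Context {R : realType} {n : nat}.
Implicit Types (u h x y : 'rV[R]_n) (i j : 'I_n).

Definition sqn u : R := \sum_i u ord0 i ^+ 2.

Lemma sqn_ge0 u : 0 <= sqn u.
Proof. by apply: sumr_ge0 => i _; exact: sqr_ge0. Qed.

Lemma enormE u : enorm u = sqrtr (sqn u).
Proof. by []. Qed.

Lemma coord_sqr_le_sqn u i : u ord0 i ^+ 2 <= sqn u.
Proof.
rewrite /sqn (bigD1 i) //= lerDl; apply: sumr_ge0 => k _; exact: sqr_ge0.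
Qed.

Lemma sqr_norm_le_sqn u : `|u| ^+ 2 <= sqn u.
Proof.
rewrite -(sqr_sqrtr (sqn_ge0 u)) ler_pXn2r ?nnegrE ?sqrtr_ge0 //.
apply: normr_row_le; first exact: sqrtr_ge0.
by move=> j; rewrite -sqrtr_sqr ler_wsqrtr // coord_sqr_le_sqn.
Qed.

Lemma norm_le_enorm u : `|u| <= enorm u.
Proof.
by rewrite enormE -[leLHS]ger0_norm // -sqrtr_sqr ler_wsqrtr // sqr_norm_le_sqn.
Qed.

Lemma sqn_le u : sqn u <= n%:R * `|u| ^+ 2.
Proof.
have -> : n%:R * `|u| ^+ 2 = \sum_(i < n) `|u| ^+ 2.
  by rewrite sumr_const card_ord mulr_natl.
apply: ler_sum => i _.
by rewrite -real_normK ?num_real // ler_pXn2r ?nnegrE // coord_le_norm.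
Qed.

Lemma sqn_gt0 u : u != 0 -> 0 < sqn u.
Proof.
by move=> u0; apply: lt_le_trans (sqr_norm_le_sqn u); rewrite exprn_gt0 ?normr_gt0.
Qed.

Definition coord i : 'rV[R]_n -> R := fun u => u ord0 i.

Lemma coord_is_linear i : linear (coord i).
Proof. by move=> a u h; rewrite /coord !mxE. Qed.
HB.instance Definition _ i := GRing.isLinear.Build R 'rV[R]_n R _ (coord i) (coord_is_linear i).

Lemma is_derive_coord u i j : is_derive u (evec R j) (coord i) (i == j)%:R.
Proof.
apply: DeriveDef; first by apply: diff_derivable; exact: differentiable_coord.
rewrite deriveE; last exact: differentiable_coord.
rewrite diff_lin; last exact: coord_continuous.
by rewrite /= /coord mxE; case: eqP.
Qed.

Lemma differentiable_sqn u : differentiable sqn u.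
Proof.
have -> : sqn = \sum_i (coord i ^+ 2).
  by apply/funext => v; rewrite /sqn fct_sumE.
by apply: differentiable_sum => i; apply: differentiableX; exact: differentiable_coord.
Qed.

Lemma is_derive_sqn u j : is_derive u (evec R j) sqn (2 * u ord0 j).
Proof.
have -> : sqn = \sum_i (coord i ^+ 2).
  by apply/funext => v; rewrite /sqn fct_sumE.
have H i : is_derive u (evec R j) (coord i ^+ 2) ((2 * u ord0 i) * (i == j)%:R).
  have := is_derive_coord u i j => ?; apply: is_derive_eq.
  by rewrite expr1 -mulr_natl.
apply: (is_derive_eq (is_derive_sum H)).
rewrite (bigD1 j) //= eqxx mulr1 big1 ?addr0 //.
by move=> i ij; rewrite (negbTE ij) mulr0.
Qed.

Definition isqn u : R := (sqn u)^-1.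

Lemma differentiable_isqn u : u != 0 -> differentiable isqn u.
Proof.
move=> u0; apply: differentiableV; first exact: differentiable_sqn.
by rewrite gt_eqF // sqn_gt0.
Qed.

Lemma is_derive_isqn u j : u != 0 ->
  is_derive u (evec R j) isqn (- 2 * (u ord0 j * isqn u) * isqn u).
Proof.
move=> u0; have s0 : sqn u != 0 by rewrite gt_eqF // sqn_gt0.
have := is_derive_sqn u j => ds; apply: DeriveDef.
  by apply: diff_derivable; exact: differentiable_isqn.
rewrite deriveV // derive_val /isqn /GRing.scale /=.
by field.
Qed.

(* Every derivative of |u|^(-2n) is |u|^(-2n) times a polynomial in the
   functions u_i/|u|^2 and 1/|u|^2; this syntax names those polynomials. *)
Inductive kexp := Cst of R | InvSq | Coord of 'I_n | Add of kexp & kexp | Mul of kexp & kexp.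

Fixpoint ev (e : kexp) : 'rV[R]_n -> R :=
  match e with
  | Cst c => cst c
  | InvSq => isqn
  | Coord i => coord i * isqn
  | Add a b => ev a + ev b
  | Mul a b => ev a * ev b
  end.

Fixpoint dexp j (e : kexp) : kexp :=
  match e with
  | Cst c => Cst 0
  | InvSq => Mul (Cst (- 2)) (Mul (Coord j) InvSq)
  | Coord i => Add (Mul (Cst (i == j)%:R) InvSq)
                   (Mul (Cst (- 2)) (Mul (Coord i) (Coord j)))
  | Add a b => Add (dexp j a) (dexp j b)
  | Mul a b => Add (Mul (dexp j a) b) (Mul a (dexp j b))
  end.

Lemma differentiable_ev e u : u != 0 -> differentiable (ev e) u.
Proof.
move=> u0; elim: e => [c| |i|a IHa b IHb|a IHa b IHb] /=.
- exact: differentiable_cst.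
- exact: differentiable_isqn.
- by apply: differentiableM; [exact: differentiable_coord|exact: differentiable_isqn].
- exact: differentiableD.
- exact: differentiableM.
Qed.

Lemma is_derive_ev e u j : u != 0 ->
  is_derive u (evec R j) (ev e) (ev (dexp j e) u).
Proof.
move=> u0; elim: e => [c| |i|a IHa b IHb|a IHa b IHb] /=.
- exact: is_derive_cst.
- by have := is_derive_isqn j u0 => H; apply: (is_derive_eq H); rewrite !fctE /coord /cst; ring.
- have := is_derive_isqn j u0 => H; have := is_derive_coord u i j => H'.
  apply: is_derive_eq; rewrite !fctE /GRing.scale /= /coord; ring.
- exact: is_deriveD.
- by apply: is_derive_eq; rewrite !fctE /GRing.scale /=; ring.
Qed.

(** Away from the origin the generators 1/|u|^2 and u_i/|u|^2 are bounded by d^(-2) and d^(-1), and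
    polynomials in them inherit a bound. *)
Lemma ev_bounded e (d : R) : 0 < d ->
  exists2 C, 0 <= C & forall u, d <= `|u| -> `|ev e u| <= C.
Proof.
move=> d0.
have inv u : d <= `|u| -> isqn u <= (d ^+ 2)^-1.
  move=> du; rewrite lef_pV2 ?posrE ?exprn_gt0 //.
    apply: le_trans (sqr_norm_le_sqn u).
    by rewrite ler_pXn2r ?nnegrE // ltW.
  by apply: sqn_gt0; rewrite -normr_gt0 (lt_le_trans d0 du).
have inv0 u : 0 <= isqn u by rewrite invr_ge0 sqn_ge0.
elim: e => [c| |i|a [Ca Ca0 IHa] b [Cb Cb0 IHb]|a [Ca Ca0 IHa] b [Cb Cb0 IHb]] /=.
- by exists `|c|.
- exists (d ^+ 2)^-1; first by rewrite invr_ge0 exprn_ge0 // ltW.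
  by move=> u du; rewrite ger0_norm // inv.
- exists d^-1; first by rewrite invr_ge0 ltW.
  move=> u du; have u0 : 0 < `|u| by exact: lt_le_trans du.
  have s0 : 0 < sqn u by rewrite sqn_gt0 // -normr_gt0.
  rewrite normrM (ger0_norm (inv0 u)) ler_pdivrMr //.
  apply: le_trans (coord_le_norm u i) _.
  rewrite ler_pdivlMl //; apply: le_trans (sqr_norm_le_sqn u).
  by rewrite expr2 ler_wpM2r // ltW.
- exists (Ca + Cb); first exact: addr_ge0.
  by move=> u du; rewrite fctE (le_trans (ler_normD _ _)) // lerD ?IHa ?IHb.
- exists (Ca * Cb); first exact: mulr_ge0.
  by move=> u du; rewrite fctE normrM ler_pM ?IHa ?IHb.
Qed.

End Kernel.

Section DecayingKernel.
Context {R : realType} {n : nat}.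
Implicit Types (u h x y : 'rV[R]_n) (i j : 'I_n) (e : @kexp R n).

Definition pw N : @kexp R n := iter N (Mul InvSq) (Cst 1).

Lemma ev_pw N u : ev (pw N) u = isqn u ^+ N.
Proof. by elim: N => [//|N IH]; rewrite /= fctE IH exprS. Qed.

Lemma dexp_pw N u j : ev (dexp j (pw N)) u = - (2 * N)%:R * u ord0 j * isqn u ^+ N.+1.
Proof.
elim: N => [|N IH] /=; first by rewrite muln0 /= /cst; ring.
rewrite !fctE IH ev_pw /cst /coord !exprS !natrM -[N.+1]addn1 natrD; ring.
Qed.

Definition ker e := ev (Mul (pw n) e).

Lemma kerE e u : ker e u = isqn u ^+ n * ev e u.
Proof. by rewrite /ker /= fctE ev_pw. Qed.

(** The product rule for |u|^(-2n) times [ev e]: the first summand comes from the power. The factor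
    |u|^(-2n) survives differentiation, so every derivative stays integrable at infinity. *)
Definition dker j e : kexp :=
  Add (Mul (Cst (- (2 * n)%:R)) (Mul (Coord j) e)) (dexp j e).

Lemma differentiable_ker e u : u != 0 -> differentiable (ker e) u.
Proof. exact: differentiable_ev. Qed.

Lemma partial_ker e u j : u != 0 -> partial j (ker e) u = ker (dker j e) u.
Proof.
move=> u0; rewrite /partial (@derive_val _ _ _ _ _ _ _ (is_derive_ev _ j u0)) kerE /=.
rewrite !fctE dexp_pw ev_pw /cst /coord exprS; ring.
Qed.

Lemma isqn_ge0 u : 0 <= isqn u.
Proof. by rewrite invr_ge0 sqn_ge0. Qed.

(** The supremum norm of u + h is at least half that of u, which costs 4 after squaring; passing
    between the supremum and the Euclidean norm costs n. *)
Lemma isqn_shift u h : (0 < n)%N -> u != 0 -> `|h| <= `|u| / 2 ->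
  isqn (u + h) <= (4 * n)%:R * isqn u.
Proof.
move=> n0 u0 hu.
have N0 : 0 < n%:R :> R by rewrite ltr0n.
have U0 : 0 < `|u| by rewrite normr_gt0.
have su := sqn_gt0 u0.
have uh : `|u| / 2 <= `|u + h|.
  have := ler_normB (u + h) h; rewrite addrK; lra.
have suh : sqn u <= (4 * n)%:R * sqn (u + h).
  apply: le_trans (sqn_le u) _; rewrite natrM [4 * _]mulrC -mulrA ler_pM2l //.
  have := sqr_norm_le_sqn (u + h); have : (`|u| / 2) ^+ 2 <= `|u + h| ^+ 2.
    by rewrite ler_pXn2r ?nnegrE // divr_ge0.
  rewrite expr_div_n; lra.
have s0 : 0 < sqn (u + h).
  by move: suh; have := su => /lt_le_trans/[apply]; rewrite pmulr_rgt0 // ltr0n muln_gt0 n0.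
by rewrite /isqn ler_pdivlMr // mulrC ler_pdivrMr.
Qed.

Lemma ker_bounded e (d : R) : 0 < d -> exists2 C, 0 <= C &
  forall u, d <= `|u| -> `|ker e u| <= C * isqn u ^+ n.
Proof.
move=> /(ev_bounded e)[C C0 H]; exists C => // u du.
by rewrite kerE normrM ger0_norm ?exprn_ge0 ?isqn_ge0 // mulrC ler_wpM2r ?exprn_ge0 ?isqn_ge0 // H.
Qed.

Lemma ker_bounded_near e (d : R) : (0 < n)%N -> 0 < d -> exists2 C, 0 <= C &
  forall u h, d <= `|u| -> `|h| <= `|u| / 2 -> `|ker e (u + h)| <= C * isqn u ^+ n.
Proof.
move=> n0 d0; have d20 : 0 < d / 2 by lra.
have [C C0 H] := ker_bounded e d20.
exists (C * (4 * n)%:R ^+ n); first by rewrite mulr_ge0.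
move=> u h du hu; have uh : d / 2 <= `|u + h|.
  have := ler_normB (u + h) h; rewrite addrK; lra.
apply: le_trans (H _ uh) _; rewrite -mulrA ler_wpM2l // -exprMn.
rewrite ler_pXn2r ?nnegrE ?isqn_ge0 ?mulr_ge0 ?isqn_ge0 //.
apply: isqn_shift => //; rewrite -normr_gt0; exact: lt_le_trans du.
Qed.

Let segment_neq0 u h (t d : R) : 0 < d -> d <= `|u| -> `|h| <= `|u| / 2 ->
  0 <= t <= 1 -> `|t *: h| <= `|h| /\ u + t *: h != 0.
Proof.
move=> d0 du hu /andP[t0 t1].
have th : `|t *: h| <= `|h| by rewrite normrZ ger0_norm // ler_piMl.
split=> //; rewrite -normr_gt0.
have := ler_normB (u + t *: h) (t *: h); rewrite addrK; lra.
Qed.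

(** The error bound keeps the factor |u|^(-2n), so here and in [ker_taylor] it can be integrated
    over an unbounded complement. *)
Lemma ker_lipschitz e (d : R) : (0 < n)%N -> 0 < d -> exists2 C, 0 <= C &
  forall u h, d <= `|u| -> `|h| <= `|u| / 2 ->
  `|ker e (u + h) - ker e u| <= C * `|h| * isqn u ^+ n.
Proof.
move=> n0 d0.
have /choice[C HC] : forall j, exists C, 0 <= C /\
    forall u h, d <= `|u| -> `|h| <= `|u| / 2 ->
    `|ker (dker j e) (u + h)| <= C * isqn u ^+ n.
  by move=> j; have [C C0 H] := ker_bounded_near (dker j e) n0 d0; exists C.
have S0 : 0 <= \sum_j C j by apply: sumr_ge0 => j _; exact: (HC j).1.
exists (n%:R * \sum_j C j); first by rewrite mulr_ge0.
move=> u h du hu.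
have seg t := @segment_neq0 u h t d d0 du hu.
rewrite (_ : _ * _ * _ = n%:R * ((\sum_j C j) * isqn u ^+ n) * `|h|); last by ring.
apply: mvt_bound => [t t01|t j t01].
  by apply: differentiable_ker; exact: (seg t t01).2.
rewrite partial_ker; last exact: (seg t t01).2.
apply: le_trans ((HC j).2 u _ du _) _.
  by apply: le_trans hu; exact: (seg t t01).1.
rewrite ler_wpM2r ?exprn_ge0 ?isqn_ge0 // (bigD1 j) //= lerDl.
by apply: sumr_ge0 => k _; exact: (HC k).1.
Qed.

Lemma ker_taylor e (d : R) : (0 < n)%N -> 0 < d -> exists2 C, 0 <= C &
  forall u h, d <= `|u| -> `|h| <= `|u| / 2 ->
  `|ker e (u + h) - ker e u - \sum_j h ord0 j * ker (dker j e) u|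
    <= C * `|h| ^+ 2 * isqn u ^+ n.
Proof.
move=> n0 d0.
have /choice[C HC] : forall j, exists C, 0 <= C /\
    forall u h, d <= `|u| -> `|h| <= `|u| / 2 ->
    `|ker (dker j e) (u + h) - ker (dker j e) u| <= C * `|h| * isqn u ^+ n.
  by move=> j; have [C C0 H] := ker_lipschitz (dker j e) n0 d0; exists C.
have S0 : 0 <= \sum_j C j by apply: sumr_ge0 => j _; exact: (HC j).1.
exists (\sum_j C j) => // u h du hu.
have seg t := @segment_neq0 u h t d d0 du hu.
have [t t01|t t01 ->] := @mvt_partial R n (ker e) u h.
  by apply: differentiable_ker; exact: (seg t t01).2.
rewrite -sumrB; apply: le_trans (ler_norm_sum _ _ _) _.
rewrite -mulrA mulr_suml; apply: ler_sum => j _.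
rewrite partial_ker; last exact: (seg t t01).2.
rewrite -mulrBr normrM.
have [th _] := seg t t01.
apply: le_trans (ler_pM _ _ (coord_le_norm h j) ((HC j).2 u _ du _)) _ => //.
  exact: le_trans hu.
rewrite [leRHS](_ : _ = `|h| * (C j * `|h| * isqn u ^+ n)); last by ring.
rewrite ler_wpM2l // ler_wpM2r ?exprn_ge0 ?isqn_ge0 // ler_wpM2l //.
exact: (HC j).1.
Qed.

(** The n factors 1/|x - y|^2 are shared out among the coordinates, each being compared with one
    factor of [weight y]. *)
Lemma isqn_le_weight (d M : R) : 0 < d -> 0 <= M -> exists2 C, 0 <= C &
  forall x y, `|x| <= M -> d <= `|x - y| -> isqn (x - y) ^+ n <= C * weight y.
Proof.
(* From y_i^2 <= 2 x_i^2 + 2 (x_i - y_i)^2: the fraction absorbs 1 + 2 M^2 since |x - y| >= d, and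
   the 2 absorbs the rest. *)
move=> d0 M0; pose c := (1 + 2 * M ^+ 2) / d ^+ 2 + 2.
have c0 : 0 <= c by apply: addr_ge0 => //; apply: divr_ge0; [have := sqr_ge0 M; lra|exact: sqr_ge0].
exists (c ^+ n); first exact: exprn_ge0.
move=> x y xM dxy.
have s0 : 0 < sqn (x - y) by apply: sqn_gt0; rewrite -normr_gt0 (lt_le_trans d0).
have H i : isqn (x - y) <= c * (1 + y ord0 i ^+ 2)^-1.
  have y0 : 0 < 1 + y ord0 i ^+ 2 by have := sqr_ge0 (y ord0 i); lra.
  rewrite ler_pdivlMr // mulrC ler_pdivrMr //.
  have H1 := coord_sqr_le_sqn (x - y) i; rewrite rowBE in H1.
  have H2 : x ord0 i ^+ 2 <= M ^+ 2.
    rewrite -real_normK ?num_real // ler_pXn2r ?nnegrE //.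
    exact: le_trans (coord_le_norm x i) xM.
  have H3 : d ^+ 2 <= sqn (x - y).
    apply: le_trans (sqr_norm_le_sqn _); rewrite ler_pXn2r ?nnegrE // ltW //.
  have H4 : 1 + 2 * M ^+ 2 <= (1 + 2 * M ^+ 2) / d ^+ 2 * sqn (x - y).
    rewrite mulrAC ler_pdivlMr ?exprn_gt0 // ler_wpM2l //.
    by have := sqr_ge0 M; lra.
  rewrite /c mulrDl; have := sqr_ge0 (2 * x ord0 i - y ord0 i); nra.
rewrite -[n in isqn _ ^+ n]card_ord -[n in c ^+ n]card_ord -!prodr_const /weight -big_split /=.
by apply: ler_prod => i _; rewrite isqn_ge0 H.
Qed.

End DecayingKernel.

(** * Potentials and the smoothness of psi *)

Section FrechetFromEstimate.
Context {R : realType} {n : nat}.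

(** This takes the place of differentiation under the integral sign: Taylor bounds for the kernel
    integrate to an estimate of this form. *)
Lemma differentiable_quadratic (f : 'rV[R]_n -> R) (x : 'rV[R]_n) (a : 'I_n -> R)
    (C d : R) : 0 < d ->
  (forall h, `|h| <= d ->
     `|f (x + h) - f x - \sum_j h ord0 j * a j| <= C * `|h| ^+ 2) ->
  differentiable f x /\ forall j, partial j f x = a j.
Proof.
move=> d0 H; pose L (h : 'rV[R]_n) := \sum_j h ord0 j * a j.
have L_lin : linear L.
  move=> k u v; rewrite /L scaler_sumr -big_split; apply: eq_bigr => j _ /=.
  by rewrite rowDE rowZE mulrDl /GRing.scale /= mulrA.
pose Lmix := GRing.isLinear.Build R 'rV[R]_n R _ L L_lin.
pose Lin : {linear 'rV[R]_n -> R} := HB.pack L Lmix.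
have cL : continuous Lin.
  have -> : (Lin : 'rV[R]_n -> R) = \sum_j (fun u : 'rV[R]_n => u ord0 j * a j).
    by apply/funext => u; rewrite fct_sumE.
  move=> u; apply: differentiable_continuous; apply: differentiable_sum => j.
  by apply: differentiableM; [exact: differentiable_coord|exact: differentiable_cst].
have E : f \o shift x = cst (f x) + Lin +o_ (0 : 'rV[R]_n) id.
  apply/eqaddoP => e e0.
  have N1 : \forall h \near nbhs (0 : 'rV[R]_n), `|h| <= d
    by exact: (@nbhs0_le _ 'rV[R]_n _ d0).
  have e1 : 0 < e / (`|C| + 1) by rewrite divr_gt0 // ltr_wpDl.
  have N2 : \forall h \near nbhs (0 : 'rV[R]_n), `|h| <= e / (`|C| + 1)
    by exact: (@nbhs0_le _ 'rV[R]_n _ e1).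
  apply: filterS2 N1 N2 => h hd hh.
  rewrite /= !fctE /= opprD addrA [h + x]addrC.
  apply: le_trans (H h hd) _.
  have he : `|C| * `|h| <= e.
    move: hh; rewrite ler_pdivlMr ?ltr_wpDl // => hh.
    by apply: le_trans hh; rewrite mulrC ler_wpM2l // lerDl.
  rewrite expr2 mulrA ler_wpM2r //; apply: le_trans he.
  by rewrite ler_wpM2r // ler_norm.
have dfL := diff_unique cL E.
have df : differentiable f x.
  by apply/diff_locallyP; rewrite dfL; split.
split=> // j; rewrite /partial deriveE // dfL /= /L (bigD1 j) //= big1 ?addr0.
  by rewrite mxE eqxx mul1r.
by move=> i ij; rewrite mxE (negbTE ij) mul0r.
Qed.

End FrechetFromEstimate.

Section WeightedIntegral.
Context {R : realType} {n : nat}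
  (mu : {sigma_finite_measure set (BR R n) -> \bar R}) (Hmu : is_volume mu).
Implicit Types (E : set (BR R n)) (F : BR R n -> R).

Definition weight_mass : R := fine (\int[mu]_x (weight (x : 'rV[R]_n))%:E).

Lemma weight_mass_ge0 : 0 <= weight_mass.
Proof. by apply: fine_ge0; apply: integral_ge0 => x _; rewrite lee_fin weight_ge0. Qed.

Lemma weight_integrable (K : R) E : measurable E ->
  mu.-integrable E (fun x : BR R n => (K * weight (x : 'rV[R]_n))%:E).
Proof.
move=> mE; apply: (@integrableS _ _ _ _ setT) => //.
have -> : (fun x : BR R n => (K * weight (x : 'rV[R]_n))%:E) =
    (fun x => K%:E * (weight (x : 'rV[R]_n))%:E)%E.
  by apply/funext => x; rewrite EFinM.
apply: integrableZl => //; apply/integrableP; split.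
  by apply: measurableT_comp => //; exact: measurable_weight.
have := volume_weight_lty Hmu; congr (_ < _)%E; apply: eq_integral => x _.
by rewrite abse_EFin ger0_norm // weight_ge0.
Qed.

Lemma integrable_le_weight (K : R) E F : measurable E -> measurable_fun E F ->
  (forall y, E y -> `|F y| <= K * weight (y : 'rV[R]_n)) ->
  mu.-integrable E (EFin \o F).
Proof.
move=> mE mF H; apply: le_integrable (weight_integrable K mE) => //.
  exact/measurable_EFinP.
move=> y Ey; rewrite /= lee_fin; apply: le_trans (H y Ey) _; exact: ler_norm.
Qed.

Lemma Rintegral_le_weight (K : R) E F : measurable E -> measurable_fun E F ->
  0 <= K -> (forall y, E y -> `|F y| <= K * weight (y : 'rV[R]_n)) ->
  `|\int[mu]_(y in E) F y| <= K * weight_mass.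
Proof.
move=> mE mF K0 H; have iF := integrable_le_weight mE mF H.
apply: le_trans (le_normr_Rintegral mE iF) _.
have iF' : mu.-integrable E (EFin \o (fun y => `|F y|)).
  apply: (@integrable_le_weight K) => //; first exact: measurableT_comp.
  by move=> y /H; rewrite normr_id.
apply: le_trans (le_Rintegral mE iF' (weight_integrable K mE) H) _.
rewrite /weight_mass -[K]/(fine K%:E) -fineM //; last first.
  have := weight_integrable 1 measurableT => /(integrable_fin_num measurableT).
  by congr (_ \is a _); apply: eq_integral => x _; rewrite mul1r.
have mw : measurable_fun setT (fun x : BR R n => (weight (x : 'rV[R]_n))%:E).
  by apply: measurableT_comp => //; exact: measurable_weight.
rewrite -ge0_integralZl //; last by move=> x _; rewrite lee_fin weight_ge0.
have -> : (fun x : BR R n => K%:E * (weight (x : 'rV[R]_n))%:E)%E =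
    (fun x : BR R n => (K * weight (x : 'rV[R]_n))%:E).
  by apply/funext => x; rewrite EFinM.
apply: fine_le.
- exact: integrable_fin_num (weight_integrable K mE).
- exact: integrable_fin_num (weight_integrable K measurableT).
- apply: ge0_subset_integral => //.
    exact: (measurable_int _ (weight_integrable K measurableT)).
  by move=> x _; rewrite lee_fin mulr_ge0 // weight_ge0.
Qed.

Lemma Rintegral_sum (I : Type) (s : seq I) E (F : I -> BR R n -> R) : measurable E ->
  (forall i, mu.-integrable E (EFin \o F i)) ->
  mu.-integrable E (EFin \o (fun y => \sum_(i <- s) F i y)) /\
  \int[mu]_(y in E) (\sum_(i <- s) F i y) = \sum_(i <- s) \int[mu]_(y in E) F i y.
Proof.
move=> mE iF; elim: s => [|i s [iS IS]].
  have -> : (fun y => \sum_(i <- [::]) F i y) = cst 0.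
    by apply/funext => y; rewrite big_nil.
  by rewrite big_nil Rintegral_cst // mul0r; split=> //; exact: integrable0.
have -> : (fun y => \sum_(k <- i :: s) F k y) = (fun y => F i y + \sum_(k <- s) F k y).
  by apply/funext => y; rewrite big_cons.
by rewrite big_cons RintegralD // IS; split => //; exact: (integrableD mE (iF i) iS).
Qed.

End WeightedIntegral.

Section Potential.
Context {R : realType} {n : nat} (n0 : (0 < n)%N)
  (mu : {sigma_finite_measure set (BR R n) -> \bar R}) (Hmu : is_volume mu).
Implicit Types (E : set (BR R n)) (x h : 'rV[R]_n) (e : @kexp R n).

Definition pot E e x : R := \int[mu]_(y in E) ker e (x - (y : 'rV[R]_n)).

Definition away (d : R) E x := forall y : 'rV[R]_n, E y -> d <= `|x - y|.

Lemma away_shift d E x h : `|h| <= d / 2 -> away d E x -> away (d / 2) E (x + h).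
Proof.
move=> hd H y Ey; have := H y Ey; have := ler_normB (x + h - y) h.
by rewrite (_ : x + h - y - h = x - y); [lra|rewrite addrAC addrK].
Qed.

Lemma measurable_ker E e x (d : R) : 0 < d -> away d E x -> measurable E ->
  measurable_fun E (fun y : BR R n => ker e (x - (y : 'rV[R]_n))).
Proof.
move=> d0 aE mE.
have oU : open [set y : 'rV[R]_n | y != x].
  have -> : [set y : 'rV[R]_n | y != x] = ~` [set x].
    by apply/seteqP; split => y /= /eqP.
  by apply: closed_openC; apply: accessible_closed_set1; apply: hausdorff_accessible; exact: norm_hausdorff.
apply: (@measurable_funS _ _ _ _ ([set y | y != x] : set (BR R n))).
- exact: open_measurable_row.
- move=> y /aE dxy /=; apply/eqP => yx; move: dxy; rewrite yx subrr normr0; lra.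
apply: continuous_measurable_row => // y /= yx.
apply: (@continuous_comp _ _ _ (fun y : 'rV[R]_n => x - y) (ker e)).
  by apply: continuousB; [exact: cst_continuous|exact: cvg_id].
by apply: differentiable_continuous; apply: differentiable_ker; rewrite subr_eq0 eq_sym.
Qed.

Lemma ker_le_weight e (d M : R) : 0 < d -> 0 <= M -> exists2 C, 0 <= C &
  forall x y, `|x| <= M -> d <= `|x - y| -> `|ker e (x - y)| <= C * weight y.
Proof.
move=> d0 M0; have [C1 C10 H1] := ker_bounded e d0.
have [C2 C20 H2] := @isqn_le_weight R n d M d0 M0.
exists (C1 * C2); first exact: mulr_ge0.
move=> x y xM dxy; apply: (le_trans (H1 _ dxy)).
by rewrite -mulrA ler_wpM2l // H2.
Qed.

Lemma pot_integrable E e x (d : R) : 0 < d -> measurable E -> away d E x ->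
  mu.-integrable E (fun y : BR R n => (ker e (x - (y : 'rV[R]_n)))%:E).
Proof.
move=> d0 mE aE; have [C C0 H] := ker_le_weight e d0 (normr_ge0 x).
apply: (@integrable_le_weight _ _ _ Hmu C) => //; first exact: measurable_ker aE mE.
by move=> y Ey; apply: H => //; exact: aE.
Qed.

(** The constant is chosen before [E]: the same bound has to serve all domains of a family. The same
    holds for [pot_taylor]. *)
Lemma pot_lipschitz e (d M : R) : 0 < d -> 0 <= M -> exists2 C, 0 <= C &
  forall E x h, measurable E -> away d E x -> `|x| <= M -> `|h| <= d / 2 ->
  `|pot E e (x + h) - pot E e x| <= C * `|h|.
Proof.
move=> d0 M0; have [C1 C10 H1] := ker_lipschitz e n0 d0.
have [C2 C20 H2] := @isqn_le_weight R n d M d0 M0.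
exists (C1 * C2 * weight_mass mu); first by rewrite !mulr_ge0 ?weight_mass_ge0.
move=> E x h mE aE xM hd.
have d20 : 0 < d / 2 by lra.
have aE' := away_shift hd aE.
rewrite /pot -RintegralB //; last 2 first.
- exact: pot_integrable d20 mE aE'.
- exact: pot_integrable d0 mE aE.
rewrite mulrAC; apply: Rintegral_le_weight => //.
- apply: measurable_funB; [exact: measurable_ker d20 aE' mE|exact: measurable_ker d0 aE mE].
- by rewrite !mulr_ge0.
move=> y Ey; rewrite addrAC.
have dxy := aE y Ey.
apply: le_trans (H1 (x - y) h dxy _) _; first lra.
rewrite [leRHS](_ : _ = C1 * `|h| * (C2 * weight (y : 'rV[R]_n))); last by ring.
by rewrite ler_wpM2l ?mulr_ge0 // H2.
Qed.

Lemma pot_taylor e (d M : R) : 0 < d -> 0 <= M -> exists2 C, 0 <= C &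
  forall E x h, measurable E -> away d E x -> `|x| <= M -> `|h| <= d / 2 ->
  `|pot E e (x + h) - pot E e x - \sum_j h ord0 j * pot E (dker j e) x|
    <= C * `|h| ^+ 2.
Proof.
move=> d0 M0; have [C1 C10 H1] := ker_taylor e n0 d0.
have [C2 C20 H2] := @isqn_le_weight R n d M d0 M0.
exists (C1 * C2 * weight_mass mu); first by rewrite !mulr_ge0 ?weight_mass_ge0.
move=> E x h mE aE xM hd.
have d20 : 0 < d / 2 by lra.
have aE' := away_shift hd aE.
have iZ j : mu.-integrable E
    (EFin \o (fun y : BR R n => h ord0 j * ker (dker j e) (x - (y : 'rV[R]_n)))).
  rewrite (_ : _ \o _ = fun y : BR R n => ((h ord0 j)%:E * (ker (dker j e) (x - (y : 'rV[R]_n)))%:E)%E).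
    by apply: integrableZl => //; exact: pot_integrable d0 mE aE.
  by apply/funext => y; rewrite /= EFinM.
have [iS IS] := Rintegral_sum (index_enum _) mE iZ.
have -> : \sum_j h ord0 j * pot E (dker j e) x =
    \int[mu]_(y in E) (\sum_j h ord0 j * ker (dker j e) (x - (y : 'rV[R]_n))).
  rewrite IS; apply: eq_bigr => j _; rewrite RintegralZl //.
  exact: pot_integrable d0 mE aE.
have i1 : mu.-integrable E (EFin \o (fun y : BR R n => ker e (x + h - (y : 'rV[R]_n)))).
  exact: pot_integrable d20 mE aE'.
have i2 : mu.-integrable E (EFin \o (fun y : BR R n => ker e (x - (y : 'rV[R]_n)))).
  exact: pot_integrable d0 mE aE.
have i3 : mu.-integrable E (EFin \o (fun y : BR R n => ker e (x + h - (y : 'rV[R]_n)) - ker e (x - (y : 'rV[R]_n)))).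
  exact: (integrableB mE i1 i2).
rewrite /pot -RintegralB // -RintegralB //.
rewrite mulrAC; apply: Rintegral_le_weight => //.
- by apply/measurable_EFinP; apply: (measurable_int mu); exact: (integrableB mE i3 iS).
- by rewrite !mulr_ge0 // sqr_ge0.
move=> y Ey; rewrite [x + h - _]addrAC.
have dxy := aE y Ey.
apply: le_trans (H1 (x - y) h dxy _) _; first lra.
rewrite [leRHS](_ : _ = C1 * `|h| ^+ 2 * (C2 * weight (y : 'rV[R]_n))); last by ring.
by rewrite ler_wpM2l ?mulr_ge0 ?sqr_ge0 // H2.
Qed.

End Potential.

Section Psi.
Context {R : realType} {n : nat} (n0 : (0 < n)%N)
  (mu : {sigma_finite_measure set (BR R n) -> \bar R}) (Hmu : is_volume mu).
Implicit Types (D : set 'rV[R]_n) (x h : 'rV[R]_n) (e : @kexp R n) (f : 'rV[R]_n -> R).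

Local Notation pot D := (pot mu (~` D : set (BR R n))).

Lemma open_away D x : open D -> D x -> exists2 d, 0 < d & away d (~` D) x.
Proof.
move=> oD Dx; have /nbhs_ballP[d /= d0 H] : nbhs x D by exact: open_nbhs_nbhs.
exists d => // y nDy; rewrite leNgt; apply/negP => xy; apply: nDy; apply: H.
by rewrite ball_rowE.
Qed.

Lemma away_in D x (d : R) h : away d (~` D) x -> `|h| < d -> D (x + h).
Proof.
move=> aD hd; apply: contrapT => /aD; rewrite opprD addrA subrr sub0r normrN; lra.
Qed.

Lemma psi_pot D x (d : R) : open D -> 0 < d -> away d (~` D) x ->
  psi D x = pot D (Cst 1) x.
Proof.
move=> oD d0 aD.
have mE : measurable (~` D : set (BR R n)).
  by apply: measurableC; exact: open_measurable_row.
have Ef : (fun y : 'rV[R]_n => ((\1_(~` D) y : R) * (enorm (x - y)) ^- (2 * n))%:E) =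
    (fun y : BR R n => (ker (Cst 1) (x - (y : 'rV[R]_n)))%:E) \_ (~` D).
  apply/funext => y; rewrite patchE indicE.
  case: ifPn => yD; last by rewrite mul0r.
  by rewrite mul1r exprM enormE sqr_sqrtr ?sqn_ge0 // kerE /= /cst mulr1 exprVn.
rewrite /psi Ef (volume_iint Hmu); last 2 first.
- apply/(measurable_restrictT _ mE).
  apply/measurable_EFinP; exact: measurable_ker aD mE.
- move=> y; rewrite patchE; case: ifPn => // _.
  by rewrite lee_fin kerE /= /cst mulr1 exprn_ge0 // isqn_ge0.
by rewrite [RHS]/Rintegral [in RHS]integral_mkcond.
Qed.

Lemma pot_differentiable D f e : open D -> (forall x, D x -> f x = pot D e x) ->
  forall x, D x -> differentiable f x /\
    forall j, partial j f x = pot D (dker j e) x.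
Proof.
move=> oD fE x Dx; have [d d0 aD] := open_away oD Dx.
have mE : measurable (~` D : set (BR R n)).
  by apply: measurableC; exact: open_measurable_row.
have [C C0 H] := pot_taylor n0 Hmu e d0 (normr_ge0 x).
have d20 : 0 < d / 2 by lra.
apply: (@differentiable_quadratic _ _ _ _ _ C (d / 2)) => // h hd.
rewrite fE ?fE //; first exact: H.
by apply: away_in aD _; lra.
Qed.

Definition gradk (j : 'I_n) : @kexp R n := dker j (Cst 1).
Definition hessk (i j : 'I_n) : @kexp R n := dker i (gradk j).

(** Each derivative is again a potential, with kernel [dker]. The second partials are continuous
    because, as potentials, they are differentiable once more. *)
Lemma psi_C2 D : open D -> Ck 2 D (psi D) /\
  forall x, D x -> (forall j, partial j (psi D) x = pot D (gradk j) x) /\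
    hessian (psi D) x = \matrix_(i, j) pot D (hessk i j) x.
Proof.
move=> oD.
have H0 : forall x, D x -> psi D x = pot D (Cst 1) x.
  by move=> x Dx; have [d d0 aD] := open_away oD Dx; exact: psi_pot aD.
have D0 := pot_differentiable oD H0.
have H1 j x : D x -> partial j (psi D) x = pot D (gradk j) x by move=> /D0[_ ->].
have D1 j := pot_differentiable oD (H1 j).
have H2 i j x : D x -> partial i (partial j (psi D)) x = pot D (hessk i j) x.
  by move=> /D1-/(_ j)[_ ->].
have D2 i j := pot_differentiable oD (H2 i j).
split.
  split=> [x /D0[]//|j]; split=> [x /D1-/(_ j)[]//|i] x Dx.
  by apply: differentiable_continuous; case: (D2 i j x Dx).
move=> x Dx; split=> [j|]; first exact: H1.
by apply/matrixP => i j; rewrite !mxE H2.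
Qed.

End Psi.

(** * A Sard theorem by counting *)

Section Quantize.
Context {R : realType}.

(** [inord] sends numbers above [Q] to a default value; taking [Q = truncn B] for values in [0, B]
    excludes this. *)
Definition quantize (Q : nat) (t : R) : 'I_Q.+1 := inord (truncn t).

Lemma quantize_eq (Q : nat) (B t t' : R) : 0 <= t <= B -> 0 <= t' <= B ->
  Q = truncn B -> quantize Q t = quantize Q t' -> `|t - t'| < 1.
Proof.
move=> /andP[t0 tQ] /andP[t'0 t'Q] QB.
have H s : 0 <= s -> s <= B -> (truncn s < Q.+1)%N.
  move=> s0 sB; rewrite ltnS QB; exact: le_truncn.
move=> /(congr1 val); rewrite /= !inordK ?H // => E.
have /andP[h1 h2] := truncn_itv t0; have /andP[] := truncn_itv t'0.
rewrite -E => h3 h4; move: h2 h4; rewrite -natr1 => h2 h4.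
rewrite ltr_norml; apply/andP; split; lra.
Qed.

End Quantize.

Section Sard.
Context {R : realType} {m : nat}.
Local Notation n := m.+1.
Variables (A r c C : R) (x0 : 'rV[R]_n).
Variables (G : 'rV[R]_n -> 'rV[R]_n -> 'rV[R]_n) (H : 'rV[R]_n -> 'rV[R]_n -> 'M[R]_n).
Hypotheses (A0 : 0 < A) (r0 : 0 <= r) (c0 : 0 < c) (C0 : 0 <= C).
Let P (a : 'rV[R]_n) := forall j, 0 <= a ord0 j <= A.
Let Y (x : 'rV[R]_n) := `|x - x0| <= r.
(** Stands in for the surjective parameter derivative of a transversality theorem. *)
Hypothesis expand : forall a a' x, P a -> P a' -> Y x -> c * `|a - a'| <= `|G a x - G a' x|.
Hypothesis H_bound : forall a x i j, P a -> Y x -> `|H a x i j| <= C.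
Hypothesis H_lipa : forall a a' x i j, P a -> P a' -> Y x ->
  `|H a x i j - H a' x i j| <= C * `|a - a'|.
Hypothesis H_lipx : forall a x x' i j, P a -> Y x -> Y x' ->
  `|H a x i j - H a x' i j| <= C * `|x - x'|.
Hypothesis G_taylor : forall a x x', P a -> Y x -> Y x' ->
  `|G a x' - G a x - (x' - x) *m H a x| <= C * `|x' - x| ^+ 2.

(** Divide a null vector by an entry of largest modulus. *)
Lemma singular_right_null (M : 'M[R]_n) : M \notin unitmx ->
  exists (w : 'cV[R]_n) (l : 'I_n),
    [/\ M *m w = 0, w l ord0 = 1 & forall i, `|w i ord0| <= 1].
Proof.
rewrite -unitmx_tr -row_free_unit -kermx_eq0 => /rowV0Pn[v vM v0].
have Mv : M *m v^T = 0.
  by apply: trmx_inj; rewrite trmx_mul trmxK trmx0; exact/sub_kermxP.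
have [l vl] : exists l, `|v| = `|v ord0 l|.
  have : `|v| != 0 by rewrite normr_eq0.
  by move=> /mx_norm_neq0[[i l]] /=; rewrite (ord1 i); exists l.
have vl0 : v ord0 l != 0 by rewrite -normr_eq0 -vl normr_eq0.
exists ((v ord0 l)^-1 *: v^T), l; split.
- by rewrite -scalemxAr Mv scaler0.
- by rewrite !mxE mulVf.
- move=> i; rewrite !mxE normrM normfV -vl mulrC ler_pdivrMr ?mul1r ?coord_le_norm //.
  by rewrite normr_gt0.
Qed.

Lemma mulmx_row_bound (h : 'rV[R]_n) (M : 'M[R]_n) (b : R) : 0 <= b ->
  (forall i j, `|M i j| <= b) -> `|h *m M| <= n%:R * b * `|h|.
Proof.
move=> b0 HM; apply: normr_row_le; first by rewrite !mulr_ge0.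
move=> j; rewrite mxE; apply: le_trans (ler_norm_sum _ _ _) _.
rewrite (_ : _ * _ * _ = \sum_(i < n) `|h| * b); last first.
  by rewrite sumr_const card_ord -mulr_natl; ring.
by apply: ler_sum => i _; rewrite normrM ler_pM // coord_le_norm.
Qed.

Lemma dot_bound (v : 'rV[R]_n) (w : 'cV[R]_n) (b : R) : 0 <= b -> `|v| <= b ->
  (forall i, `|w i ord0| <= 1) -> `|(v *m w) ord0 ord0| <= n%:R * b.
Proof.
move=> b0 vb w1; rewrite mxE; apply: le_trans (ler_norm_sum _ _ _) _.
rewrite (_ : n%:R * b = \sum_(i < n) b * 1); last first.
  by rewrite sumr_const card_ord mulr1 mulr_natl.
apply: ler_sum => i _; rewrite normrM ler_pM //.
exact: le_trans (coord_le_norm _ _) vb.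
Qed.

(** Scales for cells of size [dl]. Parameters with zeros in one cell are within [D1 * dl]; their
    values at a common point are at most [V * dl], and at most [K * dl ^+ 2] across the range of a
    singular Hessian; [T * dl ^+ 2] will be the mesh of the grid. The 1 in [K] makes it a legitimate
    divisor, the 1 in [T] makes [separated] strict. *)
Let D1 := (n%:R + 1) * C / c.
Let V := (n%:R + 1) * C.
Let K := n%:R * (n%:R * (C * (D1 + 1))) + n%:R * C + 1.
Let T := ((n%:R + 2) * K + 1) / c.

Let V0 : 0 <= V. Proof. by rewrite mulr_ge0 // addr_ge0. Qed.
Let D10 : 0 <= D1. Proof. by rewrite divr_ge0 // ltW. Qed.
Let K0 : 0 < K.
Proof.
rewrite ltr_wpDl // addr_ge0 ?mulr_ge0 //; exact: addr_ge0.
Qed.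
Let T0 : 0 < T.
Proof.
apply: divr_gt0 => //; apply: ltr_wpDl => //; apply: mulr_ge0; last exact: ltW.
exact: addr_ge0.
Qed.

Let close_value a x a' x' (dl : R) : P a -> P a' -> Y x -> Y x' ->
  G a x = 0 -> dl <= 1 -> `|x' - x| <= dl -> `|G a x'| <= V * dl.
Proof.
move=> Pa Pa' Yx Yx' Gax dl1 hd.
have h0 : 0 <= `|x' - x| by [].
have := G_taylor Pa Yx Yx'; rewrite Gax subr0 => HT.
have Hm := mulmx_row_bound (x' - x) C0 (fun i j => H_bound i j Pa Yx).
have := ler_normD (G a x' - (x' - x) *m H a x) ((x' - x) *m H a x).
rewrite subrK => Hn; apply: le_trans Hn _.
have : C * `|x' - x| ^+ 2 <= C * dl.
  rewrite ler_wpM2l // expr2; apply: le_trans (ler_pM h0 h0 hd hd) _.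
  by rewrite ler_piMr // (le_trans h0).
have : n%:R * C * `|x' - x| <= n%:R * C * dl by rewrite ler_wpM2l // mulr_ge0.
rewrite /V; lra.
Qed.

(** Evaluate both parameters at the zero x' of the second one: [expand] bounds their distance by the
    value of the first, which is small because its own zero is close. *)
Let close_param a x a' x' (dl : R) : P a -> P a' -> Y x -> Y x' ->
  G a x = 0 -> G a' x' = 0 -> dl <= 1 -> `|x' - x| <= dl -> `|a - a'| <= D1 * dl.
Proof.
move=> Pa Pa' Yx Yx' Gax Gax' dl1 hd.
have := expand Pa Pa' Yx'; rewrite Gax' subr0 => He.
have := close_value Pa Pa' Yx Yx' Gax dl1 hd.
rewrite (_ : D1 * dl = V * dl / c); last by rewrite /D1 /V; ring.
by rewrite ler_pdivlMr // [_ * c]mulrC => Hv; exact: le_trans He Hv.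
Qed.

(* [w] annihilates the range of the singular matrix [H a' x'], so [G a x'] lies
   in that range up to second order. *)
Let near_plane a x a' x' (dl : R) (w : 'cV[R]_n) : P a -> P a' -> Y x -> Y x' ->
  G a x = 0 -> G a' x' = 0 -> dl <= 1 -> `|x' - x| <= dl ->
  H a' x' *m w = 0 -> (forall i, `|w i ord0| <= 1) ->
  `|(G a x' *m w) ord0 ord0| <= K * dl ^+ 2.
Proof.
move=> Pa Pa' Yx Yx' Gax Gax' dl1 hd Hw w1.
have h0 : 0 <= `|x' - x| by [].
have dl0 : 0 <= dl by exact: le_trans hd.
have haa := close_param Pa Pa' Yx Yx' Gax Gax' dl1 hd.
have HT := G_taylor Pa Yx Yx'; rewrite Gax subr0 in HT.
have -> : G a x' = (G a x' - (x' - x) *m H a x) + (x' - x) *m (H a x - H a' x')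
   + (x' - x) *m H a' x'.
  by rewrite mulmxBr addrA subrK subrK.
rewrite mulmxDl -[X in _ + X]mulmxA Hw mulmx0 addr0 mulmxDl rowDE.
apply: le_trans (ler_normD _ _) _.
have E1 : `|((G a x' - (x' - x) *m H a x) *m w) ord0 ord0| <= n%:R * (C * dl ^+ 2).
  apply: dot_bound => //; first by rewrite mulr_ge0 // sqr_ge0.
  apply: le_trans HT _; rewrite ler_wpM2l // ler_pXn2r ?nnegrE //.
have HH i j : `|(H a x - H a' x') i j| <= C * (D1 + 1) * dl.
  rewrite !mxE (_ : H a x i j - H a' x' i j =
     (H a x i j - H a' x i j) + (H a' x i j - H a' x' i j)); last by ring.
  apply: le_trans (ler_normD _ _) _.
  have h1 := H_lipa i j Pa Pa' Yx; have h2 := H_lipx i j Pa' Yx Yx'.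
  have h3 : C * `|a - a'| <= C * (D1 * dl) by rewrite ler_wpM2l.
  have h4 : C * `|x - x'| <= C * dl by rewrite ler_wpM2l // distrC.
  by rewrite [leRHS](_ : _ = C * (D1 * dl) + C * dl); [lra|ring].
have E2 : `|((x' - x) *m (H a x - H a' x') *m w) ord0 ord0| <=
    n%:R * (n%:R * (C * (D1 + 1) * dl) * dl).
  apply: dot_bound => //.
    by rewrite !mulr_ge0 // addr_ge0.
  have b0 : 0 <= C * (D1 + 1) * dl by rewrite !mulr_ge0 // addr_ge0.
  apply: le_trans (mulmx_row_bound (x' - x) b0 HH) _.
  by rewrite ler_wpM2l // mulr_ge0.
apply: le_trans (lerD E1 E2) _; rewrite /K.
have := sqr_ge0 dl.
rewrite (_ : n%:R * (n%:R * (C * (D1 + 1) * dl) * dl) = n%:R * (n%:R * (C * (D1 + 1))) * dl ^+ 2); last by ring.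
lra.
Qed.

(* As w_l = 1, coordinate l of a vector nearly orthogonal to w is nearly
   determined by the other coordinates. *)
Let separated a a' x' (dl : R) (w : 'cV[R]_n) l : P a -> P a' -> Y x' ->
  (forall i, `|w i ord0| <= 1) -> w l ord0 = 1 ->
  `|(G a x' *m w) ord0 ord0| <= K * dl ^+ 2 ->
  `|(G a' x' *m w) ord0 ord0| <= K * dl ^+ 2 ->
  (forall i, i != l -> `|G a x' ord0 i - G a' x' ord0 i| <= K * dl ^+ 2) ->
  0 < dl -> `|a - a'| < T * dl ^+ 2.
Proof.
move=> Pa Pa' Yx' w1 wl h h' hi dl0.
set v := G a x' - G a' x'.
have K20 : 0 <= K * dl ^+ 2 by rewrite mulr_ge0 ?sqr_ge0 // ltW.
have hw : `|(v *m w) ord0 ord0| <= 2 * (K * dl ^+ 2).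
  rewrite /v mulmxBl rowBE; apply: le_trans (ler_normB _ _) _; lra.
have hl : `|v ord0 l| <= (n%:R + 2) * (K * dl ^+ 2).
  move: hw; rewrite mxE (bigD1 l) //= wl mulr1.
  set S := \sum_(_ | _) _ => hw.
  have hS : `|S| <= n%:R * (K * dl ^+ 2).
    apply: le_trans (ler_norm_sum _ _ _) _.
    apply: (@le_trans _ _ (\sum_(i < n | i != l) K * dl ^+ 2)).
      apply: ler_sum => i il; rewrite normrM.
      apply: le_trans (ler_pM _ _ (_ : _ <= K * dl ^+ 2) (w1 i)) _ => //.
        by rewrite /v rowBE; exact: hi.
      by rewrite mulr1.
    apply: (@le_trans _ _ (\sum_(i < n) K * dl ^+ 2)).
      by rewrite [leRHS](bigD1 l) //= lerDr.
    by rewrite sumr_const card_ord mulr_natl.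
  have := ler_normB (v ord0 l + S) S; rewrite addrK; lra.
have hv : `|v| <= (n%:R + 2) * (K * dl ^+ 2).
  apply: normr_row_le; first by rewrite mulr_ge0 // addr_ge0.
  move=> i; have [->//|il] := eqVneq i l.
  rewrite /v rowBE; apply: le_trans (hi i il) _.
  rewrite ler_peMl // -natr1; have : 0 <= m%:R :> R by []; lra.
have := le_trans (expand Pa Pa' Yx') hv.
rewrite -ler_pdivlMl // => /le_lt_trans; apply.
rewrite (_ : T * _ = c^-1 * (((n%:R + 2) * K + 1) * dl ^+ 2)); last by rewrite /T; ring.
rewrite ltr_pM2l ?invr_gt0 // mulrA ltr_pM2r ?exprn_gt0 //; lra.
Qed.

(** Suppose that every parameter a has a degenerate zero [X a]. Send a grid point to the cell of its
    zero together with n - 1 rounded coordinates of its value at a reference zero of that cell. By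
    [near_plane] and [separated] this map is injective, but it has fewer targets than grid
    points. *)
Lemma discrete_sard : exists a, P a /\ forall x, Y x -> G a x = 0 -> H a x \in unitmx.
Proof.
apply: contrapT => nex.
have /choice[X HX] : forall a, exists x, P a -> [/\ Y x, G a x = 0 & H a x \notin unitmx].
  move=> a; have [Pa|nPa] := pselect (P a); last by exists 0.
  apply: contrapT => nx; apply: nex; exists a; split => // x Yx Gx.
  by apply: contrapT => /negP Hx; apply: nx; exists x.
have /choice[W HW] : forall a, exists wl : 'cV[R]_n * 'I_n, P a ->
    [/\ H a (X a) *m wl.1 = 0, wl.1 wl.2 ord0 = 1 & forall i, `|wl.1 i ord0| <= 1].
  move=> a; have [Pa|nPa] := pselect (P a); last by exists (0, ord0).
  have [_ _ /singular_right_null[w [l [h1 h2 h3]]]] := HX a Pa.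
  by exists (w, l).
pose al := A / T; have al0 : 0 < al by rewrite divr_gt0.
pose b1 := 2 * r + 1; pose b2 := 2 * V / K + 1.
have b10 : 0 <= b1 by rewrite addr_ge0 // mulr_ge0.
have b20 : 0 <= b2 by rewrite addr_ge0 // divr_ge0 ?mulr_ge0 // ltW.
pose E := b1 ^+ n * b2 ^+ m.
(* [J] is the inverse cell size. The grid has more than (al J^2)^n points and the targets number at
   most E J^(2n-1), so J > E / al^n gives the contradiction. *)
pose J : R := (truncn (E / al ^+ n)).+1%:R.
have HJ : E / al ^+ n < J by exact: truncnS_gt.
have J1 : 1 <= J by rewrite ler1n.
have J0 : 0 < J by lra.
pose dl := J^-1.
have dl0 : 0 < dl by rewrite invr_gt0.
have dl1 : dl <= 1 by rewrite invf_le1.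
pose M := truncn (al * J ^+ 2).
pose N := truncn (2 * r * J).
pose Q := truncn (2 * V / K * J).
have B1 : 0 <= 2 * r * J by rewrite !mulr_ge0 // ltW.
have B2 : 0 <= 2 * V / K * J.
  by rewrite mulr_ge0 ?(ltW J0) // divr_ge0 ?mulr_ge0 // ltW.
have B3 : 0 <= al * J ^+ 2 by rewrite mulr_ge0 ?sqr_ge0 // ltW.
pose step := T * dl ^+ 2.
have step0 : 0 < step by rewrite mulr_gt0 // exprn_gt0.
pose gr (k : {ffun 'I_n -> 'I_M.+1}) : 'rV[R]_n := \row_i ((k i : nat)%:R * step).
have Pgr k : P (gr k).
  move=> j; rewrite mxE mulr_ge0 ?(ltW step0) //=.
  have : (k j : nat)%:R <= al * J ^+ 2.
    apply: le_trans (_ : M%:R <= _); first by rewrite ler_nat -ltnS.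
    by have /andP[] := truncn_itv B3.
  move=> /(ler_wpM2r (ltW step0)) /le_trans; apply.
  rewrite (_ : al * J ^+ 2 * step = A) // /al /step /dl.
  by field; rewrite !gt_eqF.
pose cell a : {ffun 'I_n -> 'I_N.+1} :=
  [ffun i => quantize N ((X a ord0 i - x0 ord0 i + r) * J)].
have cell_near a a' : P a -> P a' -> cell a = cell a' -> `|X a - X a'| <= dl.
  move=> Pa Pa' Ec; have [Ya _ _] := HX a Pa; have [Ya' _ _] := HX a' Pa'.
  apply: normr_row_le => [|i]; first exact: ltW.
  have bnd b : Y (X b) -> 0 <= (X b ord0 i - x0 ord0 i + r) * J <= 2 * r * J.
    move=> Yb; have := le_trans (coord_le_norm (X b - x0) i) Yb.
    rewrite rowBE ler_norml => /andP[h1 h2].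
    rewrite mulr_ge0 ?(ltW J0) //=; last lra.
    by rewrite ler_wpM2r ?(ltW J0) //; lra.
  have := quantize_eq (bnd _ Ya) (bnd _ Ya') (erefl N).
  move: Ec => /ffunP/(_ i); rewrite !ffunE => -> // /(_ erefl).
  rewrite -mulrBl normrM (gtr0_norm J0) -ltr_pdivlMr // => /ltW.
  by rewrite rowBE mul1r; congr (`|_| <= _); ring.
(* One grid point for each occupied cell; its zero and its null vector serve all parameters of the
   cell. The default only concerns empty cells. *)
pose ref (q : {ffun 'I_n -> 'I_N.+1}) : {ffun 'I_n -> 'I_M.+1} :=
  odflt [ffun=> ord0] [pick k | cell (gr k) == q].
have Href k : cell (gr (ref (cell (gr k)))) = cell (gr k).
  rewrite /ref; case: pickP => [k' /eqP //|/(_ k)]; by rewrite eqxx.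
(* [lift] skips the coordinate where the null vector equals 1, which [separated] recovers. Adding
   [V * dl] makes the values nonnegative, and the unit of rounding is [K * dl ^+ 2]. *)
pose Phi (k : {ffun 'I_n -> 'I_M.+1}) :=
  let a := gr (ref (cell (gr k))) in
  (cell (gr k), [ffun i : 'I_m => quantize Q
     ((G (gr k) (X a) ord0 (lift (W a).2 i) + V * dl) / (K * dl ^+ 2))]).
have Phi_inj : injective Phi.
  move=> k k'; rewrite /Phi => -[Ec].
  rewrite -Ec; set a := gr (ref _) => Eq.
  have Ea : cell a = cell (gr k) := Href k.
  have Pa : P a := Pgr _.
  have [Ya Ga Hs] := HX a Pa; have [Hw wl w1] := HW a Pa.
  have close k0 : cell (gr k0) = cell a -> `|X a - X (gr k0)| <= dl.
    by move=> E0; apply: cell_near.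
  have Ck : cell (gr k) = cell a by [].
  have Ck' : cell (gr k') = cell a by rewrite -Ec.
  have [Yk Gk _] := HX _ (Pgr k); have [Yk' Gk' _] := HX _ (Pgr k').
  have Kd0 : 0 < K * dl ^+ 2 by rewrite mulr_gt0 // exprn_gt0.
  have sep : `|gr k - gr k'| < T * dl ^+ 2.
    apply: (@separated _ _ (X a) dl (W a).1 (W a).2) => //.
    - exact: near_plane (Pgr k) Pa Yk Ya Gk Ga dl1 (close _ Ck) Hw w1.
    - exact: near_plane (Pgr k') Pa Yk' Ya Gk' Ga dl1 (close _ Ck') Hw w1.
    move=> i il; case: (unliftP (W a).2 i) => [i'|] Ei; last by rewrite Ei eqxx in il.
    move/ffunP: Eq => /(_ i'); rewrite !ffunE -Ei => Eq.
    have bnd k0 : `|G (gr k0) (X a)| <= V * dl ->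
       0 <= (G (gr k0) (X a) ord0 i + V * dl) / (K * dl ^+ 2) <= 2 * V / K * J.
      move=> /(le_trans (coord_le_norm _ i)); rewrite ler_norml => /andP[h1 h2].
      rewrite divr_ge0 ?(ltW Kd0) //=; last lra.
      rewrite ler_pdivrMr // (_ : 2 * V / K * J * _ = 2 * (V * dl)); first lra.
      by rewrite /dl; field; rewrite !gt_eqF.
    have bk := bnd k (close_value (Pgr k) Pa Yk Ya Gk dl1 (close _ Ck)).
    have bk' := bnd k' (close_value (Pgr k') Pa Yk' Ya Gk' dl1 (close _ Ck')).
    have := quantize_eq bk bk' (erefl Q) Eq.
    rewrite -mulrBl normrM normfV (gtr0_norm Kd0) ltr_pdivrMr // mul1r => /ltW.
    by congr (`|_| <= _); ring.
  (* Grid coordinates less than one step apart have indices less than 1 apart, hence equal. *)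
  apply/ffunP => i; apply: val_inj; apply/eqP; rewrite eqn_leq.
  have := le_lt_trans (coord_le_norm (gr k - gr k') i) sep.
  rewrite rowBE !mxE -mulrBl normrM (gtr0_norm step0) -/step gtr_pMl //.
  rewrite ltr_norml => /andP[h1 h2]; apply/andP; split.
    by rewrite -ltnS -(ltr_nat R) -natr1; lra.
  by rewrite -ltnS -(ltr_nat R) -natr1; lra.
have := leq_card _ Phi_inj; rewrite card_prod !card_ffun !card_ord.
rewrite -(ler_nat R) natrM !natrX leNgt => /negP; apply.
have hM : al * J ^+ 2 < M.+1%:R by exact: truncnS_gt.
have hN : N.+1%:R <= b1 * J.
  have /andP[h _] := truncn_itv B1; rewrite -natr1 /b1 mulrDl mul1r.
  by rewrite lerD.
have hQ : Q.+1%:R <= b2 * J.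
  have /andP[h _] := truncn_itv B2; rewrite -natr1 /b2 mulrDl mul1r.
  by rewrite lerD.
apply: (@lt_trans _ _ ((al * J ^+ 2) ^+ n)); last first.
  by rewrite ltr_pXn2r ?nnegrE.
apply: (@le_lt_trans _ _ ((b1 * J) ^+ n * (b2 * J) ^+ m)).
  by apply: ler_pM; rewrite ?exprn_ge0 //; apply: lerXn2r; rewrite ?nnegrE ?mulr_ge0 ?(ltW J0).
have -> : (b1 * J) ^+ n * (b2 * J) ^+ m = E * (J ^+ n * J ^+ m).
  by rewrite !exprMn /E; ring.
have -> : (al * J ^+ 2) ^+ n = (al ^+ n * J) * (J ^+ n * J ^+ m).
  by rewrite exprMn exprAC expr2 [X in _ * (X * _)]exprS; ring.
rewrite ltr_pM2r ?mulr_gt0 ?exprn_gt0 //.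
by rewrite mulrC -ltr_pdivrMr ?exprn_gt0.
Qed.

End Sard.

(** * Small C2 deformations *)

Section C2Bounds.
Context {R : realType} {n : nat}.
Implicit Types (f g : 'rV[R]_n -> R) (th ph : 'rV[R]_n -> 'rV[R]_n).

(** A real, coordinatewise form of a bound on [C2norm]: it is stable under linear combinations
    without suprema in the extended reals. *)
Definition C2bd (M : R) f := Ck 2 setT f /\
  forall g, deriv_le2 f g -> forall x, `|g x| <= M.

Lemma BballP (rho : R) th : Bball rho th <-> forall i, C2bd rho (Defs.comp i th).
Proof.
split=> [[hC Hn] i|H].
  split=> [|g Hg x]; first exact: hC i.
  by rewrite -lee_fin; apply: le_trans Hn; apply: ereal_sup_ubound; exists i, g, x.
split=> [i|]; first by case: (H i).
apply: ge_ereal_sup => _ [i [g [x [Hg ->]]]].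
by rewrite lee_fin; exact: (H i).2.
Qed.

Lemma C2dist_lt (M eps : R) th ph : M < eps ->
  (forall i, C2bd M (Defs.comp i (fun x => th x - ph x))) -> (C2dist th ph < eps%:E)%E.
Proof.
move=> Me H; apply: (@le_lt_trans _ _ M%:E); last by rewrite lte_fin.
apply: ge_ereal_sup => _ [i [g [x [Hg ->]]]].
by rewrite lee_fin; exact: (H i).2.
Qed.

Lemma C2dist_sup (eps : R) th ph : 0 < eps -> (C2dist th ph < eps%:E)%E ->
  forall x, `|th x - ph x| < eps.
Proof.
move=> e0 H x; apply: normr_row_lt => // i.
rewrite -lte_fin; apply: le_lt_trans H; apply: ereal_sup_ubound.
by exists i, (Defs.comp i (fun x => th x - ph x)), x; split => //; left.
Qed.

Lemma C2bd_partial (M : R) f : C2bd M f -> forall x,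
  differentiable f x /\ forall j, `|partial j f x| <= M.
Proof.
move=> [[d _] H] x; split=> [|j]; first exact: d.
by apply: H; right; left; exists j.
Qed.

Lemma partial_lin (a b : R) f g x j : differentiable f x -> differentiable g x ->
  differentiable (fun x => a * f x + b * g x) x /\
  partial j (fun x => a * f x + b * g x) x = a * partial j f x + b * partial j g x.
Proof.
move=> df dg; split.
  by apply: differentiableD; apply: differentiableZ.
have := diff_derivable (v := evec R j) df => /derivableP Hf.
have := diff_derivable (v := evec R j) dg => /derivableP Hg.
by rewrite /partial; apply: derive_val.
Qed.

Lemma C2bd_lin (a b Mf Mg : R) f g : C2bd Mf f -> C2bd Mg g ->
  C2bd (`|a| * Mf + `|b| * Mg) (fun x => a * f x + b * g x).
Proof.
move=> [[df cf] bf] [[dg cg] bg].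
have E1 j : partial j (fun x => a * f x + b * g x) =
    (fun x => a * partial j f x + b * partial j g x).
  by apply/funext => x; exact: (partial_lin a b j (df x I) (dg x I)).2.
have E2 i j : partial i (partial j (fun x => a * f x + b * g x)) =
    (fun x => a * partial i (partial j f) x + b * partial i (partial j g) x).
  apply/funext => x; rewrite E1.
  exact: (partial_lin a b i ((cf j).1 x I) ((cg j).1 x I)).2.
have bound u v : `|u| <= Mf -> `|v| <= Mg -> `|a * u + b * v| <= `|a| * Mf + `|b| * Mg.
  move=> hu hv; apply: le_trans (ler_normD _ _) _.
  by rewrite !normrM lerD // ler_wpM2l.
split; first split.
- by move=> x _; exact: differentiableD (differentiableZ _ (df x I)) (differentiableZ _ (dg x I)).
- move=> j; split => [x _|i x _].
    by rewrite E1; apply: differentiableD; apply: differentiableZ; [exact: (cf j).1|exact: (cg j).1].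
  rewrite E2; apply: continuousD; (apply: continuousM; first exact: cst_continuous).
    exact: (cf j).2.
  exact: (cg j).2.
- move=> h [->|[[j ->]|[i [j ->]]]] x.
  + by apply: bound; [apply: bf; left|apply: bg; left].
  + by rewrite E1; apply: bound; [apply: bf|apply: bg]; right; left; exists j.
  + by rewrite E2; apply: bound; [apply: bf|apply: bg]; right; right; exists i, j.
Qed.

Lemma C2bd_cst (c : R) : C2bd `|c| (cst c : 'rV[R]_n -> R).
Proof.
have E (k : R) j : partial j (cst k : 'rV[R]_n -> R) = cst 0.
  by apply/funext => x; rewrite /partial derive_cst.
split.
  split=> [x _|j]; first exact: differentiable_cst.
  rewrite E; split=> [x _|i x _]; first exact: differentiable_cst.
  by rewrite E; exact: cst_continuous.
move=> g [->|[[j ->]|[i [j ->]]]] x; rewrite ?E /cst //= normr0 //.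
Qed.

Lemma C2bd_le (M M' : R) f : M <= M' -> C2bd M f -> C2bd M' f.
Proof. by move=> MM [c b]; split => // g /b H x; exact: le_trans (H x) MM. Qed.

Definition lip (lam : R) th := forall x y, `|th x - th y| <= lam * `|x - y|.

Lemma Bball_lip (rho : R) th : 0 <= rho -> Bball rho th -> lip (n%:R * rho) th.
Proof.
move=> rho0 /BballP B x y; apply: normr_row_le; first by rewrite !mulr_ge0.
move=> i; have D := C2bd_partial (B i).
have := @mvt_bound R n (Defs.comp i th) y (x - y) rho.
rewrite [y + _]addrC subrK rowBE; apply => [t _|t j _]; first exact: (D _).1.
exact: (D _).2.
Qed.

End C2Bounds.

(** Gives rows the complete normed structure required by the Banach fixed point theorem. *)
HB.instance Definition _ (R : realType) (k : nat) := Complete.on 'rV[R]_k.+1.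

(** * Deformations as bi-Lipschitz homeomorphisms, and the cone property *)

Section Deformation.
Context {R : realType} {m : nat}.
Local Notation n := m.+1.
Implicit Types (x y u v p q : 'rV[R]_n) (th ph : 'rV[R]_n -> 'rV[R]_n) (Om : set 'rV[R]_n).

Definition shiftby th x := x + th x.

Lemma shiftby_dist_ge (lam : R) th x y : lip lam th ->
  (1 - lam) * `|x - y| <= `|shiftby th x - shiftby th y|.
Proof.
move=> /(_ x y) H.
have := ler_normB (shiftby th x - shiftby th y) (th x - th y).
rewrite (_ : shiftby th x - shiftby th y - (th x - th y) = x - y); first lra.
by rewrite /shiftby opprD addrACA addrK.
Qed.

Lemma shiftby_dist_le (lam : R) th x y : lip lam th ->
  `|shiftby th x - shiftby th y| <= (1 + lam) * `|x - y|.
Proof.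
move=> /(_ x y) H; rewrite /shiftby opprD addrACA.
by apply: le_trans (ler_normD _ _) _; lra.
Qed.

Lemma shiftby_dist_ge2 (lam : R) th x y : lam <= 1 / 2 -> lip lam th ->
  `|x - y| <= 2 * `|shiftby th x - shiftby th y|.
Proof.
move=> l2 /shiftby_dist_ge-/(_ x y); have := normr_ge0 (x - y); nra.
Qed.

Lemma shiftby_inj (lam : R) th : lam <= 1 / 2 -> lip lam th -> injective (shiftby th).
Proof.
move=> l2 L x y E; have := shiftby_dist_ge2 x y l2 L.
by rewrite E subrr normr0 mulr0 normr_le0 subr_eq0 => /eqP.
Qed.

(** Solving x + th x = y means finding a fixed point of the contraction x -> y - th x. *)
Lemma shiftby_surj (lam : R) th : 0 <= lam <= 1 / 2 -> lip lam th ->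
  forall y, exists x, shiftby th x = y.
Proof.
move=> /andP[l0 l2] L y; pose F x := y - th x.
have Ffun : set_fun setT setT F by [].
pose Ff : {fun [set: 'rV[R]_n] >-> [set: 'rV[R]_n]} :=
  HB.pack F (isFun.Build _ _ _ _ F Ffun).
have [||p _ Fp] := @banach_fixed_point R 'rV[R]_n setT Ff _ closedT.
- exists (NngNum l0); split => /=; first lra.
  move=> [u v] _ /=; rewrite /F opprD addrACA subrr add0r opprK addrC distrC.
  exact: L.
- by exists 0.
exists p; rewrite /shiftby {1}Fp /= /F subrK //.
Qed.

Lemma shiftby_inverse (lam : R) th : 0 <= lam <= 1 / 2 -> lip lam th ->
  exists ti, cancel (shiftby th) ti /\ cancel ti (shiftby th).
Proof.
move=> l02 L; have /choice[ti Hti] := shiftby_surj l02 L.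
exists ti; split => // x; have /andP[_ l2] := l02.
exact: shiftby_inj l2 L _ _ (Hti _).
Qed.

Lemma deformE Om th ti : cancel (shiftby th) ti -> cancel ti (shiftby th) ->
  deform Om th = [set y | Om (ti y)].
Proof.
move=> K1 K2; apply/seteqP; split => [_ [x Ox <-]|y /= Oy].
  by rewrite /= (K1 x).
by exists (ti y) => //; exact: K2.
Qed.

Lemma inverse_dist (lam : R) th ti x y : lam <= 1 / 2 -> lip lam th ->
  cancel ti (shiftby th) -> `|ti x - ti y| <= 2 * `|x - y|.
Proof. by move=> l2 L K; have := shiftby_dist_ge2 (ti x) (ti y) l2 L; rewrite !K. Qed.

Lemma inverse_continuous (lam : R) th ti : lam <= 1 / 2 -> lip lam th ->
  cancel ti (shiftby th) -> continuous ti.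
Proof.
move=> l2 L K x B /nbhs_ballP[e /= e0 HB].
have e20 : 0 < e / 2 by lra.
apply/nbhs_ballP; exists (e / 2) => //= y; rewrite ball_rowE => xy.
apply: HB; rewrite ball_rowE; have := inverse_dist x y l2 L K; lra.
Qed.

Lemma deform_open (lam : R) Om th : 0 <= lam <= 1 / 2 -> lip lam th -> open Om ->
  open (deform Om th).
Proof.
move=> l02 L oO; have [ti [K1 K2]] := shiftby_inverse l02 L.
rewrite (deformE _ K1 K2); apply: open_comp => // x _.
by have /andP[_ l2] := l02; exact: inverse_continuous l2 L K2 x.
Qed.

(* [Om] lies locally below a graph in the direction [sg *: evec j]. *)
Definition cone Om q (j : 'I_n) (sg r : R) := forall u u' (t : R),
  `|u - q| < r -> `|u' - q| < r -> Om u -> 0 <= t ->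
  `|u - u' - (t * sg) *: evec R j| <= t / (2 * n%:R) -> Om u'.

(** Let M be the largest |partial_k phi(q)|, attained at j. Near q the partials vary by at most M/8.
    Moving back by t along the outward direction then lowers [phi] by at least 7/8 M t, while an
    error of t/(2n) per coordinate costs at most n (t/(2n)) (9/8) M = 9/16 M t. *)
Lemma cone_exists Om q : smooth_bounded_open Om -> closure Om q -> ~ Om q ->
  exists j (sg r : R), [/\ `|sg| = 1, 0 < r & cone Om q j sg r].
Proof.
move=> [_ _ /(_ q)] /[apply] /[apply] -[r [phi [r0 sm [j0 dj0] Hphi]]].
have [dphi cphi] := sm 1%N.
pose F j := `|partial j phi q|.
pose j := [arg max_(j > j0) F j]%O.
have Hj k : F k <= F j.
  by rewrite /j; case: arg_maxP => // i _ /(_ k); apply.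
set M := F j; have M0 : 0 < M by apply: lt_le_trans (Hj j0); rewrite normr_gt0.
have n0 : 0 < n%:R :> R by rewrite ltr0n.
have [d d0 Hd] : exists2 d : R, 0 < d & forall k x, `|x - q| < d ->
    `|partial k phi x - partial k phi q| <= M / 8.
  have M80 : 0 < M / 8 by lra.
  apply: (@fin_pos_common _ _ (fun k d => forall x, `|x - q| < d ->
      `|partial k phi x - partial k phi q| <= M / 8)) => [k|k d d' _ dd H x xd].
    have [d d0 H] := continuous_pos (cphi k q I) M80.
    by exists d => // x /H /ltW.
  by apply: H; exact: lt_le_trans dd.
have {}Hd x : `|x - q| < d -> forall k, `|partial k phi x - partial k phi q| <= M / 8.
  by move=> xd k; exact: Hd.
(* The local equation of [Om] holds in a Euclidean ball, and the Euclidean norm is at most n times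
   the supremum norm. *)
pose r' := Num.min d (r / n%:R).
have r'0 : 0 < r' by rewrite lt_min d0 divr_gt0.
have r'r x : `|x - q| < r' -> enorm (x - q) < r.
  rewrite lt_min => /andP[_]; rewrite ltr_pdivlMr // mulrC; apply: le_lt_trans.
  rewrite enormE -[leRHS]ger0_norm ?mulr_ge0 // -sqrtr_sqr ler_wsqrtr //.
  apply: le_trans (sqn_le _) _; rewrite exprMn ler_wpM2r ?sqr_ge0 //.
  by rewrite expr2 ler_peMl // ler1n.
pose sg := Num.sg (partial j phi q).
have sgM : sg * partial j phi q = M by rewrite /M /F normrEsg.
have sg1 : `|sg| = 1 by rewrite normr_sg -normr_eq0 gt_eqF.
exists j, sg, r'; split => // u u' t uq u'q Ou t0 err.
apply/(Hphi _ (r'r _ u'q)); have := (Hphi _ (r'r _ uq)).1 Ou.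
apply: le_lt_trans; rewrite -subr_ge0.
have [|s s01] := @mvt_partial R n phi u' (u - u'); first by move=> s _; exact: dphi.
rewrite [u' + _]addrC subrK => ->.
set xi := u' + _.
have xid : `|xi - q| < d.
  have uq' : `|u - q| < d by move: uq; rewrite lt_min => /andP[].
  have u'q' : `|u' - q| < d by move: u'q; rewrite lt_min => /andP[].
  have -> : xi - q = s *: (u - q) + (1 - s) *: (u' - q).
    rewrite /xi; apply/rowP => k; rewrite !(rowBE, rowDE, rowZE); ring.
  have /andP[s0 s1] := s01.
  apply: le_lt_trans (ler_normD _ _) _; rewrite !normrZ (ger0_norm s0).
  rewrite ger0_norm ?subr_ge0 //.
  pose mx := Num.max `|u - q| `|u' - q|.
  have mxd : mx < d by rewrite gt_max uq' u'q'.
  have h1 : 0 <= s * (mx - `|u - q|) by rewrite mulr_ge0 // subr_ge0 le_max lexx.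
  have h2 : 0 <= (1 - s) * (mx - `|u' - q|).
    by rewrite mulr_ge0 ?subr_ge0 // le_max lexx orbT.
  lra.
pose e := u - u' - (t * sg) *: evec R j.
have -> : \sum_k (u - u') ord0 k * partial k phi xi =
    \sum_k e ord0 k * partial k phi xi + t * sg * partial j phi xi.
  rewrite [X in _ = _ + X](_ : _ = \sum_k ((t * sg) *: evec R j) ord0 k * partial k phi xi).
    rewrite -big_split; apply: eq_bigr => k _ /=; rewrite -mulrDl -rowDE; congr (_ * _).
    by rewrite /e subrK.
  rewrite (bigD1 j) //= rowZE mxE eqxx mulr1 big1 ?addr0 // => k kj.
  by rewrite rowZE mxE (negbTE kj) mulr0 mul0r.
have S1 : `|\sum_k e ord0 k * partial k phi xi| <= n%:R * (t / (2 * n%:R) * (9 / 8 * M)).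
  apply: le_trans (ler_norm_sum _ _ _) _.
  rewrite (_ : n%:R * _ = \sum_(k < n) (t / (2 * n%:R) * (9 / 8 * M))); last first.
    by rewrite sumr_const card_ord mulr_natl.
  apply: ler_sum => k _; rewrite normrM ler_pM //.
    exact: le_trans (coord_le_norm _ _) err.
  have h1 : `|partial k phi q| <= M := Hj k; have h2 := Hd _ xid k.
  have := ler_normD (partial k phi xi - partial k phi q) (partial k phi q).
  rewrite subrK; lra.
have S2 : t * (7 / 8 * M) <= t * sg * partial j phi xi.
  rewrite -[leRHS]mulrA ler_wpM2l //.
  have h : `|sg * (partial j phi xi - partial j phi q)| <= M / 8.
    by rewrite normrM sg1 mul1r; exact: Hd.
  move: h; rewrite mulrBr sgM ler_norml => /andP[h _]; lra.
have E : n%:R * (t / (2 * n%:R) * (9 / 8 * M)) = t * (9 / 16 * M).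
  by field; rewrite gt_eqF.
move: S1; rewrite E ler_norml => /andP[S1 _]; have : 0 <= t * M by rewrite mulr_ge0 // ltW.
lra.
Qed.

(** Half of the tolerance of [cone] is spent on replacing the limit point u by a nearby point of
    [Om]. *)
Lemma cone_strict Om q j (sg r : R) u u' t : cone Om q j sg r ->
  `|u - q| < r -> `|u' - q| < r -> closure Om u -> 0 < t ->
  `|u - u' - (t * sg) *: evec R j| <= t / (4 * n%:R) -> Om u'.
Proof.
move=> co uq u'q cu t0 err.
have n0 : 0 < n%:R :> R by rewrite ltr0n.
pose d := Num.min (r - `|u - q|) (t / (4 * n%:R)).
have d0 : 0 < d by rewrite lt_min subr_gt0 uq divr_gt0 // mulr_gt0.
have [v [Ov]] := cu _ (nbhsx_ballx u _ d0).
rewrite ball_rowE lt_min => /andP[v1 v2].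
apply: (co v u' t) => //.
- have := ler_normD (v - u) (u - q); rewrite addrA subrK [`|v - u|]distrC; lra.
- exact: ltW.
- rewrite (_ : v - u' - _ = (v - u) + (u - u' - (t * sg) *: evec R j)); last first.
    by rewrite !addrA subrK.
  apply: le_trans (ler_normD _ _) _; rewrite [`|v - u|]distrC.
  have -> : t / (2 * n%:R) = t / (4 * n%:R) + t / (4 * n%:R) by field; rewrite gt_eqF.
  by rewrite lerD // ltW.
Qed.

(** The images differ by t, so the points differ by at most 2t and their displacements by at most 2
    lam t. The bound 1/(8n) on lam turns this into the tolerance of [cone_strict]. *)
Lemma shiftby_translate (lam : R) th u u' (t sg : R) j : 0 <= lam -> lip lam th ->
  lam <= 1 / (8 * n%:R) -> `|sg| = 1 -> 0 <= t ->
  shiftby th u - shiftby th u' = (t * sg) *: evec R j ->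
  `|u - u' - (t * sg) *: evec R j| <= t / (4 * n%:R).
Proof.
move=> l0 L l8 sg1 t0 E.
have n0 : 0 < n%:R :> R by rewrite ltr0n.
have l2 : lam <= 1 / 2.
  apply: le_trans l8 _; rewrite ler_pdivrMr ?mulr_gt0 // mulrA.
  have : 1 <= n%:R :> R by rewrite ler1n.
  lra.
have h := shiftby_dist_ge2 u u' l2 L.
rewrite -E /shiftby.
have -> : u - u' - (u + th u - (u' + th u')) = th u' - th u.
  by apply/rowP => k; rewrite !(rowBE, rowDE, rowZE); ring.
rewrite distrC; apply: le_trans (L u u') _.
rewrite E normrZ norm_evec mulr1 normrM sg1 mulr1 ger0_norm // in h.
apply: le_trans (ler_pM l0 (normr_ge0 _) l8 h) _.
by rewrite le_eqVlt; apply/orP; left; apply/eqP; field; rewrite gt_eqF.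
Qed.

End Deformation.

(** * Null boundaries and closedness of degeneracy *)

Section MovingDomains.
Context {R : realType} {n : nat}
  (mu : {sigma_finite_measure set (BR R n) -> \bar R}).

(** Extend the integrands by zero: off [N] membership in the domains is eventually constant, so they
    converge pointwise and dominated convergence applies. *)
Lemma cvg_Rintegral_moving (E_ : nat -> set (BR R n)) (E : set (BR R n))
    (F_ : nat -> BR R n -> R) (F g : BR R n -> R) (N : set (BR R n)) :
  (forall k, measurable (E_ k)) -> measurable E ->
  (forall k, measurable_fun (E_ k) (F_ k)) -> measurable_fun E F ->
  mu.-integrable setT (EFin \o g) -> (forall y, 0 <= g y) ->
  (forall k y, E_ k y -> `|F_ k y| <= g y) ->
  measurable N -> mu N = 0%E ->
  (forall y, ~ N y -> \forall k \near \oo, E_ k y <-> E y) ->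
  (forall y, E y -> F_ k y @[k --> \oo] --> F y) ->
  \int[mu]_(y in E_ k) F_ k y @[k --> \oo] --> \int[mu]_(y in E) F y.
Proof.
move=> mE_ mE mF_ mF ig g0 Fg mN N0 EE FF.
pose f_ k : BR R n -> \bar R := (fun y => (F_ k y)%:E) \_ (E_ k).
pose f : BR R n -> \bar R := (fun y => (F y)%:E) \_ E.
have mf_ k : measurable_fun setT (f_ k).
  by apply/(measurable_restrictT _ (mE_ k))/measurable_EFinP.
have mf : measurable_fun setT f.
  by apply/(measurable_restrictT _ mE)/measurable_EFinP.
have cvf : {ae mu, forall y, setT y -> f_ ^~ y @ \oo --> f y}.
  exists N; split => // y /= H; apply: contrapT => Ny; apply: H => _.
  have {}EE := EE y Ny; rewrite /f /f_ patchE.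
  have [yE|yE] := boolP (y \in E).
    apply: (@cvg_trans _ ((fun k => (F_ k y)%:E) @ \oo)); last first.
      by apply: cvg_EFin; [exact: nearW|exact: FF (set_mem yE)].
    apply: near_eq_cvg; near=> k; rewrite patchE mem_set //.
    suff : E_ k y <-> E y by case=> _; apply; exact: set_mem.
    by near: k.
  apply: cvg_near_cst; near=> k; rewrite patchE memNset // => EKy.
  move: yE; rewrite notin_setE; apply.
  by suff : E_ k y <-> E y; [case=> H1 _; exact: H1|near: k].
have dom : {ae mu, forall y k, setT y -> (`|f_ k y| <= (EFin \o g) y)%E}.
  apply: aeW => y k _; rewrite /f_ patchE; case: ifPn => [yE|_] /=.
    by rewrite lee_fin Fg //; exact: set_mem.
  by rewrite normr0 lee_fin.
have [if_ _ H] := dominated_convergence measurableT mf_ mf cvf ig dom.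
have Ef : (\int[mu]_(y in E) (F y)%:E = \int[mu]_y f y)%E by rewrite integral_mkcond.
have Ef_ k : (\int[mu]_(y in E_ k) (F_ k y)%:E = \int[mu]_y f_ k y)%E.
  by rewrite integral_mkcond.
have fin : (\int[mu]_y f y)%E \is a fin_num by exact: integrable_fin_num if_.
have -> : (fun k => \int[mu]_(y in E_ k) F_ k y) = fine \o (fun k => (\int[mu]_y f_ k y)%E).
  by apply/funext => k; rewrite /= /Rintegral Ef_.
rewrite /Rintegral Ef; apply: fine_cvg.
by rewrite fineK.
Unshelve. all: by end_near. Qed.

End MovingDomains.

Section NullBoundary.
Context {R : realType} {m : nat}.
Local Notation n := m.+1.
Context (mu : {sigma_finite_measure set (BR R n) -> \bar R}) (Hmu : is_volume mu).
Implicit Types (Om : set 'rV[R]_n) (th : 'rV[R]_n -> 'rV[R]_n) (v y : 'rV[R]_n).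

(** The translates by v/(k+1) are disjoint, have equal measure and lie in one ball of finite
    measure. *)
Lemma null_disjoint_translates (E : set 'rV[R]_n) v (B : R) :
  measurable (E : set (BR R n)) ->
  (forall y, E y -> `|y| < B) -> `|v| <= 1 ->
  (forall y (t t' : R), t < t' -> E (y + t *: v) -> E (y + t' *: v) -> False) ->
  mu E = 0%E.
Proof.
move=> mE EB v1 dis.
pose E_ (k : nat) : set (BR R n) := [set y : 'rV[R]_n | E (y + k.+1%:R^-1 *: v)].
have muE k : mu (E_ k) = mu E by rewrite /E_ (volume_translation Hmu).
have mE_ k : measurable (E_ k).
  have mf : measurable_fun setT
      ((fun y : 'rV[R]_n => y + k.+1%:R^-1 *: v) : BR R n -> BR R n).
    apply: measurable_fun_row => j.
    rewrite (_ : (fun _ => _) = (fun y : BR R n => y ord0 j + (k.+1%:R^-1 *: v) ord0 j)).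
      by apply: measurable_funD => //; exact: measurable_coord.
    by apply/funext => y; rewrite mxE.
  by have := mf measurableT _ mE; rewrite setTI.
have tE : trivIset setT E_.
  apply/trivIsetP => i k _ _ ik; apply/seteqP; split => // y /= [Ei Ek].
  have [h|h|h] := ltgtP i k.
  - apply: (dis y k.+1%:R^-1 i.+1%:R^-1) => //.
    by rewrite ltf_pV2 ?posrE // ltr_nat ltnS.
  - apply: (dis y i.+1%:R^-1 k.+1%:R^-1) => //.
    by rewrite ltf_pV2 ?posrE // ltr_nat ltnS.
  - by rewrite h eqxx in ik.
pose U : set (BR R n) := [set y : 'rV[R]_n | `|0 - y| < B + 1].
have muU := volume_ball_lty Hmu 0 (B + 1).
have mU : measurable U by exact: measurable_supball.
have EU k : E_ k `<=` U.
  move=> y /EB h; rewrite /U /= sub0r normrN.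
  have := ler_normB (y + k.+1%:R^-1 *: v) (k.+1%:R^-1 *: v); rewrite addrK.
  have : `|k.+1%:R^-1 *: v| <= 1.
    rewrite normrZ ger0_norm ?invr_ge0 // mulr_ile1 // invf_le1 // ler1n //.
  lra.
have Ufin : mu U \is a fin_num by rewrite ge0_fin_numE.
have Efin : mu E \is a fin_num.
  rewrite ge0_fin_numE // -(muE 0%N); apply: le_lt_trans muU.
  by apply: le_measure; rewrite ?inE.
set a := fine (mu E); set b := fine (mu U).
have bound N : a *+ N <= b.
  rewrite -lee_fin (fineK Ufin).
  have -> : (a *+ N)%:E = mu (\big[setU/set0]_(i < N) E_ i).
    rewrite measure_bigsetU //.
    have -> : (\sum_(i < N) mu (E_ i) = \sum_(i < N) a%:E)%E.
      by apply: eq_bigr => i _; rewrite muE /a fineK.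
    by rewrite sumEFin sumr_const card_ord.
  apply: le_measure; rewrite ?inE //; first exact: bigsetU_measurable.
  by move=> y; rewrite -bigcup_mkord => -[k _]; exact: EU.
have a0 : 0 <= a by exact: fine_ge0.
rewrite -(fineK Efin) -/a; congr EFin; apply/eqP; rewrite eq_le a0 andbT leNgt.
apply/negP => {}a0; have := bound (truncn (b / a)).+1; rewrite -mulr_natr.
have := truncnS_gt (b / a); rewrite ltr_pdivrMr // mulrC; lra.
Qed.

Definition bdry Om u := closure Om u /\ ~ Om u.

Lemma null_boundary (lam : R) Om th ti : 0 <= lam -> lam <= 1 / (8 * n%:R) ->
  lip lam th -> cancel (shiftby th) ti -> cancel ti (shiftby th) ->
  smooth_bounded_open Om ->
  measurable ([set y | bdry Om (ti y)] : set (BR R n)) /\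
  mu [set y : 'rV[R]_n | bdry Om (ti y)] = 0%E.
Proof.
move=> l0 l8 L K1 K2 HO.
have n1 : 1 <= n%:R :> R by rewrite ler1n.
have l2 : lam <= 1 / 2.
  apply: le_trans l8 _; rewrite ler_pdivrMr ?mulr_gt0 // ?ltr0n //; lra.
have cti := inverse_continuous l2 L K2.
have [oO [M HM] _] := HO.
have M1 u : Om u -> `|u| <= M by move=> /HM; exact: le_trans (norm_le_enorm u).
have cM u : closure Om u -> `|u| <= M + 1.
  move=> /(_ _ (nbhsx_ballx u 1 ltr01))[v [Ov]]; rewrite ball_rowE => uv.
  have := M1 _ Ov; have := ler_normD (u - v) v; rewrite subrK; lra.
have mpre (A : set 'rV[R]_n) : open A -> measurable ([set y | A (ti y)] : set (BR R n)).
  by move=> oA; apply: open_measurable_row; apply: open_comp => // x _; exact: cti.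
have mbd : measurable ([set y | bdry Om (ti y)] : set (BR R n)).
  have -> : [set y | bdry Om (ti y)] =
      (~` [set y | (~` closure Om) (ti y)]) `&` (~` [set y | Om (ti y)]).
    apply/seteqP; split => y /=; first by case=> h1 h2; split => // h3; exact: h3.
    by case=> /contrapT h1 h2; split.
  apply: measurableI; apply: measurableC; apply: mpre => //.
  apply: closed_openC; exact: closed_closure.
split=> //.
pose N (c : 'rV[rat]_n) (k : nat) : set 'rV[R]_n :=
  [set y | bdry Om (ti y) /\ `|map_mx ratr c - ti y| < k.+1%:R^-1].
(* Only the null pieces are kept, so the union is negligible by construction. The content of the
   proof is that they still cover the boundary. *)
pose NN (i : nat) : set (BR R n) :=
  if unpickle i is Some (c, k) then
    if `[< mu (N c k) = 0%E >] then N c k else set0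
  else set0.
have mN c k : measurable (N c k : set (BR R n)).
  apply: measurableI => //; apply: (mpre [set u : 'rV[R]_n | `|map_mx ratr c - u| < k.+1%:R^-1]).
  have -> : [set u : 'rV[R]_n | `|map_mx ratr c - u| < k.+1%:R^-1] =
     ball (map_mx ratr c : 'rV[R]_n) k.+1%:R^-1.
    by apply/seteqP; split => u; rewrite /= -ball_normE.
  exact: ball_open.
have neg : mu.-negligible (\bigcup_i NN i).
  apply: negligible_bigcup => i; rewrite /NN.
  case: (unpickle i) => [[c k]|]; last exact: negligible_set0.
  case: asboolP => [h|_]; last exact: negligible_set0.
  by exists (N c k); split.
have sub : [set y | bdry Om (ti y)] `<=` \bigcup_i NN i.
  move=> y [cu nu]; set q := ti y in cu nu *.
  have [j [sg [r [sg1 r0 co]]]] := cone_exists HO cu nu.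
  have [k hk] : exists k : nat, k.+1%:R^-1 < r / 2.
    have [k] := ltr_add_invr (y := 0 : R) (x := r / 2) ltac:(lra).
    by rewrite add0r => hk; exists k.
  have [|c hc] := @row_rat_approx R n q (k.+1%:R^-1); first by rewrite invr_gt0.
  exists (pickle (c, k)) => //; rewrite /NN pickleK; case: asboolP => [_|]; last first.
    case.
    apply: (@null_disjoint_translates _ (sg *: evec R j) (2 * (M + 1) + `|shiftby th 0| + 1)).
    - exact: mN.
    - move=> z [[cz _] _].
      have h1 := cM _ cz.
      have := shiftby_dist_le (ti z) 0 L; rewrite K2 subr0 => h2.
      have := ler_normD (z - shiftby th 0) (shiftby th 0); rewrite subrK.
      have : (1 + lam) * `|ti z| <= 2 * (M + 1).
        by apply: ler_pM => //; lra.
      lra.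
    - by rewrite normrZ norm_evec mulr1 sg1.
    (* Of two boundary points on one line in the cone direction, the one further out puts the other
       inside [Om]. *)
    move=> z t t' tt' [[_ nz] dz] [[cz' _] dz'].
    apply: nz.
    have near_q u : `|map_mx ratr c - u| < k.+1%:R^-1 -> `|u - q| < r.
      move=> hu; have -> : u - q = (u - map_mx ratr c) + (map_mx ratr c - q).
        by rewrite addrA subrK.
      apply: le_lt_trans (ler_normD _ _) _; rewrite (splitr r).
      by rewrite ltrD // distrC (lt_trans _ hk).
    apply: (cone_strict co (near_q _ dz') (near_q _ dz) cz' (t := t' - t)).
      by rewrite subr_gt0.
    apply: shiftby_translate l0 L l8 sg1 _ _; first by rewrite subr_ge0 ltW.
    rewrite !K2 !scalerA opprD addrACA subrr add0r -scalerBl; congr (_ *: _); ring.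
  split => //=; rewrite distrC; exact: hc.
by apply/(negligibleP mu mbd); apply: negligibleS neg.
Qed.

(** The preimages of y under the approximating maps converge to [ti y], which lies in one of two
    open sets: [Om] or the complement of its closure. *)
Lemma deform_stable (lam : R) Om (th_ : nat -> 'rV[R]_n -> 'rV[R]_n) th
    (ti_ : nat -> 'rV[R]_n -> 'rV[R]_n) ti :
  lam <= 1 / 2 -> (forall k, lip lam (th_ k)) ->
  (forall k, cancel (ti_ k) (shiftby (th_ k))) ->
  cancel ti (shiftby th) -> open Om ->
  (forall e : R, 0 < e -> \forall k \near \oo, forall x, `|th_ k x - th x| <= e) ->
  forall y, ~ bdry Om (ti y) -> \forall k \near \oo, Om (ti_ k y) <-> Om (ti y).
Proof.
move=> l2 L K2_ K2 oO cv y nb; set u := ti y in nb *.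
have close (e : R) : 0 < e -> \forall k \near \oo, `|u - ti_ k y| < e.
  move=> e0; have e40 : 0 < e / 4 by lra.
  apply: filterS (cv _ e40) => k Hk.
  have := shiftby_dist_ge2 (ti_ k y) u l2 (L k); rewrite K2_ => h.
  have E : y = shiftby th u by rewrite K2.
  have : `|y - shiftby (th_ k) u| <= e / 4.
    rewrite E /shiftby opprD addrACA subrr add0r distrC; exact: Hk.
  by move=> h2; rewrite [ltLHS]distrC; lra.
have [Ou|nOu] := pselect (Om u).
  have /nbhs_ballP[e /= e0 He] : nbhs u Om by exact: open_nbhs_nbhs.
  apply: filterS (close e e0) => k hk; split => // _; apply: He.
  by rewrite ball_rowE.
have ncl : ~ closure Om u by move=> h; apply: nb.
have /nbhs_ballP[e /= e0 He] : nbhs u (~` closure Om).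
  by apply: open_nbhs_nbhs; split => //; apply: closed_openC; exact: closed_closure.
apply: filterS (close e e0) => k hk; split => // h; exfalso.
by apply: (He (ti_ k y)); [rewrite ball_rowE|exact: subset_closure].
Qed.

End NullBoundary.

Section CvgDet.
Context {R : realType} {n : nat}.

Lemma cvg_nat_unique (u : nat -> R) (a b : R) :
  u k @[k --> \oo] --> a -> u k @[k --> \oo] --> b -> a = b.
Proof.
move=> ua ub; have Ea := cvg_lim (@norm_hausdorff _ R) ua.
by have Eb := cvg_lim (@norm_hausdorff _ R) ub; rewrite -Ea -Eb.
Qed.

Lemma cvg_det (M_ : nat -> 'M[R]_n) (M : 'M[R]_n) :
  (forall i j, M_ k i j @[k --> \oo] --> M i j) -> \det (M_ k) @[k --> \oo] --> \det M.
Proof.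
move=> H; rewrite /determinant.
have cvg_sum' (I : Type) (s : seq I) (u : I -> nat -> R) (l : I -> R) :
    (forall i, u i k @[k --> \oo] --> l i) ->
    \sum_(i <- s) u i k @[k --> \oo] --> \sum_(i <- s) l i.
  move=> Hu; elim: s => [|i s IH].
    by under eq_cvg do rewrite big_nil; rewrite big_nil; exact: cvg_cst.
  by under eq_cvg do rewrite big_cons; rewrite big_cons; exact: cvgD.
have cvg_prod' (I : Type) (s : seq I) (u : I -> nat -> R) (l : I -> R) :
    (forall i, u i k @[k --> \oo] --> l i) ->
    \prod_(i <- s) u i k @[k --> \oo] --> \prod_(i <- s) l i.
  move=> Hu; elim: s => [|i s IH].
    by under eq_cvg do rewrite big_nil; rewrite big_nil; exact: cvg_cst.
  by under eq_cvg do rewrite big_cons; rewrite big_cons; exact: cvgM.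
apply: cvg_sum' => s; apply: cvgM; first exact: cvg_cst.
exact: cvg_prod'.
Qed.

End CvgDet.

(** * Closedness of the set of degenerate maps *)

Section DegenerateSet.
Context {R : realType} {m : nat}.
Local Notation n := m.+1.
Context (mu : {sigma_finite_measure set (BR R n) -> \bar R}) (Hmu : is_volume mu).
Implicit Types (Om K : set 'rV[R]_n) (th : 'rV[R]_n -> 'rV[R]_n) (z : 'rV[R]_n).

Definition degenerate_crit (f : 'rV[R]_n -> R) x :=
  (forall j, partial j f x = 0) /\ hessian f x \notin unitmx.

(** The critical point is located by its preimage in the fixed set [K], because the deformed domain
    moves with [th]. *)
Definition degenerate_maps Om (rho : R) K : set ('rV[R]_n -> 'rV[R]_n) :=
  [set th | Bball rho th /\
     exists z, K z /\ degenerate_crit (psi (deform Om th)) (shiftby th z)].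

Lemma away_deform (lam e : R) Om th ti z : lam <= 1 / 2 -> lip lam th ->
  cancel (shiftby th) ti -> cancel ti (shiftby th) ->
  (forall u, `|z - u| < e -> Om u) ->
  away (e / 2) (~` deform Om th) (shiftby th z).
Proof.
move=> l2 L K1 K2 He y; rewrite (deformE _ K1 K2) /= => ny.
rewrite leNgt; apply/negP => hy; apply: ny; apply: He.
have := shiftby_dist_ge2 z (ti y) l2 L; rewrite K2; lra.
Qed.

(** Joint continuity of a potential in the map and the point. Memberships stabilise off the null
    image of the boundary; the points stay bounded and at distance d from the complements, so one
    multiple of [weight] dominates. *)
Lemma cvg_pot_moving (lam d : R) Om th (th_ : nat -> 'rV[R]_n -> 'rV[R]_n) ti
    (ti_ : nat -> 'rV[R]_n -> 'rV[R]_n) e x (x_ : nat -> 'rV[R]_n) :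
  0 <= lam -> lam <= 1 / (8 * n%:R) -> smooth_bounded_open Om ->
  lip lam th -> (forall k, lip lam (th_ k)) ->
  cancel (shiftby th) ti -> cancel ti (shiftby th) ->
  (forall k, cancel (shiftby (th_ k)) (ti_ k)) ->
  (forall k, cancel (ti_ k) (shiftby (th_ k))) ->
  (forall e : R, 0 < e -> \forall k \near \oo, forall x, `|th_ k x - th x| <= e) ->
  0 < d -> (forall k, away d (~` deform Om (th_ k)) (x_ k)) ->
  away d (~` deform Om th) x ->
  x_ k @[k --> \oo] --> x -> (forall k, `|x_ k - x| <= 1) ->
  pot mu (~` deform Om (th_ k)) e (x_ k) @[k --> \oo] -->
  pot mu (~` deform Om th) e x.
Proof.
move=> l0 l8 HO L L_ K1 K2 K1_ K2_ cv d0 ad_ ad cx bx.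
have l2 : lam <= 1 / 2.
  apply: le_trans l8 _; rewrite ler_pdivrMr ?mulr_gt0 // ?ltr0n //.
  have : 1 <= n%:R :> R by rewrite ler1n.
  lra.
have l02 : 0 <= lam <= 1 / 2 by rewrite l0.
have [oO _ _] := HO.
have mD th0 : lip lam th0 -> measurable (~` deform Om th0 : set (BR R n)).
  by move=> L0; apply: measurableC; apply: open_measurable_row; exact: deform_open l02 L0 oO.
have M0 : 0 <= `|x| + 1 by rewrite addr_ge0.
have [C C0 HC] := @ker_le_weight R n e d (`|x| + 1) d0 M0.
have [mN N0] := null_boundary Hmu l0 l8 L K1 K2 HO.
apply: (cvg_Rintegral_moving (g := fun y => C * weight (y : 'rV[R]_n)) (N := [set y | bdry Om (ti y)])) => //.
- by move=> k; exact: mD.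
- exact: mD.
- by move=> k; apply: measurable_ker d0 (ad_ k) _; exact: mD.
- by apply: measurable_ker d0 ad _; exact: mD.
- exact: weight_integrable Hmu C _ measurableT.
- by move=> y; rewrite mulr_ge0 // weight_ge0.
- move=> k y Ey; apply: HC; last exact: ad_ Ey.
  by have := ler_normD (x_ k - x) x; rewrite subrK; have := bx k; lra.
- move=> y /(deform_stable l2 L_ K2_ K2 oO cv).
  apply: filterS => k; rewrite (deformE _ (K1_ k) (K2_ k)) (deformE _ K1 K2) /=.
  by case=> h1 h2; split => h h'; apply: h; [apply: h2|apply: h1].
move=> y Ey.
have xy : x - y != 0.
  by rewrite -normr_gt0; apply: lt_le_trans (ad y Ey).
have ck := differentiable_continuous (differentiable_ker e xy).
have cxy : x_ k - y @[k --> \oo] --> x - y by apply: cvgB => //; exact: cvg_cst.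
exact: (continuous_cvg _ ck cxy).
Qed.

Lemma degenerate_maps_closed Om (rho : R) K : 0 <= rho -> n%:R * rho <= 1 / (8 * n%:R) ->
  smooth_bounded_open Om -> compact K -> K `<=` Om ->
  rel_closed (Bball rho) (degenerate_maps Om rho K).
Proof.
move=> rho0 l8 HO cK KO; split=> [th []//|th Bth Hth].
set lam := n%:R * rho in l8.
have l0 : 0 <= lam by rewrite mulr_ge0.
have l2 : lam <= 1 / 2.
  apply: le_trans l8 _; rewrite ler_pdivrMr ?mulr_gt0 // ?ltr0n //.
  have : 1 <= n%:R :> R by rewrite ler1n.
  lra.
have l02 : 0 <= lam <= 1 / 2 by rewrite l0.
have [oO _ _] := HO.
have /choice[ph Hph] : forall k : nat, exists ph, degenerate_maps Om rho K ph /\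
    (C2dist th ph < (k.+1%:R^-1)%:E)%E.
  by move=> k; apply: Hth; rewrite invr_gt0.
have /choice[zz Hzz] : forall k, exists z, K z /\
   degenerate_crit (psi (deform Om (ph k))) (shiftby (ph k) z).
  by move=> k; have [[_ H] _] := Hph k.
have FK : (zz @ \oo) K by exists 0%N => // k _; exact: (Hzz k).1.
have PF : ProperFilter (zz @ \oo) by exact: fmap_proper_filter.
have [z [Kz cz]] := cK (zz @ \oo) PF FK.
have Oz := KO _ Kz.
have [e0 e00 He] := open_ball_in oO Oz.
(* A convergent selection of the preimages. It need not be increasing: [k <= sg k] already gives the
   rate 1/(k+1). *)
have /choice[sg Hsg] : forall k : nat, exists i, (k <= i)%N /\
    `|z - zz i| < Num.min (e0 / 2) (k.+1%:R^-1).
  move=> k; pose r := Num.min (e0 / 2) (k.+1%:R^-1 : R).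
  have r0 : 0 < r by rewrite lt_min divr_gt0 // invr_gt0 ltr0n.
  have [|_ [[i ki <-] hi]] := cz [set zz i | i in [set i | (k <= i)%N]] _ _ (nbhsx_ballx z _ r0).
    by exists k => // i /= ki; exists i.
  by exists i; split => //; move: hi; rewrite ball_rowE.
pose th_ k := ph (sg k); pose z_ k := zz (sg k).
have d1 k x : `|th x - th_ k x| < k.+1%:R^-1.
  apply: lt_le_trans (C2dist_sup _ (Hph (sg k)).2 x) _; first by rewrite invr_gt0.
  by rewrite lef_pV2 ?posrE // ler_nat ltnS; exact: (Hsg k).1.
have small (e : R) : 0 < e -> \forall k \near \oo, k.+1%:R^-1 < e.
  by move=> e1; exact: near_infty_natSinv_lt (PosNum e1).
have cv (e : R) : 0 < e -> \forall k \near \oo, forall x, `|th_ k x - th x| <= e.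
  move=> e1; apply: filterS (small e e1) => k hk x.
  by rewrite distrC ltW // (lt_trans (d1 k x)).
have L : lip lam th by exact: Bball_lip.
have L_ k : lip lam (th_ k) by exact: Bball_lip rho0 (Hph (sg k)).1.1.
have [ti [K1 K2]] := shiftby_inverse l02 L.
have /choice[ti_ Hti_] := fun k => shiftby_inverse l02 (L_ k).
have K1_ k := (Hti_ k).1; have K2_ k := (Hti_ k).2.
set x := shiftby th z; pose x_ k := shiftby (th_ k) (z_ k).
have zd k : `|z - z_ k| < e0 / 2 /\ `|z - z_ k| < k.+1%:R^-1.
  by apply/andP; rewrite -lt_min; exact: (Hsg k).2.
have xd k : `|x - x_ k| <= 3 * k.+1%:R^-1.
  have h1 := shiftby_dist_le z (z_ k) L; have h2 := d1 k (z_ k).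
  have -> : x - x_ k = (shiftby th z - shiftby th (z_ k)) + (th (z_ k) - th_ k (z_ k)).
    by rewrite /x /x_ /shiftby opprD addrA [in RHS]addrA opprD; apply/rowP => i;
       rewrite !(mxE); ring.
  apply: le_trans (ler_normD _ _) _; have [_ h3] := zd k.
  have h4 : (1 + lam) * `|z - z_ k| <= 2 * k.+1%:R^-1.
    by apply: ler_pM => //; [rewrite addr_ge0|lra|exact: ltW].
  apply: le_trans (lerD h1 (ltW h2)) _.
  rewrite [leRHS](_ : _ = 2 * k.+1%:R^-1 + k.+1%:R^-1); last by ring.
  by rewrite lerD2r.
have aw : away (e0 / 4) (~` deform Om th) x.
  move=> y Ey; apply: le_trans (away_deform l2 L K1 K2 He Ey).
  by rewrite ler_pM2l // lef_pV2 ?posrE // ler_nat.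
have aw_ k : away (e0 / 4) (~` deform Om (th_ k)) (x_ k).
  have -> : e0 / 4 = (e0 / 2) / 2 by field.
  apply: (away_deform l2 (L_ k) (K1_ k) (K2_ k)) => u hu; apply: He.
  have -> : z - u = (z - z_ k) + (z_ k - u) by rewrite addrA subrK.
  apply: le_lt_trans (ler_normD _ _) _; rewrite (splitr e0).
  by rewrite ltrD //; case: (zd k).
(* shift the sequence so that it stays within distance 1 of its limit *)
have inv43 k : k.+4%:R^-1 <= k.+1%:R^-1 :> R.
  by rewrite lef_pV2 ?posrE // ler_nat !ltnS (leqW (leqW (leqnSn k))).
have e40 : 0 < e0 / 4 by rewrite divr_gt0.
have cpot e : pot mu (~` deform Om (th_ k.+3)) e (x_ k.+3) @[k --> \oo] -->
    pot mu (~` deform Om th) e x.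
  apply: (cvg_pot_moving (lam := lam) (d := e0 / 4) (ti := ti) (ti_ := fun k => ti_ k.+3)) => //.
  - move=> e1 e10; apply: filterS (small e1 e10) => k hk y.
    rewrite distrC ltW // (lt_trans (d1 k.+3 y)) //; apply: le_lt_trans hk.
    exact: inv43.
  - apply/cvgrPdist_le => e1 e10; have e130 : 0 < e1 / 3 by lra.
    apply: filterS (small _ e130) => k hk; apply: le_trans (xd _) _.
    apply: le_trans (_ : 3 * k.+1%:R^-1 <= _); first by rewrite ler_wpM2l // inv43.
    by rewrite mulrC -ler_pdivlMr // ltW.
  - move=> k; rewrite distrC; apply: le_trans (xd _) _.
    by rewrite ler_pdivrMr // mul1r ler_nat.
have oD th0 : lip lam th0 -> open (deform Om th0) by move=> L0; exact: deform_open l02 L0 oO.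
have Dx : deform Om th x by exists z.
have Dx_ k : deform Om (th_ k) (x_ k) by exists (z_ k) => //; apply: KO; exact: (Hzz _).1.
have n0 : (0 < n)%N by [].
have [G0 H0] := (psi_C2 n0 Hmu (oD _ L)).2 x Dx.
split=> //; exists z; split=> //; split => [j|].
  rewrite G0; apply: (cvg_nat_unique (cpot (gradk j))).
  have -> : (fun k => pot mu (~` deform Om (th_ k.+3)) (gradk j) (x_ k.+3)) = fun=> 0.
    apply/funext => k.
    have [G1 _] := (psi_C2 n0 Hmu (oD _ (L_ k.+3))).2 _ (Dx_ k.+3).
    by rewrite -G1; have [_ []] := Hzz (sg k.+3).
  exact: cvg_cst.
pose M_ k : 'M[R]_n := \matrix_(i, j) pot mu (~` deform Om (th_ k.+3)) (hessk i j) (x_ k.+3).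
pose M : 'M[R]_n := \matrix_(i, j) pot mu (~` deform Om th) (hessk i j) x.
rewrite H0 -/M unitmxE unitfE negbK; apply/eqP.
have cM : \det (M_ k) @[k --> \oo] --> \det M.
  apply: cvg_det => i j; rewrite mxE.
  rewrite (_ : (fun k => M_ k i j) =
    (fun k => pot mu (~` deform Om (th_ k.+3)) (hessk i j) (x_ k.+3))) //.
  by apply/funext => k; rewrite mxE.
apply: (cvg_nat_unique cM).
have -> : (fun k => \det (M_ k)) = fun=> 0.
  apply/funext => k; have [_ H1] := (psi_C2 n0 Hmu (oD _ (L_ k.+3))).2 _ (Dx_ k.+3).
  have [_ []] := Hzz (sg k.+3).
  by rewrite -/(th_ k.+3) -/(z_ k.+3) -/(x_ k.+3) H1 -/(M_ k) unitmxE unitfE negbK => _ /eqP.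
exact: cvg_cst.
Qed.

End DegenerateSet.

(** * Bumps and volume parameters *)

Section Bump.
Context {R : realType} {n : nat} (q : 'rV[R]_n) (r : R) (r0 : 0 < r).
Implicit Types (x u : 'rV[R]_n).

Let B := r ^+ 2.
Let h x := B - sqn (x - q).
Let pos (t : R) := Num.max t 0.

Let pos_le t : t <= B -> 0 <= pos t <= B.
Proof.
move=> tB; rewrite le_max lexx orbT /= ge_max tB /=; exact: sqr_ge0.
Qed.

Let hB x : h x <= B.
Proof. by rewrite /h lerBlDr lerDl sqn_ge0. Qed.

Let quad2 s t : `|pos s ^+ 2 - pos t ^+ 2 - 2 * pos t * (s - t)| <= 2 * (s - t) ^+ 2.
Proof.
have st := sqr_ge0 (s - t).
rewrite /pos; have [t0|t0] := leP t 0; have [s0|s0] := leP s 0.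
- by rewrite expr0n /= !(mulr0, mul0r, subr0) normr0 mulr_ge0.
- rewrite expr0n /= !(mulr0, mul0r, subr0) ger0_norm ?sqr_ge0 //.
  have : 0 <= s * (- t) by rewrite mulr_ge0 ?oppr_ge0 // ltW.
  have := sqr_ge0 t; have := sqr_ge0 s; lra.
- rewrite [0 ^+ 2]expr0n /= sub0r.
  have p : 0 <= t * (- s) by rewrite mulr_ge0 ?oppr_ge0 // ltW.
  have := sqr_ge0 t; have := sqr_ge0 s.
  rewrite ler_norml => h1 h2; apply/andP; split; lra.
- have -> : s ^+ 2 - t ^+ 2 - 2 * t * (s - t) = (s - t) ^+ 2 by ring.
  rewrite ger0_norm //; lra.
Qed.

(** For positive s and t the remainder is (s + 2t)(s - t)^2, which is quadratic only on a bounded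
    range; [B] bounds [h] from above. *)
Let quad3 s t : s <= B -> t <= B ->
  `|pos s ^+ 3 - pos t ^+ 3 - 3 * pos t ^+ 2 * (s - t)| <= 6 * B * (s - t) ^+ 2.
Proof.
move=> sB tB; have B0 : 0 <= B := sqr_ge0 r; have st := sqr_ge0 (s - t).
rewrite /pos; have [t0|t0] := leP t 0; have [s0|s0] := leP s 0.
- by rewrite !expr0n /= !(mulr0, mul0r, subr0) normr0 mulr_ge0 // mulr_ge0.
- rewrite [0 ^+ 3]expr0n [0 ^+ 2]expr0n /= !(mulr0, mul0r, subr0) ger0_norm ?exprn_ge0 ?(ltW s0) //.
  have h1 : s ^+ 2 <= (s - t) ^+ 2 by nra.
  rewrite exprS; have : s * s ^+ 2 <= B * (s - t) ^+ 2.
    by apply: ler_pM => //; rewrite ?sqr_ge0 // ltW.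
  have : 0 <= B * (s - t) ^+ 2 by rewrite mulr_ge0.
  lra.
- rewrite [0 ^+ 3]expr0n /= sub0r.
  have -> : - t ^+ 3 - 3 * t ^+ 2 * (s - t) = t * (t * (2 * t - 3 * s)) by ring.
  have h1 : 0 <= t * (2 * t - 3 * s) by rewrite mulr_ge0 ?(ltW t0) //; lra.
  have h2 : t * (2 * t - 3 * s) <= 3 * (s - t) ^+ 2 by nra.
  rewrite ger0_norm; last by rewrite mulr_ge0 // ltW.
  have : t * (t * (2 * t - 3 * s)) <= B * (3 * (s - t) ^+ 2).
    by apply: ler_pM => //; rewrite ltW.
  have : 0 <= B * (s - t) ^+ 2 by rewrite mulr_ge0.
  lra.
- have -> : s ^+ 3 - t ^+ 3 - 3 * t ^+ 2 * (s - t) = (s + 2 * t) * (s - t) ^+ 2 by ring.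
  rewrite normrM [`|_ ^+ 2|]ger0_norm // ler_wpM2r // ger0_norm; lra.
Qed.

Let sqn_expand x u : sqn (x + u) = sqn x + 2 * (\sum_j x ord0 j * u ord0 j) + sqn u.
Proof.
rewrite /sqn mulr_sumr -!big_split; apply: eq_bigr => j _ /=.
by rewrite rowDE sqrrD -mulr_natl; ring.
Qed.

(** A chain rule through quadratic remainders. It treats the kink of [max] at 0 like any other
    point. *)
Let comp_quadratic (f f' : R -> R) (C C' : R) : 0 <= C -> 0 <= C' ->
  (forall s t, s <= B -> t <= B -> `|f s - f t - f' t * (s - t)| <= C * (s - t) ^+ 2) ->
  (forall t, t <= B -> `|f' t| <= C') ->
  forall x, differentiable (f \o h) x /\
    forall j, partial j (f \o h) x = - 2 * f' (h x) * (x - q) ord0 j.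
Proof.
move=> C0 C'0 Hf Hf' x.
pose X := `|x - q|.
have X0 : 0 <= X by exact: normr_ge0.
pose D := 2 * (n%:R * X) + n%:R.
have D0 : 0 <= D by rewrite addr_ge0 // !mulr_ge0.
apply: (@differentiable_quadratic _ _ _ _ _ (C * D ^+ 2 + C' * n%:R) 1) => // u u1.
have u0 : 0 <= `|u| by [].
have Eh : h (x + u) - h x = - 2 * (\sum_j (x - q) ord0 j * u ord0 j) - sqn u.
  by rewrite /h [x + u - q]addrAC (sqn_expand (x - q) u); ring.
set S := \sum_j (x - q) ord0 j * u ord0 j in Eh.
have -> : \sum_j u ord0 j * (- 2 * f' (h x) * (x - q) ord0 j) = f' (h x) * (- 2 * S).
  by rewrite /S !mulr_sumr; apply: eq_bigr => j _; ring.
have Hs := sqn_le u.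
have uu : `|u| ^+ 2 <= `|u| by rewrite expr2 ler_piMl.
have HS : `|S| <= n%:R * X * `|u|.
  apply: le_trans (ler_norm_sum _ _ _) _.
  rewrite (_ : _ * _ * _ = \sum_(j < n) X * `|u|); last first.
    by rewrite sumr_const card_ord -mulr_natl; ring.
  by apply: ler_sum => j _; rewrite normrM ler_pM // coord_le_norm.
have Hd : `|h (x + u) - h x| <= D * `|u|.
  rewrite Eh; apply: le_trans (ler_normB _ _) _.
  rewrite normrM normrN (ger0_norm (sqn_ge0 u)) (ger0_norm (ler0n _ 2)).
  have : n%:R * `|u| ^+ 2 <= n%:R * `|u| by rewrite ler_wpM2l.
  rewrite /D; lra.
have := Hf _ _ (hB (x + u)) (hB x).
have -> : (f \o h) (x + u) - (f \o h) x - f' (h x) * (- 2 * S) =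
   (f (h (x + u)) - f (h x) - f' (h x) * (h (x + u) - h x)) - f' (h x) * sqn u.
  by rewrite Eh /=; ring.
move=> H; apply: le_trans (ler_normB _ _) _; rewrite mulrDl lerD //.
  apply: le_trans H _; rewrite -mulrA ler_wpM2l // -exprMn.
  by rewrite -[X in X <= _]real_normK ?num_real // ler_pXn2r ?nnegrE ?mulr_ge0.
rewrite normrM -mulrA ler_pM //; first exact: Hf'.
by rewrite ger0_norm ?sqn_ge0.
Qed.

(** The cube is what makes it C2: the second partials still contain a factor [pos (h x)], hence are
    continuous across the sphere. *)
Definition bump x : R := pos (h x) ^+ 3.

Let pos2 x : differentiable (fun x => pos (h x) ^+ 2) x /\
  forall j, partial j (fun x => pos (h x) ^+ 2) x = - 4 * pos (h x) * (x - q) ord0 j.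
Proof.
have B0 : 0 <= B := sqr_ge0 r.
have B20 : 0 <= 2 * B by rewrite mulr_ge0.
have H t : t <= B -> `|2 * pos t| <= 2 * B.
  by move=> /pos_le/andP[h1 h2]; rewrite normrM !ger0_norm // ler_pM2l.
have [d p] := comp_quadratic (ler0n _ 2) B20 (fun s t _ _ => quad2 s t) H x.
by split => // j; rewrite p; ring.
Qed.

Let pos3 x : differentiable bump x /\
  forall j, partial j bump x = - 6 * pos (h x) ^+ 2 * (x - q) ord0 j.
Proof.
have B0 : 0 <= B := sqr_ge0 r.
have B60 : 0 <= 6 * B by rewrite mulr_ge0.
have B30 : 0 <= 3 * B ^+ 2 by rewrite mulr_ge0 // sqr_ge0.
have H t : t <= B -> `|3 * pos t ^+ 2| <= 3 * B ^+ 2.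
  move=> /pos_le/andP[h1 h2]; rewrite normrM !ger0_norm ?sqr_ge0 // ler_pM2l //.
  by rewrite ler_pXn2r ?nnegrE.
have [d p] := comp_quadratic B60 B30 quad3 H x.
by split => // j; rewrite p; ring.
Qed.

Let diff_coordB x j : differentiable (fun x => (x - q) ord0 j) x /\
  forall i, partial i (fun x => (x - q) ord0 j) x = (j == i)%:R.
Proof.
have -> : (fun x => (x - q) ord0 j) = (fun x => 1 * coord j x + 1 * cst (- q ord0 j) x).
  by apply/funext => y; rewrite rowBE /coord /cst !mul1r.
have dc := @differentiable_coord R 1 n x ord0 j.
have dk := differentiable_cst (- q ord0 j) x.
split=> [|i]; first exact: (partial_lin 1 1 j dc dk).1.
rewrite (partial_lin 1 1 i dc dk).2 /partial derive_cst mulr0 addr0 mul1r.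
by have := is_derive_coord x j i => H; rewrite derive_val.
Qed.

Let bump1 j : partial j bump = (fun x => - 6 * (pos (h x) ^+ 2 * (x - q) ord0 j)).
Proof. by apply/funext => x; rewrite (pos3 x).2; ring. Qed.

Let bump2 x i j : differentiable (partial j bump) x /\ partial i (partial j bump) x =
  - 6 * (pos (h x) ^+ 2 * (j == i)%:R + (x - q) ord0 j * (- 4 * pos (h x) * (x - q) ord0 i)).
Proof.
have [d1 p1] := pos2 x; have [d2 p2] := diff_coordB x j.
have dM : differentiable (fun x => pos (h x) ^+ 2 * (x - q) ord0 j) x.
  exact: differentiableM.
rewrite bump1; split; first exact: differentiableZ.
rewrite /partial deriveZ; last exact: diff_derivable.
rewrite deriveM; [|exact: diff_derivable|exact: diff_derivable].
have := p1 i; have := p2 i; rewrite /partial => -> ->; rewrite /GRing.scale /=; ring.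
Qed.

Lemma bump_supp x : r <= `|x - q| -> bump x = 0.
Proof.
move=> rx; rewrite /bump /pos max_r ?expr0n //= /h subr_le0.
apply: le_trans (sqr_norm_le_sqn _); rewrite ler_pXn2r ?nnegrE //; exact: ltW.
Qed.

Lemma bump_ge0 x : 0 <= bump x.
Proof. by rewrite exprn_ge0 // le_max lexx orbT. Qed.

Lemma bump_center : 0 < bump q.
Proof. by rewrite exprn_gt0 // lt_max /h subrr /sqn big1 ?subr0 ?exprn_gt0 // => i _; rewrite mxE expr0n. Qed.

Let cont_pos x : {for x, continuous (fun x => pos (h x))}.
Proof.
apply: continuous_max; last exact: cst_continuous.
apply: continuousB; first exact: cst_continuous.
apply: (@continuous_comp _ _ _ (fun x => x - q) sqn).
  by apply: continuousB; [exact: cvg_id|exact: cst_continuous].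
by apply: differentiable_continuous; exact: differentiable_sqn.
Qed.

Lemma bump_C2bd : exists2 M, 0 < M & C2bd M bump.
Proof.
have B0 : 0 <= B := sqr_ge0 r.
have cases x : pos (h x) = 0 \/ (0 <= pos (h x) <= B /\ `|x - q| <= r).
  have [h0|h0] := leP (h x) 0; first by left; rewrite /pos max_r.
  right; split; first exact: pos_le.
  rewrite leNgt; apply/negP => rx; move: h0; rewrite ltNge /h subr_le0 => /negP; apply.
  by apply: le_trans (sqr_norm_le_sqn _); rewrite ler_pXn2r ?nnegrE ?(ltW r0) ?(ltW rx).
pose M := B ^+ 3 + 6 * (B ^+ 2 * r) + 6 * (B ^+ 2 + 4 * B * r ^+ 2) + 1.
have M1 : 0 <= B ^+ 3 by rewrite exprn_ge0.
have M2 : 0 <= 6 * (B ^+ 2 * r) by rewrite mulr_ge0 // mulr_ge0 ?sqr_ge0 ?(ltW r0).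
have M3 : 0 <= 6 * (B ^+ 2 + 4 * B * r ^+ 2) 
  by rewrite mulr_ge0 // addr_ge0 ?sqr_ge0 // mulr_ge0 ?sqr_ge0 // mulr_ge0.
have M0 : 0 < M by rewrite /M; lra.
have PB2 p : 0 <= p <= B -> 0 <= p ^+ 2 <= B ^+ 2.
  by move=> /andP[p0 pB]; rewrite sqr_ge0 ler_pXn2r ?nnegrE.
exists M => //; split.
  split=> [x _|j]; first exact: (pos3 x).1.
  split=> [x _|i x _]; first exact: (bump2 x j j).1.
  have -> : partial i (partial j bump) = (fun x => - 6 * (pos (h x) ^+ 2 * (j == i)%:R +
      (x - q) ord0 j * (- 4 * pos (h x) * (x - q) ord0 i))).
    by apply/funext => y; exact: (bump2 y i j).2.
  have cc k : {for x, continuous (fun x => (x - q) ord0 k)}.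
    by apply: differentiable_continuous; exact: (diff_coordB x k).1.
  have cp := @cont_pos x.
  apply: continuousM; first exact: cst_continuous.
  apply: continuousD; apply: continuousM.
  - by apply: differentiable_continuous; exact: (pos2 x).1.
  - exact: cst_continuous.
  - exact: cc.
  - apply: continuousM; last exact: cc.
    by apply: continuousM; [exact: cst_continuous|exact: cp].
move=> g [->|[[j ->]|[i [j ->]]]] x.
- rewrite ger0_norm ?bump_ge0 // /bump; have [->|[/andP[p0 pB] _]] := cases x.
    by rewrite expr0n ltW.
  apply: (@le_trans _ _ (B ^+ 3)); first by rewrite ler_pXn2r ?nnegrE.
  rewrite /M; lra.
- rewrite bump1; have [->|[pB xq]] := cases x.
    by rewrite expr0n /= mul0r mulr0 normr0 ltW.
  have /andP[h1 h2] := PB2 _ pB.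
  rewrite normrM normrN (ger0_norm (ler0n _ 6)) normrM (ger0_norm h1).
  have : pos (h x) ^+ 2 * `|(x - q) ord0 j| <= B ^+ 2 * r.
    by apply: ler_pM => //; exact: le_trans (coord_le_norm _ _) xq.
  rewrite /M; lra.
- rewrite (bump2 x i j).2; have [->|[pB xq]] := cases x.
    by rewrite expr0n /= !(mul0r, mulr0, addr0) normr0 ltW.
  have /andP[h1 h2] := PB2 _ pB; have /andP[p0 p1] := pB.
  rewrite normrM normrN (ger0_norm (ler0n _ 6)).
  have E1 : `|pos (h x) ^+ 2 * (j == i)%:R| <= B ^+ 2.
    by rewrite normrM (ger0_norm h1); case: eqP => _; rewrite ?normr1 ?normr0 ?mulr1 ?mulr0 ?sqr_ge0.
  have E2 : `|(x - q) ord0 j * (- 4 * pos (h x) * (x - q) ord0 i)| <= 4 * B * r ^+ 2.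
    rewrite !normrM normrN (ger0_norm (ler0n _ 4)) (ger0_norm p0).
    have cx k : `|(x - q) ord0 k| <= r by exact: le_trans (coord_le_norm _ _) xq.
    have e1 : `|(x - q) ord0 j| * `|(x - q) ord0 i| <= r * r by rewrite ler_pM.
    have e2 : pos (h x) * (`|(x - q) ord0 j| * `|(x - q) ord0 i|) <= B * (r * r).
      by rewrite ler_pM // mulr_ge0.
    rewrite expr2; lra.
  have := ler_normD (pos (h x) ^+ 2 * (j == i)%:R) ((x - q) ord0 j * (- 4 * pos (h x) * (x - q) ord0 i)).
  rewrite /M; lra.
Qed.

End Bump.

(** * Nondegeneracy in a family of domains parametrised by volumes *)

Section VolumeParameters.
Context {R : realType} {m : nat}.
Local Notation n := m.+1.
Context (mu : {sigma_finite_measure set (BR R n) -> \bar R}) (Hmu : is_volume mu).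
Variables (A d : R) (x0 : 'rV[R]_n) (Dm : 'rV[R]_n -> set 'rV[R]_n)
  (Bs : 'I_n -> set (BR R n)) (t : 'I_n -> R).
Hypotheses (A0 : 0 < A) (d0 : 0 < d) (t0 : forall i, 0 < t i).
Let P (a : 'rV[R]_n) := forall j, 0 <= a ord0 j <= A.
Let Y (x : 'rV[R]_n) := `|x - x0| <= 2 * d.
Hypothesis Dm_open : forall a, P a -> open (Dm a).
Hypothesis Dm_away : forall a x, P a -> Y x -> away (2 * d) (~` Dm a) x.
Hypothesis Bs_meas : forall i, measurable (Bs i).
Hypothesis Bs_disj : forall i j y, Bs i y -> Bs j y -> i = j.
Hypothesis Dm_local : forall a a' y, P a -> P a' -> Dm a y -> ~ Dm a' y ->
  exists l, a' ord0 l < a ord0 l /\ Bs l y.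
(** This normalisation turns bounds for a kernel on the gained set into bounds by the change of a
    parameter, whatever the shape of that set. *)
Hypothesis Dm_vol : forall a a' i, P a -> P a' -> a ord0 i <= a' ord0 i ->
  mu (Bs i `&` (Dm a' `\` Dm a)) = (a' ord0 i - a ord0 i)%:E.
(** Seen from near [x0], box i lies in direction e_i; the factor 1/(4n) yields the diagonal
    dominance in [grad_expand]. *)
Hypothesis Bs_dir : forall i (y x : 'rV[R]_n), Bs i y -> Y x ->
  [/\ t i / 2 <= (y - x) ord0 i, `|y - x| <= 2 * t i &
      forall k, k != i -> `|(y - x) ord0 k| <= (y - x) ord0 i / (4 * n%:R)].

Let n0 : (0 < n)%N. Proof. by []. Qed.
Let d20 : 0 < 2 * d. Proof. by rewrite mulr_gt0. Qed.

Let mDm a : P a -> measurable (Dm a : set (BR R n)).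
Proof. by move=> /Dm_open; exact: open_measurable_row. Qed.

Let f e x (y : BR R n) := @ker R n e (x - (y : 'rV[R]_n)).

Let f_int a e x : P a -> Y x -> mu.-integrable (~` Dm a) (EFin \o f e x).
Proof.
move=> Pa Yx.
exact: (pot_integrable Hmu e d20 (measurableC (mDm Pa)) (Dm_away Pa Yx)).
Qed.

Let f_intS a e x (S : set (BR R n)) : P a -> Y x -> measurable S -> S `<=` ~` Dm a ->
  mu.-integrable S (EFin \o f e x).
Proof.
move=> Pa Yx mS SD; apply: integrableS (f_int e Pa Yx) => //.
exact: measurableC (mDm Pa).
Qed.

Let Uof (s : seq 'I_n) : set (BR R n) := [set y | exists2 i, i \in s & Bs i y].

Let mUof s : measurable (Uof s).
Proof.
elim: s => [|i s IH].
  by rewrite (_ : Uof [::] = set0) //; apply/seteqP; split => y //= -[].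
rewrite (_ : Uof (i :: s) = Bs i `|` Uof s); first exact: measurableU.
apply/seteqP; split => y /=.
  by move=> [k]; rewrite inE => /predU1P[-> ?|ks Bk]; [left|right; exists k].
by move=> [Bi|[k ks Bk]]; [exists i|exists k]; rewrite ?inE ?eqxx ?ks ?orbT.
Qed.

Let part a e x i := \int[mu]_(y in Bs i `\` Dm a) f e x y.

(** By [outer_eq] the first integral does not depend on [a], so differences of potentials reduce to
    one local jump per box. *)
Let pot_split a e x : P a -> Y x ->
  pot mu (~` Dm a) e x =
  \int[mu]_(y in ~` Dm a `\` Uof (index_enum _)) f e x y + \sum_i part a e x i.
Proof.
move=> Pa Yx; have mD := mDm Pa.
suff H s : uniq s -> pot mu (~` Dm a) e x =
    \int[mu]_(y in ~` Dm a `\` Uof s) f e x y + \sum_(i <- s) part a e x i.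
  exact: (H _ (index_enum_uniq _)).
elim: s => [_|i s IH /= /andP[ins us]].
  rewrite big_nil addr0; congr (Rintegral _ _ _); apply/seteqP; split => y /=.
    by move=> h; split => // -[].
  by case.
rewrite IH // big_cons addrA; congr (_ + _).
rewrite /part -Rintegral_setU.
- congr (Rintegral _ _ _); apply/seteqP; split => y /=.
    move=> [Dy nU]; have [Bi|nBi] := pselect (Bs i y); [by right|left].
    split=> // -[k]; rewrite inE => /predU1P[->//|ks Bk].
    by apply: nU; exists k.
  move=> [[Dy nU]|[Bi Dy]]; split => //.
    by move=> [k ks Bk]; apply: nU; exists k => //; rewrite inE ks orbT.
  by move=> [k ks Bk]; move: ins; rewrite (Bs_disj Bi Bk) ks.
- by apply: measurableD => //; exact: measurableC.
- exact: measurableD.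
- apply: (f_intS (a := a)) => //.
    apply: measurableU; apply: measurableD => //; exact: measurableC.
  by move=> y [[]|[]].
- apply/disj_setPS => y [[Dy nU] [Bi _]]; apply: nU; exists i => //.
  by rewrite inE eqxx.
Qed.

Let outer_eq a a' : P a -> P a' ->
  ~` Dm a `\` Uof (index_enum _) `<=` ~` Dm a' `\` Uof (index_enum _).
Proof.
move=> Pa Pa' y [Dy nU]; split=> // Dy'.
have [l [_ Bl]] := Dm_local Pa' Pa Dy' Dy.
by apply: nU; exists l => //; exact: mem_index_enum.
Qed.

Let jump a a' e x i := part a e x i - part a' e x i.

Let pot_jump a a' e x : P a -> P a' -> Y x ->
  pot mu (~` Dm a) e x - pot mu (~` Dm a') e x = \sum_i jump a a' e x i.
Proof.
move=> Pa Pa' Yx; rewrite !pot_split // (_ : ~` Dm a `\` _ = ~` Dm a' `\` Uof (index_enum _)).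
  by rewrite opprD addrACA subrr add0r -sumrB.
by apply/seteqP; split; exact: outer_eq.
Qed.

Let gap a a' i : set (BR R n) := Bs i `&` (Dm a' `\` Dm a).

Let mgap a a' i : P a -> P a' -> measurable (gap a a' i).
Proof.
move=> Pa Pa'; apply: measurableI => //; apply: measurableD; exact: mDm.
Qed.

Let jump_gap a a' e x i : P a -> P a' -> Y x -> a ord0 i <= a' ord0 i ->
  jump a a' e x i = \int[mu]_(y in gap a a' i) f e x y.
Proof.
move=> Pa Pa' Yx aa'; have mD := mDm Pa; have mD' := mDm Pa'.
rewrite /jump /part.
have -> : Bs i `\` Dm a = (Bs i `\` Dm a') `|` gap a a' i.
  apply/seteqP; split => y /=.
    move=> [Bi nD]; have [Dy'|nDy'] := pselect (Dm a' y); [by right|by left].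
  move=> [[Bi nD']|[Bi [_ nD]]]; split => // Dy.
  have [l [ll Bl]] := Dm_local Pa Pa' Dy nD'.
  by move: ll; rewrite -(Bs_disj Bi Bl) ltNge aa'.
rewrite Rintegral_setU.
- by rewrite addrAC subrr add0r.
- exact: measurableD.
- exact: mgap.
- apply: (f_intS (a := a)) => //.
    by apply: measurableU; [exact: measurableD|exact: mgap].
  move=> y [[Bi nD']|[_ [_ //]]] Dy.
  have [l [ll Bl]] := Dm_local Pa Pa' Dy nD'.
  by move: ll; rewrite -(Bs_disj Bi Bl) ltNge aa'.
- by apply/disj_setPS => y [[_ nD'] [_ [Dy' _]]]; exact: nD'.
Qed.

Let jump_sym a a' e x i : jump a a' e x i = - jump a' a e x i.
Proof. by rewrite /jump opprB. Qed.

Let gap_int a a' e x i : P a -> P a' -> Y x -> mu.-integrable (gap a a' i) (EFin \o f e x).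
Proof.
move=> Pa Pa' Yx; apply: (f_intS (a := a)) => //; first exact: mgap.
by move=> y [_ []].
Qed.

Let gap_cst a a' i (c : R) : P a -> P a' -> a ord0 i <= a' ord0 i ->
  mu.-integrable (gap a a' i) (EFin \o cst c) /\
  \int[mu]_(y in gap a a' i) c = c * (a' ord0 i - a ord0 i).
Proof.
move=> Pa Pa' aa'.
have V : mu (gap a a' i) = (a' ord0 i - a ord0 i)%:E := Dm_vol Pa Pa' aa'.
have mg := mgap i Pa Pa'.
split.
  2: by rewrite Rintegral_cst //; congr (_ * _); exact: (congr1 fine V).
apply/integrableP; split; first by apply/measurable_EFinP; exact: measurable_cst.
rewrite (_ : (fun _ => _) = cst `|c|%:E) //.
apply: (@le_lt_trans _ _ (`|c|%:E * (a' ord0 i - a ord0 i)%:E)%E).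
  by rewrite integral_cst // -V; exact: lexx.
by rewrite -EFinM ltry.
Qed.

Let f_bound e : exists2 C, 0 <= C & forall a x y, P a -> Y x -> ~ Dm a y -> `|f e x y| <= C.
Proof.
have [C C0 H] := ker_bounded e d20; pose q := ((2 * d) ^+ 2)^-1.
have q0 : 0 < q by rewrite invr_gt0 exprn_gt0.
exists (C * q ^+ n); first by rewrite mulr_ge0 // exprn_ge0 // ltW.
move=> a x y Pa Yx nD; have dxy := Dm_away Pa Yx nD.
apply: le_trans (H _ dxy) _; rewrite ler_wpM2l // ler_pXn2r ?nnegrE ?isqn_ge0 ?(ltW q0) //.
rewrite /isqn /q lef_pV2 ?posrE ?exprn_gt0 //.
  by apply: le_trans (sqr_norm_le_sqn _); rewrite ler_pXn2r ?nnegrE // ltW.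
by apply: sqn_gt0; rewrite -normr_gt0 (lt_le_trans d20).
Qed.

Let jump_bound e : exists2 C, 0 <= C & forall a a' x i, P a -> P a' -> Y x ->
  `|jump a a' e x i| <= C * `|a ord0 i - a' ord0 i|.
Proof.
have [C C0 H] := f_bound e; exists C => //.
have main a a' x i : P a -> P a' -> Y x -> a ord0 i <= a' ord0 i ->
    `|jump a a' e x i| <= C * `|a ord0 i - a' ord0 i|.
  move=> Pa Pa' Yx aa'; rewrite jump_gap //.
  have mg := mgap i Pa Pa'; have ig := gap_int e i Pa Pa' Yx.
  apply: le_trans (le_normr_Rintegral mg ig) _.
  have [ic Ec] := gap_cst C Pa Pa' aa'.
  rewrite distrC ger0_norm ?subr_ge0 // -Ec; apply: le_Rintegral => //.
    exact: (integrable_abse ig).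
  by move=> y [_ [_ nD]]; exact: (H a).
move=> a a' x i Pa Pa' Yx; have [aa'|/ltW aa'] := leP (a ord0 i) (a' ord0 i).
  exact: main.
by rewrite jump_sym normrN [`|a ord0 i - _|]distrC; exact: main.
Qed.

(** A positive multiple of y - x: the gradient kernel points at the box and inherits its
    direction. *)
Let fgrad k x y : f (gradk k) x y =
  (2 * n)%:R * isqn (x - (y : 'rV[R]_n)) ^+ n.+1 * ((y : 'rV[R]_n) - x) ord0 k.
Proof.
rewrite /f kerE /gradk /dker /= !fctE /cst /coord !rowBE !exprS; ring.
Qed.

Let grad_dir x i y k : Bs i y -> Y x ->
  [/\ (2 * n)%:R * (n%:R * (2 * t i) ^+ 2)^-1 ^+ n.+1 * (t i / 2) <= f (gradk i) x y,
   0 <= f (gradk i) x y &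
   k != i -> `|f (gradk k) x y| <= f (gradk i) x y / (4 * n%:R)].
Proof.
move=> By Yx; have [h1 h2 h3] := Bs_dir By Yx.
have ti := t0 i.
have yx0 : 0 < ((y : 'rV[R]_n) - x) ord0 i by lra.
have i0 : 0 <= isqn (x - (y : 'rV[R]_n)) ^+ n.+1 by rewrite exprn_ge0 // isqn_ge0.
have xy : x - (y : 'rV[R]_n) != 0.
  apply/eqP => E; move: yx0; rewrite -opprB E oppr0 mxE ltxx //.
rewrite !fgrad; split.
- have q0 : 0 < (n%:R * (2 * t i) ^+ 2)^-1.
    by rewrite invr_gt0 mulr_gt0 ?ltr0n // exprn_gt0 // mulr_gt0.
  apply: ler_pM h1; [|by rewrite divr_ge0 // ltW|].
    by rewrite mulr_ge0 // exprn_ge0 // ltW.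
  rewrite ler_wpM2l // ler_pXn2r ?nnegrE ?isqn_ge0 ?(ltW q0) //.
  rewrite lef_pV2 ?posrE; last 2 first.
  - by rewrite -invr_gt0.
  - exact: sqn_gt0.
  apply: le_trans (sqn_le _) _; rewrite ler_wpM2l //.
  rewrite ler_pXn2r ?nnegrE ?mulr_ge0 ?(ltW ti) //.
  by rewrite distrC.
- by apply: mulr_ge0 (ltW yx0); rewrite mulr_ge0.
- move=> ki; have p0 : 0 <= (2 * n)%:R * isqn (x - (y : 'rV[R]_n)) ^+ n.+1.
    exact: mulr_ge0.
  by rewrite normrM (ger0_norm p0) -[leRHS]mulrA ler_wpM2l //; exact: h3.
Qed.

Let jump_grad : exists2 c, 0 < c & forall a a' x i k, P a -> P a' -> Y x ->
  c * `|a ord0 i - a' ord0 i| <= `|jump a a' (gradk i) x i| /\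
  (k != i -> `|jump a a' (gradk k) x i| <= `|jump a a' (gradk i) x i| / (4 * n%:R)).
Proof.
pose ci i := (2 * n)%:R * (n%:R * (2 * t i) ^+ 2)^-1 ^+ n.+1 * (t i / 2).
have [c c0 Hc] : exists2 c, 0 < c & forall i, c <= ci i.
  apply: fin_pos_common => [i|i c c' _ h1 h2]; last exact: le_trans h2.
  exists (ci i) => //; rewrite /ci mulr_gt0 ?divr_gt0 // mulr_gt0 ?ltr0n //.
  by rewrite exprn_gt0 // invr_gt0 mulr_gt0 ?ltr0n // exprn_gt0 // mulr_gt0.
exists c => //.
have main a a' x i k : P a -> P a' -> Y x -> a ord0 i <= a' ord0 i ->
  c * `|a ord0 i - a' ord0 i| <= `|jump a a' (gradk i) x i| /\
  (k != i -> `|jump a a' (gradk k) x i| <= `|jump a a' (gradk i) x i| / (4 * n%:R)).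
  move=> Pa Pa' Yx aa'; rewrite !jump_gap //.
  have mg := mgap i Pa Pa'; have ig k' := gap_int (gradk k') i Pa Pa' Yx.
  have G0 : 0 <= \int[mu]_(y in gap a a' i) f (gradk i) x y.
    by apply: Rintegral_ge0 => y [By _]; have [] := grad_dir i By Yx.
  rewrite (ger0_norm G0); split=> [|ki].
    have [ic Ec] := gap_cst c Pa Pa' aa'.
    rewrite distrC ger0_norm ?subr_ge0 // -Ec; apply: le_Rintegral => //; first exact: ig.
    move=> y [By _]; have [h _ _] := grad_dir i By Yx; exact: le_trans (Hc i) h.
  apply: le_trans (le_normr_Rintegral mg (ig k)) _.
  rewrite -RintegralZr //; last exact: ig.
  apply: le_Rintegral => //.
  - exact: (integrable_abse (ig k)).
  - have := integrableZr mg (4 * n%:R)^-1 (ig i); exact: eq_integrable.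
  - by move=> y [By _]; have [_ _] := grad_dir k By Yx; apply.
move=> a a' x i k Pa Pa' Yx; have [aa'|/ltW aa'] := leP (a ord0 i) (a' ord0 i).
  exact: main.
by rewrite [jump a a' _ _ _]jump_sym [jump a a' (gradk k) _ _]jump_sym !normrN [`|a ord0 i - _|]distrC; exact: main.
Qed.

Let grad a x : 'rV[R]_n := \row_k pot mu (~` Dm a) (gradk k) x.
Let hess a x : 'M[R]_n := \matrix_(i, j) pot mu (~` Dm a) (hessk i j) x.

(** Diagonal dominance. Let i have the largest diagonal jump |J_ii|, which bounds c |a - a'|. The
    other boxes contribute to coordinate i at most n |J_ii|/(4n), so at least 3/4 of |J_ii|
    remains. *)
Let grad_expand : exists2 c, 0 < c & forall a a' x, P a -> P a' -> Y x ->
  c * `|a - a'| <= `|grad a x - grad a' x|.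
Proof.
have [c c0 H] := jump_grad; exists (c / 2); first by rewrite divr_gt0.
move=> a a' x Pa Pa' Yx.
pose J i k := jump a a' (gradk k) x i.
pose i := [arg max_(i > ord0) `|J i i|]%O.
have Hi l : `|J l l| <= `|J i i|.
  by rewrite /i; case: arg_maxP => // k _ /(_ l); apply.
have n1 : 0 < n%:R :> R by rewrite ltr0n.
have h1 : c * `|a - a'| <= `|J i i|.
  rewrite mulrC -ler_pdivlMr //; apply: normr_row_le => [|l]; first by rewrite divr_ge0 // ltW.
  rewrite ler_pdivlMr // mulrC rowBE; apply: le_trans (Hi l).
  exact: (H a a' x l l Pa Pa' Yx).1.
have h2 : `|\sum_(l | l != i) J l i| <= `|J i i| / 4.
  apply: le_trans (ler_norm_sum _ _ _) _.
  apply: (@le_trans _ _ (\sum_(l < n | l != i) `|J i i| / (4 * n%:R))).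
    apply: ler_sum => l li; apply: le_trans ((H a a' x l i Pa Pa' Yx).2 _) _.
      by rewrite eq_sym.
    by rewrite ler_wpM2r ?invr_ge0 ?mulr_ge0 //; exact: Hi.
  apply: (@le_trans _ _ (\sum_(l < n) `|J i i| / (4 * n%:R))).
    by rewrite [leRHS](bigD1 i) //= lerDr divr_ge0 // mulr_ge0.
  rewrite sumr_const card_ord -mulr_natr.
  by rewrite le_eqVlt; apply/orP; left; apply/eqP; field; rewrite gt_eqF.
apply: le_trans (coord_le_norm _ i); rewrite rowBE !mxE pot_jump // (bigD1 i) //=.
have := ler_normB (J i i + \sum_(l | l != i) J l i) (\sum_(l | l != i) J l i).
rewrite addrK -/(J i i) => h3; have J0 := normr_ge0 (J i i).
have : c / 2 * `|a - a'| <= `|J i i| / 2 by lra.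
rewrite /J in h2 h3 *; lra.
Qed.

Lemma volume_family_morse : exists a, P a /\
  forall x, `|x - x0| <= d / 2 -> (forall j, partial j (psi (Dm a)) x = 0) ->
    hessian (psi (Dm a)) x \in unitmx.
Proof.
have [c c0 Hexp] := grad_expand.
pose M := `|x0| + d.
have M0 : 0 <= M by rewrite addr_ge0 // ltW.
(* Two points of this ball are at most d apart, half of their distance 2d to the complement, as the
   potential estimates require. *)
pose Y' (x : 'rV[R]_n) := `|x - x0| <= d / 2.
have YY x : Y' x -> Y x.
  by move=> h; apply: le_trans h _; have := d0; lra.
have YM x : Y' x -> `|x| <= M.
  move=> Yx; have := ler_normD (x - x0) x0; rewrite subrK => h; apply: le_trans h _.
  by rewrite addrC lerD2l; apply: le_trans Yx _; have := d0; lra.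
have Ydist x x' : Y' x -> Y' x' -> `|x' - x| <= (2 * d) / 2.
  move=> h h'; have -> : x' - x = (x' - x0) - (x - x0) by rewrite opprB addrA subrK.
  apply: le_trans (ler_normB _ _) _.
  have -> : 2 * d / 2 = d / 2 + d / 2 by field.
  exact: lerD.
have mE a : P a -> measurable (~` Dm a : set (BR R n)) by move=> /mDm /measurableC.
have [C1 C10 H1] : exists2 C, 0 <= C & forall ij a x, P a -> Y' x ->
    `|pot mu (~` Dm a) (hessk ij.1 ij.2) x| <= C.
  apply: fin_bound_common => [[i j]|ij C C' CC H a x Pa Yx] /=; last exact: le_trans (H _ _ Pa Yx) CC.
  have [C C0 H] := ker_le_weight (hessk i j) d20 M0.
  exists (C * weight_mass mu); first by rewrite mulr_ge0 // weight_mass_ge0.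
  move=> a x Pa Yx; have aw := Dm_away Pa (YY _ Yx).
  apply: (Rintegral_le_weight Hmu) => //; [exact: mE|exact: (measurable_ker _ d20 aw (mE _ Pa))|].
  by move=> y Ey; apply: H; [exact: YM|exact: aw].
have [C2 C20 H2] : exists2 C, 0 <= C & forall ij a a' x, P a -> P a' -> Y' x ->
    `|pot mu (~` Dm a) (hessk ij.1 ij.2) x - pot mu (~` Dm a') (hessk ij.1 ij.2) x| <= C * `|a - a'|.
  apply: fin_bound_common => [[i j]|ij C C' CC H a a' x Pa Pa' Yx] /=; last first.
    by apply: le_trans (H _ _ _ Pa Pa' Yx) _; rewrite ler_wpM2r.
  have [C C0 H] := jump_bound (hessk i j).
  exists (n%:R * C); first by rewrite mulr_ge0.
  move=> a a' x Pa Pa' Yx; rewrite pot_jump //; last exact: YY.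
  apply: le_trans (ler_norm_sum _ _ _) _.
  rewrite (_ : _ * _ * _ = \sum_(l < n) C * `|a - a'|); last first.
    by rewrite sumr_const card_ord -mulrA mulr_natl.
  apply: ler_sum => l _; apply: le_trans (H _ _ _ _ Pa Pa' (YY _ Yx)) _.
  by rewrite ler_wpM2l // -rowBE coord_le_norm.
have [C3 C30 H3] : exists2 C, 0 <= C & forall ij a x x', P a -> Y' x -> Y' x' ->
    `|pot mu (~` Dm a) (hessk ij.1 ij.2) x - pot mu (~` Dm a) (hessk ij.1 ij.2) x'| <= C * `|x - x'|.
  apply: fin_bound_common => [[i j]|ij C C' CC H a x x' Pa Yx Yx'] /=; last first.
    by apply: le_trans (H _ _ _ Pa Yx Yx') _; rewrite ler_wpM2r.
  have [C C0 H] := pot_lipschitz n0 Hmu (hessk i j) d20 M0.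
  exists C => // a x x' Pa Yx Yx'.
  have := H _ x' (x - x') (mE _ Pa) (Dm_away Pa (YY _ Yx')) (YM _ Yx') (Ydist _ _ Yx' Yx).
  by rewrite [x' + _]addrC subrK.
have [C4 C40 H4] : exists2 C, 0 <= C & forall k a x x', P a -> Y' x -> Y' x' ->
    `|pot mu (~` Dm a) (gradk k) x' - pot mu (~` Dm a) (gradk k) x -
      \sum_j (x' - x) ord0 j * pot mu (~` Dm a) (hessk j k) x| <= C * `|x' - x| ^+ 2.
  apply: fin_bound_common => [k|k C C' CC H a x x' Pa Yx Yx'] /=; last first.
    by apply: le_trans (H _ _ _ Pa Yx Yx') _; rewrite ler_wpM2r // sqr_ge0.
  have [C C0 H] := pot_taylor n0 Hmu (gradk k) d20 M0.
  exists C => // a x x' Pa Yx Yx'.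
  have := H _ x (x' - x) (mE _ Pa) (Dm_away Pa (YY _ Yx)) (YM _ Yx) (Ydist _ _ Yx Yx').
  by rewrite [x + _]addrC subrK.
pose C := C1 + C2 + C3 + C4.
have C0 : 0 <= C by rewrite !addr_ge0.
have d2 : 0 <= d / 2 by rewrite divr_ge0 // ltW.
have [|||||a [Pa Ha]] := @discrete_sard R m A (d / 2) c C x0 grad hess A0 d2 c0 C0.
- by move=> a a' x Pa Pa' Yx; apply: Hexp => //; exact: YY.
- move=> a x i j Pa Yx; rewrite mxE; apply: le_trans (H1 (i, j) a x Pa Yx) _.
  by rewrite /C; lra.
- move=> a a' x i j Pa Pa' Yx; rewrite !mxE; apply: le_trans (H2 (i, j) a a' x Pa Pa' Yx) _.
  by rewrite ler_wpM2r // /C; lra.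
- move=> a x x' i j Pa Yx Yx'; rewrite !mxE; apply: le_trans (H3 (i, j) a x x' Pa Yx Yx') _.
  by rewrite ler_wpM2r // /C; lra.
- move=> a x x' Pa Yx Yx'; apply: normr_row_le; first by rewrite mulr_ge0 // sqr_ge0.
  move=> k; rewrite 2!rowBE.
  have -> : ((x' - x) *m hess a x) ord0 k =
      \sum_j (x' - x) ord0 j * pot mu (~` Dm a) (hessk j k) x.
    by rewrite mxE; apply: eq_bigr => j _; rewrite [hess _ _ _ _]mxE.
  rewrite [grad a x' _ _]mxE [grad a x _ _]mxE.
  apply: le_trans (H4 k a x x' Pa Yx Yx') _; rewrite ler_wpM2r ?sqr_ge0 // /C; lra.
exists a; split => // x Yx Gx.
have Dx : Dm a x.
  apply: contrapT => nD; have := Dm_away Pa (YY _ Yx) nD.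
  by rewrite subrr normr0 leNgt d20.
have [G0 H0] := (psi_C2 n0 Hmu (Dm_open Pa)).2 x Dx.
rewrite H0; apply: Ha => //; apply/rowP => k.
by rewrite !mxE -G0 Gx.
Qed.

End VolumeParameters.

(** * Exit points of the coordinate half-lines *)

Section LocalData.
Context {R : realType} {m : nat}.
Local Notation n := m.+1.
Implicit Types (Om : set 'rV[R]_n) (z q : 'rV[R]_n).

(** Take the supremum of the lengths of segments from z inside [Om]; openness would allow a longer
    one if the endpoint were in [Om]. *)
Lemma exit_point Om z i : smooth_bounded_open Om -> Om z ->
  exists t : R, [/\ 0 < t, closure Om (z + t *: evec R i) & ~ Om (z + t *: evec R i)].
Proof.
move=> [oO [M HM] _] Oz.
have M1 u : Om u -> `|u| <= M by move=> /HM; exact: le_trans (norm_le_enorm u).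
pose pt (s : R) := z + s *: evec R i.
have ptd s s' : `|pt s - pt s'| = `|s - s'|.
  by rewrite /pt opprD addrACA subrr add0r -scalerBl normrZ norm_evec mulr1.
pose S : set R := [set s | 0 <= s /\ forall s', 0 <= s' <= s -> Om (pt s')].
have pt0 : pt 0 = z by rewrite /pt scale0r addr0.
have S0 : S 0.
  by split=> // s' /andP[h1 h2]; rewrite (le_anti (introT andP (conj h2 h1))) pt0.
have ubS : ubound S (M + `|z|).
  move=> s [s0 /(_ s)]; rewrite s0 lexx => /(_ isT) /M1 h.
  have := ler_normB (pt s) z; rewrite {1}/pt [z + _]addrC addrK normrZ norm_evec mulr1 ger0_norm //.
  move=> h2; apply: le_trans h2 _; by rewrite lerD2r.
have hS : has_sup S by split; [exists 0|exists (M + `|z|)].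
pose t := sup S.
have tub s : S s -> s <= t by move=> Ss; apply: (sup_upper_bound hS).
have below s' : 0 <= s' -> s' < t -> Om (pt s').
  move=> s'0 s't; have [s [_ Hs] ss] := sup_gt (ex_intro _ 0 S0) s't.
  by apply: Hs; rewrite s'0 ltW.
have t00 : 0 <= t := tub _ S0.
have nOt : ~ Om (pt t).
  move=> Ot; have [e e0 He] := open_ball_in oO Ot.
  have : S (t + e / 2).
    split=> [|s' /andP[s'0 s'e]]; first by rewrite addr_ge0 // divr_ge0 // ltW.
    have [/(below _ s'0)//|ts] := ltP s' t.
    apply: He; rewrite ptd distrC ger0_norm ?subr_ge0 //; lra.
  by move=> /tub; lra.
have tpos : 0 < t.
  rewrite lt_neqAle t00 andbT; apply/eqP => t0E; apply: nOt.
  by rewrite -t0E pt0.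
exists t; split => // B /nbhs_ballP[e /= e0 He].
pose s := Num.max 0 (t - e / 2).
have e20 : 0 < e / 2 by rewrite divr_gt0.
have s0 : 0 <= s by rewrite le_max lexx.
have st : s < t by rewrite gt_max tpos ltrBlDr ltrDl.
exists (pt s); split; first exact: below.
apply: He; rewrite ball_rowE -/(pt t) ptd ger0_norm ?subr_ge0 ?(ltW st) //.
have : t - e / 2 <= s by rewrite le_max lexx orbT.
rewrite lerBlDr => h; rewrite ltrBlDl; apply: le_lt_trans h _.
by rewrite ltrD2l gtr_pMr // invf_lt1 // ltr1n.
Qed.

Lemma cone_le Om q j sg r r' : r' <= r -> cone Om q j sg r -> cone Om q j sg r'.
Proof. by move=> rr H u u' t h1 h2; apply: H; [exact: lt_le_trans rr|exact: lt_le_trans rr]. Qed.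

(** One scale e for all n exit points. The room 8e leaves 2e around the deformed points near z; 64 n
    e <= t_i makes the boxes small as seen from z; the cone radius 4e contains a point within e of
    the exit point and its partner, at most 2e further away. *)
Definition local_data Om z (t sg : 'I_n -> R) (j : 'I_n -> 'I_n) (e : R) :=
  [/\ 0 < e, (forall u, `|z - u| < 8 * e -> Om u) &
   forall i, [/\ 64 * n%:R * e <= t i, `|sg i| = 1,
     closure Om (z + t i *: evec R i), ~ Om (z + t i *: evec R i) &
     cone Om (z + t i *: evec R i) (j i) (sg i) (4 * e)]].

Lemma local_data_exists Om z : smooth_bounded_open Om -> Om z ->
  exists t sg j e, local_data Om z t sg j e.
Proof.
move=> HO Oz; have /choice[t Ht] := fun i => exit_point i HO Oz.
have /choice[d Hd] : forall i, exists d : 'I_n * R * R,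
    [/\ `|d.1.2| = 1, 0 < d.2 & cone Om (z + t i *: evec R i) d.1.1 d.1.2 d.2].
  move=> i; have [_ h1 h2] := Ht i.
  by have [j [sg [r H]]] := cone_exists HO h1 h2; exists (j, sg, r).
have [oO _ _] := HO; have [e1 e10 He1] := open_ball_in oO Oz.
have [e e0 He] : exists2 e, 0 < e & forall i,
    [/\ 64 * n%:R * e <= t i, 4 * e <= (d i).2 & 8 * e <= e1].
  have N0 : 0 < 64 * n%:R :> R by rewrite mulr_gt0 // ltr0n.
  apply: fin_pos_common => [i|i e e' e'0 ee [h1 h2 h3]].
    have [t0 _ _] := Ht i; have [_ r0 _] := Hd i.
    exists (Num.min (t i / (64 * n%:R)) (Num.min ((d i).2 / 4) (e1 / 8))).
      by rewrite !lt_min !divr_gt0.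
    split; rewrite mulrC -ler_pdivlMr // !ge_min lexx ?orbT //.
  split; [apply: le_trans h1|apply: le_trans h2|apply: le_trans h3]; rewrite ler_wpM2l //.
exists t, (fun i => (d i).1.2), (fun i => (d i).1.1), e; split => // [u hu|i].
  by apply: He1; apply: lt_le_trans hu _; have [] := He ord0.
have [t0 h1 h2] := Ht i; have [s1 r0 co] := Hd i; have [k1 k2 _] := He i.
by split => //; exact: cone_le co.
Qed.

End LocalData.

(** * The family of bumps and its reparametrisation by volume *)

Section Family.
Context {R : realType} {m : nat}.
Local Notation n := m.+1.
Context (mu : {sigma_finite_measure set (BR R n) -> \bar R}) (Hmu : is_volume mu).
Variables (Om : set 'rV[R]_n) (HO : smooth_bounded_open Om) (z0 : 'rV[R]_n)
  (t sg : 'I_n -> R) (j : 'I_n -> 'I_n) (e : R) (LD : local_data Om z0 t sg j e)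
  (lam : R) (lam0 : 0 <= lam) (lam16 : lam <= 1 / (16 * n%:R))
  (th : 'rV[R]_n -> 'rV[R]_n) (b : 'I_n -> 'rV[R]_n -> R) (M sbar : R).
Let q i := z0 + t i *: evec R i.
Hypotheses (b_supp : forall i x, e <= `|x - q i| -> b i x = 0)
  (b_ge0 : forall i x, 0 <= b i x) (b_le : forall i x, b i x <= M)
  (b_pos : forall i, 0 < b i (q i)) (sbar0 : 0 < sbar) (sbarM : n%:R * sbar * M <= e).

(** [sg i *: evec R (j i)] is the outward direction of the cone at exit point i, so nonnegative [s]
    enlarges the domain. *)
Definition family (s : 'rV[R]_n) (x : 'rV[R]_n) : 'rV[R]_n :=
  th x + \sum_i (s ord0 i * sg i * b i x) *: evec R (j i).

Let S (s : 'rV[R]_n) := forall i, 0 <= s ord0 i <= sbar.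
Hypothesis fam_lip : forall s, S s -> lip lam (family s).

Let e0 : 0 < e. Proof. by have [] := LD. Qed.
Let n1 : 1 <= n%:R :> R. Proof. by rewrite ler1n. Qed.
Let te i : 64 * n%:R * e <= t i. Proof. by have [_ _ /(_ i)[]] := LD. Qed.
Let te1 i : 64 * e <= t i.
Proof.
apply: le_trans (te i); rewrite ler_wpM2r ?(ltW e0) //; have := n1; lra.
Qed.
Let t0 i : 0 < t i. Proof. by apply: lt_le_trans (te1 i); rewrite mulr_gt0. Qed.
Let sg1 i : `|sg i| = 1. Proof. by have [_ _ /(_ i)[]] := LD. Qed.
Let lam8 : lam <= 1 / (8 * n%:R).
Proof.
apply: le_trans lam16 _; rewrite !div1r lef_pV2 ?posrE ?mulr_gt0 ?ltr0n //.
by rewrite ler_wpM2r // ler_nat.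
Qed.
Let lam2 : lam <= 1 / 2.
Proof.
apply: le_trans lam8 _; rewrite !div1r lef_pV2 ?posrE ?mulr_gt0 ?ltr0n //.
have := n1; lra.
Qed.
Let lam02 : 0 <= lam <= 1 / 2. Proof. by rewrite lam0. Qed.
Let M0 : 0 <= M. Proof. exact: le_trans (b_ge0 ord0 0) (b_le _ _). Qed.
Let S0 : S 0. Proof. by move=> i; rewrite mxE lexx ltW. Qed.
Let oO : open Om. Proof. by have [] := HO. Qed.

Let T s := shiftby (family s).
Let D s := deform Om (family s).
Let x0 := T 0 z0.
Let p i := T 0 (q i).
(** Radius 3e contains the image of the support of bump i: 3/2 e from the Lipschitz bound plus e
    from the displacement by the bumps. *)
Let Bs i : set 'rV[R]_n := [set y | `|p i - y| < 3 * e].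

Let sM s i x : S s -> 0 <= s ord0 i * b i x <= sbar * M.
Proof.
move=> /(_ i)/andP[h1 h2]; rewrite mulr_ge0 //=; exact: ler_pM.
Qed.

Let fam_diff s s' x : family s x - family s' x =
  \sum_i ((s ord0 i - s' ord0 i) * sg i * b i x) *: evec R (j i).
Proof.
rewrite /family opprD addrACA subrr add0r -sumrB; apply: eq_bigr => i _.
by rewrite -scalerBl; congr (_ *: _); ring.
Qed.

Let fam_small s x : S s -> `|family s x - family 0 x| <= e.
Proof.
move=> Ss; rewrite fam_diff; apply: le_trans (ler_norm_sum _ _ _) _.
apply: le_trans sbarM; rewrite (_ : _ * _ * _ = \sum_(i < n) sbar * M); last first.
  by rewrite sumr_const card_ord -mulrA mulr_natl.
apply: ler_sum => i _; rewrite normrZ norm_evec mulr1 mxE subr0 mulrAC.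
rewrite normrM sg1 mulr1; have /andP[h1 h2] := sM i x Ss.
by rewrite ger0_norm.
Qed.

(** The bumps vanish near z0, so the region searched for critical points is the same for all members
    of the family. *)
Let fam_near s x : `|x - z0| <= 8 * e -> family s x = family 0 x.
Proof.
move=> xz; apply/eqP; rewrite -subr_eq0 fam_diff big1 // => i _.
rewrite b_supp ?mulr0 ?scale0r //.
have := ler_normB (x - z0) (x - q i).
have -> : x - z0 - (x - q i) = t i *: evec R i.
  by apply/rowP => k; rewrite /q !(rowBE, rowDE, rowZE); ring.
rewrite normrZ norm_evec mulr1 ger0_norm ?(ltW (t0 i)) //.
have := te1 i; have := e0; lra.
Qed.

Let q_dist i l : i != l -> 64 * e <= `|q i - q l|.
Proof.
move=> il; apply: le_trans (te1 i) _.
apply: le_trans (coord_le_norm _ i); rewrite rowBE !rowDE !rowZE !mxE eqxx (negbTE il).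
by rewrite mulr1 mulr0 addr0 [z0 _ _ + _]addrC addrK ler_norm.
Qed.

Let supp_uniq i l x : `|x - q i| < e -> `|x - q l| < e -> i = l.
Proof.
move=> h1 h2; apply/eqP/negP => /negP il; have := q_dist il.
have := ler_normB (x - q l) (x - q i).
have -> : x - q l - (x - q i) = q i - q l by rewrite opprB addrC addrA subrK.
have := e0; lra.
Qed.

Let b_near i x : b i x != 0 -> `|x - q i| < e.
Proof. by move=> bx; rewrite ltNge; apply/negP => /b_supp/eqP; rewrite (negbTE bx). Qed.

Let p_dist i l : i != l -> 32 * e <= `|p i - p l|.
Proof.
move=> il; have := shiftby_dist_ge2 (q i) (q l) lam2 (fam_lip S0).
have := q_dist il; rewrite -/(T 0 _) -/(T 0 _) -/(p i) -/(p l); lra.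
Qed.

Let Bs_disj i l y : Bs i y -> Bs l y -> i = l.
Proof.
rewrite /Bs /= => h1 h2; apply/eqP/negP => /negP il; have := p_dist il.
have := ler_normB (p i - y) (p l - y).
have -> : p i - y - (p l - y) = p i - p l by rewrite opprB addrA subrK.
have := e0; lra.
Qed.

Let image_loc s l u : S s -> `|u - q l| < e -> Bs l (T s u).
Proof.
move=> Ss hu; rewrite /Bs /=.
have h1 := shiftby_dist_le (q l) u (fam_lip Ss).
have h2 := fam_small (q l) Ss.
have -> : p l - T s u = (T s (q l) - T s u) - (family s (q l) - family 0 (q l)).
  by rewrite /p /T /shiftby; apply/rowP => k; rewrite !(rowBE, rowDE); ring.
apply: le_lt_trans (ler_normB _ _) _.
rewrite distrC in hu.
have h3 : (1 + lam) * `|q l - u| <= 3 / 2 * e.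
  apply: ler_pM => //; [by rewrite addr_ge0| |exact: ltW].
  have := lam2; lra.
have e0' := e0.
apply: le_lt_trans (lerD h1 h2) _; apply: le_lt_trans (lerD h3 (lexx _)) _; lra.
Qed.

Let inverse_ex : forall s, exists ti, S s -> cancel (T s) ti /\ cancel ti (T s).
Proof.
move=> s; have [Ss|nS] := pselect (S s); last by exists id.
by have [ti H] := shiftby_inverse lam02 (fam_lip Ss); exists ti.
Qed.
Let ti s := sval (cid (inverse_ex s)).
Let tiK s : S s -> cancel (T s) (ti s).
Proof. by move=> Ss; rewrite /ti; case: cid => f /= /(_ Ss)[]. Qed.
Let Kti s : S s -> cancel (ti s) (T s).
Proof. by move=> Ss; rewrite /ti; case: cid => f /= /(_ Ss)[]. Qed.

Let DE s : S s -> D s = [set y | Om (ti s y)].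
Proof. by move=> Ss; exact: deformE (tiK Ss) (Kti Ss). Qed.

Let D_open s : S s -> open (D s).
Proof. by move=> Ss; exact: deform_open lam02 (fam_lip Ss) oO. Qed.

(* If [T s' u] differs from [y = T s u] then exactly one bump moved [u], and
   the cone condition decides on which side of the boundary it went. *)
Let D_local s s' y : S s -> S s' -> D s y -> ~ D s' y ->
  exists l, s' ord0 l < s ord0 l /\ Bs l y.
Proof.
move=> Ss Ss' [u Ou <-] nD'; rewrite -/(shiftby (family s) u) -/(T s u) in nD' *.
have [l [sl bl]] : exists l, s ord0 l != s' ord0 l /\ b l u != 0.
  apply: contrapT => nex; apply: nD'; exists u => //.
  rewrite /T /shiftby; congr (_ + _); apply/eqP; rewrite eq_sym -subr_eq0 fam_diff big1 // => i _.
  have [->|bi] := eqVneq (b i u) 0; first by rewrite mulr0 scale0r.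
  have [->|si] := eqVneq (s ord0 i) (s' ord0 i); first by rewrite subrr !mul0r scale0r.
  by exfalso; apply: nex; exists i.
have ul := b_near bl.
exists l; split; last exact: image_loc.
rewrite ltNge; apply/negP => ss'; apply: nD'.
rewrite (DE Ss') /=; set u' := ti s' _.
pose tt := (s' ord0 l - s ord0 l) * b l u.
have tt0 : 0 <= tt by rewrite mulr_ge0 ?subr_ge0.
have Tu : T s' u - T s' u' = (tt * sg l) *: evec R (j l).
  rewrite (Kti Ss') /T /shiftby opprD addrACA subrr add0r fam_diff (bigD1 l) //= big1 ?addr0.
    by congr (_ *: _); rewrite /tt; ring.
  move=> i il; have [->|bi] := eqVneq (b i u) 0; first by rewrite mulr0 scale0r.
  by rewrite (supp_uniq (b_near bi) ul) eqxx in il.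
have tte : tt <= e.
  apply: le_trans sbarM; apply: (@le_trans _ _ (sbar * M)).
    have /andP[_ h] := Ss' l; have /andP[h' _] := Ss l.
    by apply: ler_pM => //; [rewrite subr_ge0|lra].
  by rewrite -mulrA ler_peMl // mulr_ge0 // ltW.
have uu' : `|u - u'| <= 2 * e.
  apply: le_trans (shiftby_dist_ge2 u u' lam2 (fam_lip Ss')) _.
  by rewrite -/(T s') Tu normrZ norm_evec mulr1 normrM sg1 mulr1 ger0_norm // ler_pM2l.
have err := shiftby_translate lam0 (fam_lip Ss') lam8 (sg1 l) tt0 Tu.
have [_ _ /(_ l)[_ _ _ _ co]] := LD.
have e0' := e0.
apply: (co u u' tt) => //.
- by apply: lt_le_trans ul _; lra.
- have -> : u' - (z0 + t l *: evec R l) = (u - q l) - (u - u').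
    by apply/rowP => k; rewrite /q !(rowBE, rowDE, rowZE); ring.
  by apply: le_lt_trans (ler_normB _ _) _; apply: lt_le_trans (ltr_leD ul uu') _; lra.
apply: le_trans err _; rewrite ler_wpM2l // lef_pV2 ?posrE ?mulr_gt0 ?ltr0n //.
by rewrite ler_wpM2r // ler_nat.
Qed.

Let Bs_dir i y x : Bs i y -> `|x - x0| <= 2 * e ->
  [/\ t i / 2 <= (y - x) ord0 i, `|y - x| <= 2 * t i &
      forall k, k != i -> `|(y - x) ord0 k| <= (y - x) ord0 i / (4 * n%:R)].
Proof.
rewrite /Bs /= => By Yx.
have N0 : 0 < n%:R :> R by rewrite ltr0n.
have ti0 := t0 i; have e0' := e0.
pose w := y - x - t i *: evec R i.
have wE : w = (family 0 (q i) - family 0 z0) - (p i - y) - (x - x0).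
  rewrite /w /p /x0 /T /shiftby /q; apply/rowP => k; rewrite !(rowBE, rowDE, rowZE); ring.
have ne : n%:R * e <= t i / 64.
  by rewrite ler_pdivlMr // mulrC mulrA te.
have et : e <= t i / (64 * n%:R).
  by rewrite ler_pdivlMr ?mulr_gt0 // mulrC te.
(* The maps distort by t_i/(16n), which is 4/64; the box radius 3e and the range 2e of x add 5e <= 5
   t_i/(64n). *)
have hw : `|w| <= 9 / 64 * t i / n%:R.
  have h1 : `|family 0 (q i) - family 0 z0| <= 1 / (16 * n%:R) * t i.
    apply: le_trans (fam_lip S0 (q i) z0) _.
    rewrite /q [z0 + _]addrC addrK normrZ norm_evec mulr1 ger0_norm ?(ltW ti0) //.
    by rewrite ler_wpM2r // ltW.
  have h2 := ler_normB (family 0 (q i) - family 0 z0) (p i - y).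
  have h3 := ler_normB (family 0 (q i) - family 0 z0 - (p i - y)) (x - x0).
  rewrite wE; apply: le_trans h3 _.
  have -> : 9 / 64 * t i / n%:R = 1 / (16 * n%:R) * t i + 5 * (t i / (64 * n%:R)).
    by field; rewrite gt_eqF.
  have h4 : `|p i - y| + `|x - x0| <= 5 * (t i / (64 * n%:R)).
    apply: (@le_trans _ _ (5 * e)); last by rewrite ler_pM2l.
    by apply: le_trans (lerD (ltW By) Yx) _; lra.
  apply: le_trans (lerD h2 (lexx _)) _; rewrite -addrA; exact: lerD.
have hwt : `|w| <= 9 / 64 * t i.
  apply: le_trans hw _; rewrite ler_pdivrMr // ler_peMr //.
  by rewrite mulr_ge0 // ltW.
have yxE : y - x = w + t i *: evec R i by rewrite /w subrK.
have yi : (y - x) ord0 i = w ord0 i + t i by rewrite yxE rowDE rowZE [evec _ _ _ _]mxE eqxx mulr1.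
have := le_trans (coord_le_norm w i) hwt; rewrite ler_norml => /andP[wi1 wi2].
have lower : 55 / 64 * t i <= (y - x) ord0 i by rewrite yi; lra.
split.
- lra.
- rewrite yxE; apply: le_trans (ler_normD _ _) _.
  rewrite normrZ norm_evec mulr1 ger0_norm ?(ltW ti0) //.
  by apply: le_trans (lerD hwt (lexx _)) _; lra.
move=> k ki; have -> : (y - x) ord0 k = w ord0 k.
  by rewrite yxE rowDE rowZE [evec _ _ _ _]mxE (negbTE ki) mulr0 addr0.
apply: le_trans (coord_le_norm _ _) _; apply: le_trans hw _.
rewrite (_ : 9 / 64 * t i / n%:R = (36 / 64 * t i) / (4 * n%:R)); last first.
  by field; rewrite gt_eqF.
rewrite ler_wpM2r ?invr_ge0 ?mulr_ge0 //; lra.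
Qed.

Let D_away s x : S s -> `|x - x0| <= 2 * e -> away (2 * e) (~` D s) x.
Proof.
move=> Ss Yx y Dy.
have He : forall u, `|z0 - u| < 8 * e -> Om u by have [] := LD.
have := away_deform lam2 (fam_lip Ss) (tiK Ss) (Kti Ss) He Dy.
have -> : shiftby (family s) z0 = x0.
  rewrite /x0 /T /shiftby fam_near // subrr normr0 mulr_ge0 // ltW //; exact: e0.
move=> h2; have h3 := ler_normD (x0 - x) (x - y).
rewrite addrA subrK [`|x0 - x|]distrC in h3.
rewrite -(lerD2l `|x - x0|); apply: le_trans h3; apply: le_trans h2.
by apply: le_trans (lerD Yx (lexx _)) _; lra.
Qed.

Let axis (i : 'I_n) (tau : R) : 'rV[R]_n := tau *: evec R i.

Let S_axis i tau : 0 <= tau <= sbar -> S (axis i tau).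
Proof.
move=> H k; rewrite rowZE mxE; case: ifP => _; rewrite ?mulr1 //.
by rewrite mulr0 lexx ltW.
Qed.

Let axis_i i tau : axis i tau ord0 i = tau.
Proof. by rewrite rowZE mxE eqxx mulr1. Qed.

(** Inside box i only [s_i] matters, so the volume gained there is a function of one variable. *)
Let D_axis s i : S s -> Bs i `&` D s = Bs i `&` D (axis i (s ord0 i)).
Proof.
move=> Ss; have Sa : S (axis i (s ord0 i)) by apply: S_axis; exact: Ss.
apply/seteqP; split => y [By Dy]; split=> //; apply: contrapT => nD.
  have [l [ll Bl]] := D_local Ss Sa Dy nD.
  by move: ll; rewrite -(Bs_disj By Bl) axis_i ltxx.
have [l [ll Bl]] := D_local Sa Ss Dy nD.
by move: ll; rewrite -(Bs_disj By Bl) axis_i ltxx.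
Qed.

Let mBs i : measurable (Bs i : set (BR R n)).
Proof. exact: measurable_supball. Qed.

Let mD s : S s -> measurable (D s : set (BR R n)).
Proof. by move=> /D_open; exact: open_measurable_row. Qed.

Let Bs_lty i : (mu (Bs i) < +oo)%E.
Proof. exact: volume_ball_lty. Qed.

Let vol i tau : R := fine (mu (Bs i `&` D (axis i tau))).

Let vol_fin i tau : 0 <= tau <= sbar ->
  mu (Bs i `&` D (axis i tau)) = (vol i tau)%:E.
Proof.
move=> H; rewrite /vol fineK // ge0_fin_numE //.
have mI : measurable (Bs i `&` D (axis i tau) : set (BR R n)).
  by apply: measurableI => //; apply: mD; exact: S_axis.
by apply: le_lt_trans (Bs_lty i); apply: le_measure; rewrite ?inE.
Qed.

Let vol_mono_sub i tau tau' : 0 <= tau <= sbar -> 0 <= tau' <= sbar -> tau <= tau' ->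
  Bs i `&` D (axis i tau) `<=` Bs i `&` D (axis i tau').
Proof.
move=> H H' tt y [By Dy]; split=> //; apply: contrapT => nD.
have [l [ll Bl]] := D_local (S_axis i H) (S_axis i H') Dy nD.
by move: ll; rewrite -(Bs_disj By Bl) !axis_i ltNge tt.
Qed.

Let vol_mono i tau tau' : 0 <= tau <= sbar -> 0 <= tau' <= sbar -> tau <= tau' ->
  vol i tau <= vol i tau'.
Proof.
move=> H H' tt; rewrite -lee_fin -!vol_fin //; apply: le_measure; rewrite ?inE.
- by apply: measurableI => //; apply: mD; exact: S_axis.
- by apply: measurableI => //; apply: mD; exact: S_axis.
- exact: vol_mono_sub.
Qed.

Let S_sbar : 0 <= sbar <= sbar. Proof. by rewrite lexx ltW. Qed.
Let S_zero : 0 <= (0 : R) <= sbar. Proof. by rewrite lexx ltW. Qed.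

(** Push the exit point q outwards and stop halfway. By [cone_strict] this point is inside the full
    deformation, while its preimage under the undeformed map is outside the closure of [Om]. Both
    conditions are open, so a whole ball is gained. *)
Let vol_strict i : vol i 0 < vol i sbar.
Proof.
have [_ _ /(_ i)[_ _ cq nOq co]] := LD.
have e0' := e0; have bq := b_pos i.
have Sa := S_axis i S_sbar; have Sz := S_axis i S_zero.
have ax0 : axis i 0 = 0 by rewrite /axis scale0r.
pose be := sbar * b i (q i).
have be0 : 0 < be by rewrite mulr_gt0.
have be2 : 0 < be / 2 by rewrite divr_gt0.
have bee : be <= e.
  apply: le_trans sbarM; apply: (@le_trans _ _ (sbar * M)); first by rewrite ler_wpM2l // ltW.
  by rewrite -mulrA ler_peMl // mulr_ge0 // ltW.
have Tq : T (axis i sbar) (q i) = T 0 (q i) + (be * sg i) *: evec R (j i).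
  have : family (axis i sbar) (q i) - family 0 (q i) = (be * sg i) *: evec R (j i).
    rewrite fam_diff (bigD1 i) //= big1 ?addr0.
      by rewrite axis_i mxE subr0 /be; congr (_ *: _); ring.
    move=> k ki; rewrite rowZE !mxE (negbTE ki) mulr0 subrr !mul0r scale0r //.
  by rewrite /T /shiftby => <-; apply/rowP => k; rewrite !(rowBE, rowDE); ring.
pose y := T 0 (q i) + (be / 2 * sg i) *: evec R (j i).
have Oy : D (axis i sbar) y.
  rewrite (DE Sa) /=; set u := ti _ y.
  have Tu : T (axis i sbar) (q i) - T (axis i sbar) u = (be / 2 * sg i) *: evec R (j i).
    by rewrite (Kti Sa) Tq /y opprD addrACA subrr add0r -scalerBl; congr (_ *: _); field.
  have err := shiftby_translate lam0 (fam_lip Sa) lam8 (sg1 i) (ltW be2) Tu.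
  apply: (cone_strict co _ _ cq be2 err); first by rewrite subrr normr0 mulr_gt0.
  rewrite -/(q i) distrC; apply: le_lt_trans (shiftby_dist_ge2 (q i) u lam2 (fam_lip Sa)) _.
  rewrite -/(T _) Tu normrZ norm_evec mulr1 normrM sg1 mulr1 ger0_norm ?(ltW be2) //; lra.
have nclD : ~ closure Om (ti 0 y).
  set u := ti 0 y => cu; apply: nOq.
  have Tu : T 0 u - T 0 (q i) = (be / 2 * sg i) *: evec R (j i).
    by rewrite (Kti S0) /y addrAC subrr add0r.
  have err := shiftby_translate lam0 (fam_lip S0) lam8 (sg1 i) (ltW be2) Tu.
  apply: (cone_strict co _ _ cu be2 err); last by rewrite subrr normr0 mulr_gt0.
  rewrite -/(q i); apply: le_lt_trans (shiftby_dist_ge2 u (q i) lam2 (fam_lip S0)) _.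
  rewrite -/(T _) Tu normrZ norm_evec mulr1 normrM sg1 mulr1 ger0_norm ?(ltW be2) //; lra.
have By : Bs i y.
  rewrite /Bs /= /y -/(p i) opprD addrA subrr sub0r normrN normrZ norm_evec mulr1 normrM sg1 mulr1.
  rewrite ger0_norm ?(ltW be2) //; lra.
pose W : set 'rV[R]_n := D (axis i sbar) `&` [set y | (~` closure Om) (ti 0 y)] `&` Bs i.
have oW : open W.
  apply: openI; first apply: openI; first exact: D_open.
    apply: open_comp; last by apply: closed_openC; exact: closed_closure.
    by move=> x _; exact: inverse_continuous lam2 (fam_lip S0) (Kti S0) x.
  have -> : Bs i = ball (p i) (3 * e).
    by apply/seteqP; split => x; rewrite /Bs /= -ball_normE.
  exact: ball_open.
have [d d0 Hd] : exists2 d : R, 0 < d & forall u, `|y - u| < d -> W u.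
  by apply: open_ball_in => //; split => //; split.
pose N : set (BR R n) := [set u : 'rV[R]_n | `|y - u| < d].
have mN : measurable N by exact: measurable_supball.
have Npos : (0 < mu N)%E by exact: volume_ball_gt0.
rewrite -lte_fin -!vol_fin //.
have mI tau : 0 <= tau <= sbar -> measurable (Bs i `&` D (axis i tau) : set (BR R n)).
  by move=> H; apply: measurableI => //; apply: mD; exact: S_axis.
apply: (@lt_le_trans _ _ (mu (Bs i `&` D (axis i 0)) + mu N)%E).
  by rewrite lteDl // vol_fin.
rewrite -measureU //; last 2 first.
- exact: mI.
- apply/seteqP; split => // u [[_ Du] /Hd[[_ ncl] _]].
  apply: ncl; apply: subset_closure; move: Du; rewrite ax0 (DE S0) //.
apply: le_measure; rewrite ?inE; [by apply: measurableU => //; exact: mI|exact: mI|].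
move=> u [|/Hd[[Du _] Bu]]; last by split.
by apply: vol_mono_sub => //; exact: ltW.
Qed.

(** Extends [vol] to the whole line, so that sequences and the intermediate value theorem need not
    respect the interval on which the family is controlled. *)
Let clamp (tau : R) : R := Num.min sbar (Num.max 0 tau).

Let clampP tau : 0 <= clamp tau <= sbar.
Proof. by rewrite /clamp le_min ge_min lexx /= le_max lexx /= andbT ltW. Qed.

Let clampK tau : 0 <= tau <= sbar -> clamp tau = tau.
Proof. by move=> /andP[h1 h2]; rewrite /clamp max_r // min_r. Qed.

Let clamp_cont : continuous clamp.
Proof.
apply: min_fun_continuous; first by move=> x; exact: cvg_cst.
by apply: max_fun_continuous => x; [exact: cvg_cst|exact: cvg_id].
Qed.

Let fam_axis_dist i tau tau' x :
  `|family (axis i tau) x - family (axis i tau') x| <= `|tau - tau'| * M.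
Proof.
rewrite fam_diff (bigD1 i) //= big1 ?addr0 => [|k ki].
  rewrite !axis_i normrZ norm_evec mulr1 !normrM sg1 mulr1 ler_wpM2l //.
  by rewrite ger0_norm.
by rewrite !rowZE mxE (negbTE ki) !mulr0 subrr !mul0r scale0r.
Qed.

Let indic_int i : mu.-integrable setT (EFin \o (\1_(Bs i) : BR R n -> R)).
Proof.
apply/integrableP; split; first by apply/measurable_EFinP; exact: measurable_indic.
rewrite (eq_integral (EFin \o (\1_(Bs i) : BR R n -> R))) => [|y _].
  by rewrite integral_indic // setIT; exact: Bs_lty.
by rewrite /= ger0_norm // indicE.
Qed.

(** The boundary of the limit domain is null and memberships stabilise off it; the indicator of the
    box dominates. *)
Let vol_cont i : continuous (fun tau => vol i (clamp tau)).
Proof.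
move=> tau; apply/(@cvg_nbhsP R R^o (fun tau => vol i (clamp tau))) => u cu.
have Sc t' : S (axis i (clamp t')) by apply: S_axis; exact: clampP.
have mI t' : measurable (Bs i `&` D (axis i (clamp t')) : set (BR R n)).
  by apply: measurableI => //; exact: mD.
have [mN N0] := null_boundary Hmu lam0 lam8 (fam_lip (Sc tau)) (tiK (Sc tau)) (Kti (Sc tau)) HO.
have volE t' : vol i (clamp t') = (\int[mu]_(y in Bs i `&` D (axis i (clamp t'))) 1)%R.
  by rewrite Rintegral_cst // mul1r.
rewrite volE; under eq_cvg do rewrite volE.
apply: (cvg_Rintegral_moving (F_ := fun _ => cst 1) (F := cst 1) (g := \1_(Bs i))
   (N := [set y | bdry Om (ti (axis i (clamp tau)) y)])) => //.
- by move=> k y [By _]; rewrite indicE mem_set // normr1.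
- have cv (e1 : R) : 0 < e1 -> \forall k \near \oo, forall x,
      `|family (axis i (clamp (u k))) x - family (axis i (clamp tau)) x| <= e1.
    move=> e10; have M10 : 0 < M + 1 by apply: ltr_wpDl.
    have cc : clamp (u k) @[k --> \oo] --> clamp tau := cvg_comp _ _ cu (@clamp_cont tau).
    have e11 : 0 < e1 / (M + 1) by rewrite divr_gt0.
    move/cvgrPdist_le: cc => /(_ _ e11); apply: filterS => k /= hk x.
    apply: le_trans (fam_axis_dist _ _ _ _) _; rewrite distrC.
    rewrite ler_pdivlMr // in hk; apply: le_trans hk; rewrite ler_wpM2l //; lra.
  move=> y /(deform_stable lam2 (fun k => fam_lip (Sc (u k))) (fun k => Kti (Sc (u k)))
      (Kti (Sc tau)) oO cv).
  apply: filterS => k; rewrite !DE //= => -[h1 h2].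
  by split=> -[By Oy]; split => //; [apply: h1|apply: h2].
by move=> y _; exact: cvg_cst.
Qed.

(** Intermediate value theorem; [A] is a common lower bound for the total gains of the n boxes. *)
Let vol_attained : exists2 A : R, 0 < A & forall i alpha, 0 <= alpha <= A ->
  exists2 tau, 0 <= tau <= sbar & vol i tau = vol i 0 + alpha.
Proof.
have [A A0 HA] : exists2 A, 0 < A & forall i, A <= vol i sbar - vol i 0.
  apply: fin_pos_common => [i|i A A' _ AA]; last exact: le_trans.
  by exists (vol i sbar - vol i 0); rewrite // subr_gt0 vol_strict.
exists A => // i al /andP[al0 alA].
have vs := ltW (vol_strict i).
have [] := @IVT R (fun tau => vol i (clamp tau)) 0 sbar (vol i 0 + al).
- exact: ltW.
- exact: continuous_subspaceT (@vol_cont i).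
- rewrite !clampK // (min_idPl vs) (max_idPr vs).
  have := HA i; lra.
move=> tau; rewrite in_itv /= => Ht; rewrite clampK // => E.
by exists tau.
Qed.

Lemma family_morse : exists s : 'rV[R]_n, (forall i, 0 <= s ord0 i <= sbar) /\
  forall z, `|z - z0| <= e / 4 ->
    ~ degenerate_crit (psi (deform Om (family s))) (shiftby (family s) z).
Proof.
have [A A0 HA] := vol_attained.
have /choice[sel Hsel] : forall ial : 'I_n * R, exists tau, 0 <= ial.2 <= A ->
    0 <= tau <= sbar /\ vol ial.1 tau = vol ial.1 0 + ial.2.
  move=> [i al]; have [h|h] := pselect (0 <= al <= A); last by exists 0.
  by have [tau h1 h2] := HA i al h; exists tau.
pose sl (a : 'rV[R]_n) : 'rV[R]_n := \row_i sel (i, a ord0 i).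
pose P (a : 'rV[R]_n) := forall i, 0 <= a ord0 i <= A.
have Ssl a : P a -> S (sl a) by move=> Pa i; rewrite mxE; exact: (Hsel (i, _) (Pa i)).1.
have vsl a i : P a -> vol i (sl a ord0 i) = vol i 0 + a ord0 i.
  by move=> Pa; rewrite mxE; exact: (Hsel (i, _) (Pa i)).2.
(* [sel] is an arbitrary choice of amplitudes, yet monotone: a smaller amplitude has no larger
   volume, and equal volumes select the same amplitude. *)
have sl_mono a a' i : P a -> P a' -> a ord0 i <= a' ord0 i ->
    sl a ord0 i <= sl a' ord0 i.
  move=> Pa Pa' aa; rewrite leNgt; apply/negP => ss.
  have := vol_mono i (Ssl a' Pa' i) (Ssl a Pa i) (ltW ss).
  rewrite !vsl // lerD2l => aa'.
  by move: ss; rewrite !mxE (le_anti (introT andP (conj aa aa'))) ltxx.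
have e0' := e0.
have [|||||||a [Pa Ha]] := @volume_family_morse R m mu Hmu A e x0 (D \o sl) Bs t A0 e0 t0.
- by move=> a Pa; apply: D_open; exact: Ssl.
- by move=> a x Pa; apply: D_away; exact: Ssl.
- exact: mBs.
- exact: Bs_disj.
- move=> a a' y Pa Pa' Dy nDy.
  have [l [ll Bl]] := D_local (Ssl a Pa) (Ssl a' Pa') Dy nDy.
  exists l; split => //; rewrite ltNge; apply/negP => aa.
  by have := sl_mono a a' l Pa Pa' aa; rewrite leNgt ll.
- move=> a a' i Pa Pa' aa.
  have Hs := Ssl a Pa; have Hs' := Ssl a' Pa'.
  have -> : Bs i `&` (D (sl a') `\` D (sl a)) =
     (Bs i `&` D (sl a')) `\` (Bs i `&` D (sl a)).
    apply/seteqP; split => y; first by move=> [h1 [h2 h3]]; split => // -[_].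
    by move=> [[h1 h2] h3]; split => //; split => // h4; apply: h3.
  have sub : Bs i `&` D (sl a) `<=` Bs i `&` D (sl a').
    rewrite (D_axis i Hs) (D_axis i Hs').
    by apply: vol_mono_sub; [exact: Hs|exact: Hs'|exact: sl_mono].
  rewrite measureD; last 3 first.
  - by apply: measurableI => //; exact: mD.
  - by apply: measurableI => //; exact: mD.
  - by rewrite (D_axis i Hs'); apply: le_lt_trans (ltry (vol i (sl a' ord0 i)));
       rewrite -(vol_fin i (Hs' i)).
  rewrite (setIidr sub) (D_axis i Hs) (D_axis i Hs').
  apply: (etrans (congr2 (fun x y => x - y)%E (vol_fin i (Hs' i)) (vol_fin i (Hs i)))).
  by rewrite !vsl // -EFinB; congr (_%:E); ring.
- exact: Bs_dir.
exists (sl a); split; first exact: Ssl.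
have Hs := Ssl a Pa.
move=> z zz [G H]; move: H; rewrite -/(D (sl a)) Ha //.
rewrite -/(T (sl a)) /x0.
have -> : T (sl a) z = T 0 z by rewrite /T /shiftby fam_near //; lra.
apply: le_trans (shiftby_dist_le _ _ (fam_lip S0)) _.
rewrite (_ : e / 2 = 2 * (e / 4)); last by field.
by apply: ler_pM => //; [rewrite addr_ge0|have := lam2; lra].
Qed.

End Family.

(** * Density and residuality *)

Section Density.
Context {R : realType} {m : nat}.
Local Notation n := m.+1.
Context (mu : {sigma_finite_measure set (BR R n) -> \bar R}) (Hmu : is_volume mu).
Implicit Types (Om : set 'rV[R]_n) (th : 'rV[R]_n -> 'rV[R]_n).

Lemma C2bd_sum (I : Type) (s : seq I) (c : I -> R) (f : I -> 'rV[R]_n -> R) (M : R) :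
  (forall i, C2bd M (f i)) ->
  C2bd (\sum_(i <- s) `|c i| * M) (fun x => \sum_(i <- s) c i * f i x).
Proof.
move=> H; elim: s => [|i s IH].
  have := @C2bd_cst R n 0; rewrite normr0 big_nil.
  by congr (C2bd _ _); apply/funext => x; rewrite big_nil.
have := C2bd_lin (c i) 1 (H i) IH; rewrite normr1 mul1r big_cons.
by congr (C2bd _ _); apply/funext => x; rewrite big_cons mul1r.
Qed.

(** [e] is fixed before [th] and [eps]. One cube around z0 therefore works for all maps, which the
    covering by countably many cubes requires. *)
Lemma nondegenerate_perturbation Om (rho : R) z0 : 0 < rho ->
  n%:R * rho <= 1 / (16 * n%:R) -> smooth_bounded_open Om -> Om z0 ->
  exists2 e : R, 0 < e & forall th eps, Bball rho th -> 0 < eps ->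
    exists ph, [/\ Bball rho ph, (C2dist th ph < eps%:E)%E &
      forall z, `|z - z0| <= e ->
        ~ degenerate_crit (psi (deform Om ph)) (shiftby ph z)].
Proof.
move=> rho0 l16 HO Oz; have [t [sg [j [e LD]]]] := local_data_exists HO Oz.
have [e0 _ Hi] := LD.
exists (e / 4) => [|th eps Bth eps0]; first by rewrite divr_gt0.
pose b i : 'rV[R]_n -> R := bump (z0 + t i *: evec R i) e.
have [M M0 HM] : exists2 M, 0 < M & forall i, C2bd M (b i).
  have [M M0 HM] : exists2 M, 0 <= M & forall i, C2bd M (b i).
    apply: fin_bound_common => [i|i C C']; last exact: C2bd_le.
    by have [M M0 HM] := bump_C2bd (z0 + t i *: evec R i) e0; exists M => //; exact: ltW.
  exists (M + 1) => [|i]; first exact: ltr_wpDl.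
  by apply: C2bd_le (HM i); rewrite lerDl.
have n0 : 0 < n%:R :> R by rewrite ltr0n.
(* Shrinking [th] by 1 - eta frees eta rho of the norm and moves it by at most eps/4. *)
pose eta := Num.min 1 (eps / (4 * rho)).
have eta0 : 0 < eta by rewrite lt_min ltr01 divr_gt0 // mulr_gt0.
have eta1 : eta <= 1 by rewrite ge_min lexx.
have eta_eps : eta * rho <= eps / 4.
  rewrite (_ : eps / 4 = eps / (4 * rho) * rho); last by field; rewrite gt_eqF.
  by rewrite ler_pM2r // ge_min lexx orbT.
(* Bound for the C2 size of all bumps together: within the freed norm, within eps/4 so that the
   total change is at most eps/2, and within the displacement e allowed by [family_morse]. *)
pose w := Num.min (eta * rho) (Num.min (eps / 4) e).
have w0 : 0 < w by rewrite !lt_min mulr_gt0 // divr_gt0.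
have w1 : w <= eta * rho by rewrite ge_min lexx.
have w2 : w <= eps / 4 by rewrite !ge_min lexx orbT.
have w3 : w <= e by rewrite !ge_min lexx !orbT.
pose sbar := w / (n%:R * M).
have sbar0 : 0 < sbar by rewrite divr_gt0 // mulr_gt0.
have sbarE : n%:R * sbar * M = w by rewrite /sbar; field; rewrite !gt_eqF.
pose th' x := (1 - eta) *: th x.
pose S (s : 'rV[R]_n) := forall i, 0 <= s ord0 i <= sbar.
pose fam s := family sg j th' b s.
pose c (s : 'rV[R]_n) (k i : 'I_n) := s ord0 i * sg i * evec R (j i) ord0 k.
have famE s k x : fam s x ord0 k = (1 - eta) * th x ord0 k + \sum_i c s k i * b i x.
  rewrite /fam /family rowDE rowZE summxE; congr (_ + _); apply: eq_bigr => i _.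
  by rewrite rowZE /c; ring.
have c_le s k : S s -> \sum_i `|c s k i| * M <= w.
  move=> Ss; rewrite -sbarE -mulrA (_ : n%:R * _ = \sum_(i < n) sbar * M); last first.
    by rewrite sumr_const card_ord mulr_natl.
  apply: ler_sum => i _; rewrite ler_pM2r // /c !normrM.
  have [_ -> _ _ _] := Hi i; rewrite mulr1; have /andP[h1 h2] := Ss i.
  rewrite (ger0_norm h1) -[leRHS]mulr1; apply: ler_pM => //.
  by rewrite mxE; case: ifP => _; rewrite ?normr1 ?normr0.
have /BballP Bth' := Bth.
have famB s : S s -> Bball rho (fam s).
  move=> Ss; apply/BballP => k.
  have H := C2bd_lin (1 - eta) 1 (Bth' k) (C2bd_sum (index_enum 'I_n) (c s k) HM).
  rewrite (_ : Defs.comp k (fam s) = (fun x => (1 - eta) * Defs.comp k th x +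
     1 * \sum_i c s k i * b i x)); last first.
    by apply/funext => x; rewrite mul1r; exact: famE.
  apply: C2bd_le H; rewrite normr1 mul1r ger0_norm ?subr_ge0 //.
  by have := c_le s k Ss; lra.
have famD s : S s -> (C2dist th (fam s) < eps%:E)%E.
  move=> Ss; apply: (@C2dist_lt _ _ (eps / 2)) => [|k]; first lra.
  have H := C2bd_lin eta (- 1) (Bth' k) (C2bd_sum (index_enum 'I_n) (c s k) HM).
  rewrite (_ : Defs.comp k _ = (fun x => eta * Defs.comp k th x +
     - 1 * \sum_i c s k i * b i x)); last first.
    by apply/funext => x; rewrite /Defs.comp rowBE famE; ring.
  apply: C2bd_le H; rewrite normrN normr1 mul1r ger0_norm ?(ltW eta0) //.
  by have := c_le s k Ss; lra.
have l0 : 0 <= n%:R * rho by rewrite mulr_ge0 // ltW.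
have [|||||||s [Ss Hs]] := @family_morse R m mu Hmu Om HO z0 t sg j e LD (n%:R * rho) l0 l16
    th' b M sbar.
- by move=> i x; exact: bump_supp.
- by move=> i x; exact: bump_ge0.
- by move=> i x; have [_ /(_ (b i) (or_introl erefl) x)] := HM i; rewrite ler_norml => /andP[].
- by move=> i; exact: bump_center.
- exact: sbar0.
- by rewrite sbarE.
- by move=> s Ss; apply: Bball_lip (famB s Ss); exact: ltW.
by exists (fam s); split; [exact: famB|exact: famD|exact: Hs].
Qed.

End Density.

(** * Countable covering by cubes and the residual set *)

Section Residual.
Context {R : realType} {m : nat}.
Local Notation n := m.+1.

Lemma closed_cube_compact (c : 'rV[R]_n) (r : R) : 0 < r -> compact [set u : 'rV[R]_n | `|c - u| <= r].
Proof.
move=> r0; apply: bounded_closed_compact.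
  exists (`|c| + r); split; first exact: num_real.
  move=> M hM u /= hu; apply: ltW; apply: le_lt_trans hM.
  by have := ler_normB c (c - u); rewrite opprB addrCA subrr addr0; lra.
by have := @closed_ball_closed _ _ c r; rewrite closed_ballE.
Qed.

Definition rat_cube (ck : 'rV[rat]_n * nat) : set 'rV[R]_n :=
  [set u | `|map_mx ratr ck.1 - u| <= ck.2.+1%:R^-1].

Lemma rat_cube_inside (z : 'rV[R]_n) (e : R) : 0 < e ->
  exists2 ck, rat_cube ck z & forall u, rat_cube ck u -> `|z - u| < e.
Proof.
move=> e0; have e20 : 0 < e / 2 by rewrite divr_gt0.
have [k _ /(_ k (leqnn _)) /= hk] := near_infty_natSinv_lt (PosNum e20).
have k0 : 0 < k.+1%:R^-1 :> R by rewrite invr_gt0.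
have [c hc] := row_rat_approx z k0.
exists (c, k) => [|u /= hu]; first by rewrite /rat_cube /= distrC ltW.
have := ler_normD (z - map_mx ratr c) (map_mx ratr c - u).
rewrite addrA subrK => h; apply: le_lt_trans h _; rewrite (splitr e).
by apply: ltr_leD; [exact: lt_trans hc hk|exact: le_trans hu (ltW hk)].
Qed.

End Residual.

Theorem theoremA1 (R : realType) (n : nat) (Om : set 'rV[R]_n) :
  (3 <= n)%N -> smooth_bounded_open Om ->
  exists rho : R, 0 < rho /\
    residual_in (Bball rho)
      [set th | Bball rho th /\ Morse_on (deform Om th) (psi (deform Om th))].
Proof.
case: n Om => // m Om _ HO; pose n := m.+1.
have [mu Hmu] := @volume_exists R n.
have n0 : 0 < n%:R :> R by rewrite ltr0n.
(* Makes the Lipschitz constant n rho equal to 1/(16n), the bound under which bump directions are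
   controlled; null boundaries ask for 1/(8n). *)
pose rho : R := 1 / (16 * n%:R) / n%:R.
have rho0 : 0 < rho by rewrite !divr_gt0 // mulr_gt0.
have nrho : n%:R * rho = 1 / (16 * n%:R) by rewrite /rho mulrC divfK // gt_eqF.
have l16 : n%:R * rho <= 1 / (16 * n%:R) by rewrite nrho.
have l8 : n%:R * rho <= 1 / (8 * n%:R).
  rewrite nrho !div1r lef_pV2 ?posrE ?mulr_gt0 // ler_wpM2r ?ler_nat //; exact: ltW.
have l02 : 0 <= n%:R * rho <= 1 / 2.
  apply/andP; split; first by rewrite mulr_ge0 // ltW.
  apply: le_trans l8 _.
  rewrite !div1r lef_pV2 ?posrE ?mulr_gt0 //.
  have : 1 <= n%:R :> R by rewrite ler1n.
  lra.
have [oO _ _] := HO.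
exists rho; split=> //; split=> [th []//|].
have psiC th : Bball rho th -> Ck 2 (deform Om th) (psi (deform Om th)).
  move=> Bth; apply: (psi_C2 (ltn0Sn m) Hmu _).1.
  exact: deform_open l02 (Bball_lip (ltW rho0) Bth) oO.
(* Compact inclusion in [Om] gives closedness and the approximation clause gives empty interior. For
   other cubes, and for numbers that code no cube, [F k] is empty. *)
pose good (K : set 'rV[R]_n) := K `<=` Om /\ forall th eps, Bball rho th -> 0 < eps ->
  exists ph, [/\ Bball rho ph, (C2dist th ph < eps%:E)%E & ~ degenerate_maps Om rho K ph].
pose F k := [set th | exists ck : 'rV[rat]_n * nat,
  [/\ unpickle k = Some ck, good (rat_cube ck) & degenerate_maps Om rho (rat_cube ck) th]].
have FE k : F k = set0 \/ exists ck, good (rat_cube ck) /\ F k = degenerate_maps Om rho (rat_cube ck).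
  case E : (unpickle k : option ('rV[rat]_n * nat)) => [ck|]; last first.
    by left; apply/seteqP; split => th // -[ck []]; rewrite E.
  have [g|ng] := pselect (good (rat_cube ck)); [right; exists ck; split => //|left];
    apply/seteqP; split => th //.
  - by move=> [ck' []]; rewrite E => -[<-].
  - by move=> H; exists ck.
  - by move=> [ck' []]; rewrite E => -[<-].
exists F; split=> [k|].
  have [->|[ck [g ->]]] := FE k.
    split; last by move=> [th [eps []]].
    by split=> // th _ /(_ 1 ltr01)[ph []].
  split.
    by apply: (degenerate_maps_closed Hmu (ltW rho0) l8 HO _ g.1); apply: closed_cube_compact; rewrite invr_gt0.
  move=> [th [eps [[Bth _] eps0 H]]]; have [ph [Bph d nF]] := g.2 th eps Bth eps0.
  by apply: nF; exact: H.
apply/seteqP; split => th; last first.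
  move=> [k _ [ck [_ [KO _] [Bth [z [Kz [G H]]]]]]]; split=> // -[_ [_ M]].
  by move: H; rewrite M //; exists z => //; exact: KO.
move=> [Bth nM].
(* Since [psi] is C2 on every deformed domain, failing to be Morse means having a degenerate
   critical point. *)
have [z [Oz dz]] : exists z, Om z /\ degenerate_crit (psi (deform Om th)) (shiftby th z).
  apply: contrapT => nz; apply: nM; split=> //; split; first exact: psiC.
  move=> _ [z Oz <-] G; apply: contrapT => /negP H; apply: nz; exists z; split=> //.
have [e e0 He] := nondegenerate_perturbation Hmu rho0 l16 HO Oz.
have [d d0 Hd] := open_ball_in oO Oz.
have [|ck Kz HK] := @rat_cube_inside R m z (Num.min e d); first by rewrite lt_min e0.
have g : good (rat_cube ck).
  split=> [u /HK|th' eps Bth' eps0]; first by rewrite lt_min => /andP[_ /Hd].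
  have [ph [Bph dph nd]] := He th' eps Bth' eps0; exists ph; split=> //.
  move=> [_ [u [/HK]]]; rewrite lt_min => /andP[ue _]; apply: nd.
  by rewrite distrC ltW.
by exists (pickle ck) => //; exists ck; split=> //; [exact: pickleK|split=> //; exists z].
Qed.
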